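(* The problem \textsc{Fair Discrete Means Cluster Editing} restricted to binary matrices (entries in $\{0,1\}$), denoted FDMC$_2$, is W[1]-hard when parameterized by $\tilde{c}+k$, where $\tilde{c}$ is the fairlet size and $k$ the edit budget; this holds even when restricted to instances in which the input matrix $M$ already has at most $r$ distinct rows.
   Context: An instance of \textsc{Fair Discrete Means Cluster Editing} (FDMC) consists of an $m\times n$ matrix $M$ (over some finite domain), a vector $\gamma\in[c]^m$ (the color of row $i$ is $\gamma[i]$), and positive integers $k$ and $r$. A cluster of a matrix is a maximal set of pairwise identical rows. For a color $i\in[c]$ let $|\gamma|_i$ be the number of entries of $\gamma$ equal to $i$. A matrix $M'$ with $m$ rows is fair (w.r.t. $\gamma$) if every cluster $S$ of $M'$ contains exactly $\frac{|\gamma|_i}{m}|S|$ rows of color $i$, for every $i\in[c]$. The task is to decide whether there exists a fair $m\times n$ matrix $M'$ that differs from $M$ in at most $k$ entries and has at most $r$ distinct rows. The fairlet size is $\tilde{c}=m/\gcd(|\gamma|_1,\dots,|\gamma|_c)$, the minimum size of a nonempty fair set of rows. FDMC$_2$ is the restriction to instances where $M$ has at most two distinct entries (binary matrices). *)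

(* Defs.v *)
From mathcomp Require Import all_boot all_algebra.

Set Implicit Arguments.
Unset Strict Implicit.
Unset Printing Implicit Defensive.

(** * Model of computation

    Jones' WHILE language on binary trees.  An assignment is charged the size
    of the tree it stores, so that the total size of a store never exceeds the
    size of the initial one plus the cost of the computation; hence WHILE
    programs and multitape Turing machines simulate each other with polynomial
    overhead, for computing functions as well as for deciding sets. *)

Inductive tree : Type := Leaf | Node of tree & tree.

Fixpoint tsize (t : tree) : nat :=
  if t is Node l r then (tsize l + tsize r).+1 else 1.

Inductive expr : Type :=
| EVar of nat
| ENil
| ECons of expr & expr
| EHd of expr
| ETl of expr.

Inductive cmd : Type :=
| Skip
| Assign of nat & expr
| Seq of cmd & cmd
| If of expr & cmd & cmd
| While of expr & cmd.

Definition store : Type := nat -> tree.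

Definition update (s : store) (x : nat) (t : tree) : store :=
  fun y => if y == x then t else s y.

Definition thd (t : tree) : tree := if t is Node l _ then l else Leaf.
Definition ttl (t : tree) : tree := if t is Node _ r then r else Leaf.
Definition truthy (t : tree) : bool := if t is Node _ _ then true else false.

Fixpoint eval (s : store) (e : expr) : tree :=
  match e with
  | EVar x => s x
  | ENil => Leaf
  | ECons e1 e2 => Node (eval s e1) (eval s e2)
  | EHd e1 => thd (eval s e1)
  | ETl e1 => ttl (eval s e1)
  end.

(** [exec c s n s']: from [s], [c] terminates in [s'] at cost [n]. *)
Inductive exec : cmd -> store -> nat -> store -> Prop :=
| ExecSkip s : exec Skip s 1 s
| ExecAssign s x e :
    exec (Assign x e) s (tsize (eval s e)).+1 (update s x (eval s e))
| ExecSeq c1 c2 s1 s2 s3 n1 n2 :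
    exec c1 s1 n1 s2 -> exec c2 s2 n2 s3 -> exec (Seq c1 c2) s1 (n1 + n2) s3
| ExecIfTrue e c1 c2 s s' n :
    truthy (eval s e) -> exec c1 s n s' -> exec (If e c1 c2) s n.+1 s'
| ExecIfFalse e c1 c2 s s' n :
    ~~ truthy (eval s e) -> exec c2 s n s' -> exec (If e c1 c2) s n.+1 s'
| ExecWhileFalse e c s :
    ~~ truthy (eval s e) -> exec (While e c) s 1 s
| ExecWhileTrue e c s1 s2 s3 n1 n2 :
    truthy (eval s1 e) -> exec c s1 n1 s2 -> exec (While e c) s2 n2 s3 ->
    exec (While e c) s1 (n1 + n2).+1 s3.

(** Input and output are both held by variable 0. *)
Definition outputs (c : cmd) (x : tree) (n : nat) (y : tree) : Prop :=
  exists2 s : store, exec c (update (fun=> Leaf) 0 x) n s & s 0 = y.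

(** * Encodings *)

(** Numbers are written in unary.  This does not affect parameterized
    reducibility: each encoded number either is at most the parameter (weight,
    budget), or is less than the size of the rest of the instance (gate
    numbers), or may be brought below it without changing the answer (the bound
    on the number of distinct rows, by capping it at the number of rows; the
    colors, by renaming the at most [m] colors in use). *)
Definition tnat (n : nat) : tree := iter n (Node Leaf) Leaf.

Definition tbool (b : bool) : tree := tnat b.

Definition tseq (s : seq tree) : tree := foldr Node Leaf s.

(** * Parameterized problems and reductions *)

Record pproblem : Type := PProblem {
  inst : Type;
  code : inst -> tree;
  param : inst -> nat;
  yes : inst -> Prop }.

Definition restrict (P : pproblem) (Q : inst P -> Prop) : pproblem :=
  @PProblem {x : inst P | Q x}
    (fun x => code (sval x)) (fun x => param (sval x)) (fun x => yes (sval x)).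

(** As usual, an instance is presented together with its parameter. *)
Definition pcode (P : pproblem) (x : inst P) : tree :=
  Node (code x) (tnat (param x)).

Definition computable (f : nat -> nat) : Prop :=
  exists c : cmd, forall k, exists n, outputs c (tnat k) n (tnat (f k)).

(** Parameterized (many-one, strongly uniform) reduction: computable in time
    [f(k) * |x|^e], with the new parameter at most [g(k)]. *)
Definition fpt_reducible (P Q : pproblem) : Prop :=
  exists (R : inst P -> inst Q) (c : cmd) (f g : nat -> nat) (e : nat),
    [/\ computable f,
        computable g,
        forall x, yes x <-> yes (R x),
        forall x, param (R x) <= g (param x)
      & forall x, exists2 n, outputs c (pcode x) n (pcode (R x))
                           & n <= f (param x) * tsize (pcode x) ^ e].

(** * Weighted circuit satisfiability and the W-hierarchy *)

(** A circuit is given by its gates in a topological order; the arguments of a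
    gate are positions in that list. *)
Inductive gate : Type :=
| GInput
| GNot of nat
| GAnd of seq nat
| GOr of seq nat.

Definition is_input (g : gate) : bool := if g is GInput then true else false.

Definition gate_args (g : gate) : seq nat :=
  match g with
  | GInput => [::]
  | GNot j => [:: j]
  | GAnd js | GOr js => js
  end.

Definition gate_ok (i : nat) (g : gate) : bool :=
  (is_input g || (0 < size (gate_args g)))
    && all (fun j => j < i) (gate_args g).

Record circuit : Type := Circuit {
  gates : seq gate;
  output : nat;
  gates_ok :
    forall i, i < size gates -> gate_ok i (nth GInput gates i);
  output_ok : output < size gates }.

(** Bottom-up evaluation: [step i g v] is the value at gate [g] in position
    [i], given the values [v j] at the earlier positions [j]. *)
Definition run (A : Type) (a0 : A) (step : nat -> gate -> (nat -> A) -> A)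
    (gs : seq gate) : seq A :=
  foldl (fun vs g => rcons vs (step (size vs) g (nth a0 vs))) [::] gs.

Definition circuit_value (C : circuit) (a : nat -> bool) : bool :=
  nth false
    (run false (fun i g v =>
       match g with
       | GInput => a i
       | GNot j => ~~ v j
       | GAnd js => all v js
       | GOr js => has v js
       end) (gates C))
    (output C).

(** Maximal [w]-weight of a path of the circuit ending at its output. *)
Definition longest_path (w : gate -> nat) (C : circuit) : nat :=
  nth 0
    (run 0 (fun _ g v => w g + \max_(j <- gate_args g) v j) (gates C))
    (output C).

Definition depth (C : circuit) : nat :=
  longest_path (fun g => ~~ is_input g : nat) C.

(** Large gates are those of fan-in greater than 2. *)
Definition weft (C : circuit) : nat :=
  longest_path (fun g => 2 < size (gate_args g) : nat) C.

Definition weight (C : circuit) (a : nat -> bool) : nat :=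
  \sum_(i < size (gates C)) (is_input (nth GInput (gates C) i) && a i).

Definition tgate (g : gate) : tree :=
  match g with
  | GInput => Node (tnat 0) Leaf
  | GNot j => Node (tnat 1) (tnat j)
  | GAnd js => Node (tnat 2) (tseq [seq tnat j | j <- js])
  | GOr js => Node (tnat 3) (tseq [seq tnat j | j <- js])
  end.

Definition tcircuit (C : circuit) : tree :=
  Node (tseq [seq tgate g | g <- gates C]) (tnat (output C)).

Definition WCS : pproblem :=
  @PProblem (circuit * nat)
    (fun x => Node (tcircuit x.1) (tnat x.2))
    (fun x => x.2)
    (fun x => exists2 a : nat -> bool,
       weight x.1 a = x.2 & circuit_value x.1 a).

Definition WCS_weft_depth (t d : nat) : pproblem :=
  @restrict WCS (fun x => (weft x.1 <= t) && (depth x.1 <= d)).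

Definition W (t : nat) (P : pproblem) : Prop :=
  exists d : nat, fpt_reducible P (WCS_weft_depth t d).

Definition W_hard (t : nat) (Q : pproblem) : Prop :=
  forall P : pproblem, W t P -> fpt_reducible P Q.

(** * Fair Discrete Means Cluster Editing *)

Section FairMatrices.

Variables (D : finType) (m n c : nat).
Implicit Types (M : 'M[D]_(m, n)) (gamma : {ffun 'I_m -> 'I_c}).

Definition identical_rows M (S : {set 'I_m}) : bool :=
  [forall i in S, forall j in S, row i M == row j M].

Definition cluster M (S : {set 'I_m}) : bool := maxset (identical_rows M) S.

Definition color_count gamma (i : 'I_c) : nat := #|[set x | gamma x == i]|.

(** The proportion [|gamma|_i / m] is cleared of its denominator. *)
Definition fair gamma M : Prop :=
  forall S, cluster M S -> forall i : 'I_c,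
    #|[set x in S | gamma x == i]| * m = color_count gamma i * #|S|.

Definition fairlet_size gamma : nat :=
  m %/ \big[gcdn/0]_(i < c) color_count gamma i.

Definition edits M M' : nat :=
  #|[set p : 'I_m * 'I_n | M p.1 p.2 != M' p.1 p.2]|.

Definition distinct_rows M : nat := #|[set row i M | i : 'I_m]|.

End FairMatrices.

Record fdmc (D : finType) : Type := Fdmc {
  nrows : nat;
  ncols : nat;
  ncolors : nat;
  mat : 'M[D]_(nrows, ncols);
  coloring : {ffun 'I_nrows -> 'I_ncolors};
  budget : nat;
  row_bound : nat;
  nrows_gt0 : 0 < nrows;
  ncols_gt0 : 0 < ncols;
  budget_gt0 : 0 < budget;
  row_bound_gt0 : 0 < row_bound }.

Definition fdmc_yes (D : finType) (I : fdmc D) : Prop :=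
  exists M' : 'M[D]_(nrows I, ncols I),
    [/\ fair (coloring I) M',
        edits (mat I) M' <= budget I
      & distinct_rows M' <= row_bound I].

Definition tfdmc2 (I : fdmc bool) : tree :=
  tseq [:: tseq [seq tseq [seq tbool (mat I i j) | j <- enum 'I_(ncols I)]
                | i <- enum 'I_(nrows I)];
           tnat (ncolors I);
           tseq [seq tnat (coloring I i) | i <- enum 'I_(nrows I)];
           tnat (budget I);
           tnat (row_bound I)].

Definition FDMC2 : pproblem :=
  @PProblem (fdmc bool) tfdmc2
    (fun I => fairlet_size (coloring I) + budget I)
    (@fdmc_yes bool).

(* Main.v *)
(** The reduction goes through off-diagonal grid tiling: choose words [u a] and
    [v b] in [U] such that [S a b (u a) (v b)] for all [a <> b] below [C].

    From circuits.  List the selected inputs in increasing order, between two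
    sentinels; an input is selected or not according to two consecutive entries
    of this list.  In a circuit of weft 1 and depth at most [d], every gate that
    is reached from the output, or from an argument of a large gate, through
    small gates only depends on at most [q = 2 ^ d] inputs and large gates.
    Hence, once the values of the [q] large gates near the output are guessed,
    together with an argument deciding each of them, the remaining claims are
    local: each of them is settled by some [2 q] positions of the list.  A row
    or column of the tiling stands for a word of [2 q] positions and chooses the
    entries of the list there, together with the guess; the number of words
    depends on [d] and the weight only.

    To clusters.  There are [C] colors, and each admissible pair of words for
    the tile [(a, b)] gives one row of each color.  A column for the tile has
    one row too many in the colors [a] and [b], and a column for a hub [c] of
    the tile lacks one row of color [c]; these columns are repeated so often
    that some copy of each is edited to its majority count.  So each hub takes in
    one cell of its tile, and one cell of color [a] and one of color [b] leave
    the tile for the side clusters of [b] and of [a] respectively.  The few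
    remaining edits do not suffice unless the words of these cells agree within
    the tile and within the side clusters, which is a solution of the tiling. *)

From HB Require Import structures.
Require Import Defs.
From mathcomp Require Import all_boot all_algebra.
From mathcomp Require Import zify.
Import Defs.

Set Implicit Arguments.
Unset Strict Implicit.
Unset Printing Implicit Defensive.

(** The budget may depend on the parameter only, while a tile has unboundedly many admissible pairs
    of words. So each pair comes in all [C] colors: its rows are identical and fair among
    themselves, and cost nothing as long as none of them moves. Only one pair per tile is broken up.
    The surplus colors [a] and [b] of a tile have to differ, hence no tiles on the diagonal.

    The constants are tight. Vertex columns, one for each word of each row or column of the tiling,
    occur once. Every hub and every side cluster pays a least number of edits there, and these
    numbers sum to [slack]. Hence all of them are attained: no edit remains for a second word in a
    side cluster or for a row outside these clusters.

    A large gate has unboundedly many arguments, but the checks hold for all words of positions, so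
    each argument may have a word of its own. There are [C = 2 (k+2)^(2q)] rows and columns of the
    tiling, a function of [d] and [k], and [(N+2)^(4q)] candidate words, a polynomial for fixed [d],
    where [N] is the number of gates. *)

(** * Encodings of data as trees *)

Class Enc (A : Type) := enc : A -> tree.
#[global] Hint Mode Enc + : typeclass_instances.
#[global] Instance enc_unit : Enc unit := fun=> Leaf.
#[global] Instance enc_nat : Enc nat := tnat.
#[global] Instance enc_bool : Enc bool := tbool.
#[global] Instance enc_pair A B {eA : Enc A} {eB : Enc B} : Enc (A * B) :=
  fun p => Node (enc p.1) (enc p.2).
#[global] Instance enc_seq A {eA : Enc A} : Enc (seq A) :=
  fun s => tseq (map enc s).
#[global] Instance enc_gate : Enc gate := tgate.

Notation esize x := (tsize (enc x)).

Lemma tsize_gt0 t : 0 < tsize t. Proof. by case: t. Qed.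

Lemma tsize_tnat n : tsize (tnat n) = n.*2.+1.
Proof. by elim: n => //= n ->; rewrite add1n. Qed.

Lemma esize_nat (n : nat) : esize n = n.*2.+1.
Proof. exact: tsize_tnat. Qed.

Lemma esize_pair A B {eA : Enc A} {eB : Enc B} (p : A * B) :
  esize p = (esize p.1 + esize p.2).+1.
Proof. by []. Qed.

Lemma esize_cons A {eA : Enc A} (a : A) s :
  esize (a :: s) = (esize a + esize s).+1.
Proof. by []. Qed.

Lemma esize_seq A {eA : Enc A} (s : seq A) :
  esize s = \sum_(a <- s) (esize a).+1 + 1.
Proof.
elim: s => [|a s IHs]; first by rewrite big_nil.
by rewrite esize_cons IHs big_cons; lia.
Qed.

(** Each encoding ends in a leaf, and the concatenation has one of the two. *)
Lemma esize_cat A {eA : Enc A} (s t : seq A) :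
  (esize (s ++ t)).+1 = esize s + esize t.
Proof. by rewrite !esize_seq big_cat /=; lia. Qed.

Lemma esize_gt0 A {eA : Enc A} (x : A) : 0 < esize x.
Proof. exact: tsize_gt0. Qed.

Lemma esize_take A {eA : Enc A} i (s : seq A) : esize (take i s) <= esize s.
Proof.
have := esize_cat (eA := eA) (take i s) (drop i s).
by have := esize_gt0 (eA := enc_seq (eA := eA)) (drop i s); rewrite cat_take_drop; lia.
Qed.

Lemma esize_rev A {eA : Enc A} (s : seq A) : esize (rev s) = esize s.
Proof.
elim: s => // a s IHs; rewrite rev_cons -cats1; apply: succn_inj.
rewrite esize_cat IHs (esize_cons a s).
have -> : esize [:: a] = (esize a).+2 by rewrite esize_cons [esize [::]]/= addn1.
by rewrite addnS; lia.
Qed.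

Lemma esize_size A {eA : Enc A} (s : seq A) : size s < esize s.
Proof. by elim: s => // a s IHs; rewrite esize_cons /=; lia. Qed.

(** ** Polynomially bounded measures *)

Definition pb A {eA : Enc A} (F : A -> nat) : Prop :=
  exists a e, forall x, F x <= a * esize x ^ e.

Section PolynomialBounds.
Context (A : Type) {eA : Enc A}.
Implicit Types F G : A -> nat.

Lemma pb_le F G : pb F -> (forall x, G x <= F x) -> pb G.
Proof. by case=> a [e H] le; exists a, e => x; apply: leq_trans (H x). Qed.

Lemma pb_const n : pb (fun _ : A => n).
Proof. by exists n, 0 => x; rewrite expn0 muln1. Qed.

Lemma pb_size : pb (fun x : A => esize x).
Proof. by exists 1, 1 => x; rewrite expn1 mul1n. Qed.

Lemma pb_add F G : pb F -> pb G -> pb (fun x => F x + G x).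
Proof.
move=> [a [e HF]] [b [f HG]]; exists (a + b), (e + f) => x.
rewrite mulnDl leq_add //.
  by apply: leq_trans (HF x) _; rewrite leq_mul2l leq_pexp2l ?tsize_gt0 ?leq_addr ?orbT.
by apply: leq_trans (HG x) _; rewrite leq_mul2l leq_pexp2l ?tsize_gt0 ?leq_addl ?orbT.
Qed.

Lemma pb_mul F G : pb F -> pb G -> pb (fun x => F x * G x).
Proof.
move=> [a [e HF]] [b [f HG]]; exists (a * b), (e + f) => x.
by rewrite expnD mulnACA leq_mul.
Qed.

Lemma pb_S F : pb F -> pb (fun x => (F x).+1).
Proof. by move=> bF; apply: pb_le (pb_add bF (pb_const 1)) _ => x; rewrite addn1. Qed.

End PolynomialBounds.
Arguments pb_const {A eA} n.
Arguments pb_size {A eA}.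

Lemma leq_exp m n e : m <= n -> m ^ e <= n ^ e.
Proof. by case: e => // e; rewrite leq_exp2r. Qed.

Lemma pb_comp A B {eA : Enc A} {eB : Enc B} (G : B -> nat) (f : A -> B) :
  pb G -> pb (fun x => esize (f x)) -> pb (fun x => G (f x)).
Proof.
move=> [a [e HG]] [b [g Hf]]; exists (a * b ^ e), (g * e) => x.
apply: leq_trans (HG _) _; rewrite -mulnA leq_mul2l expnM -expnMn.
by rewrite leq_exp ?orbT.
Qed.

(** ** Programs with bounded running time *)

(** The store is arbitrary outside variable 0, so that programs compose. *)
Definition computes A B {eA : Enc A} {eB : Enc B} (c : cmd) (F : A -> nat)
    (f : A -> B) : Prop :=
  forall x s, s 0 = enc x ->
  exists n s', [/\ exec c s n s', s' 0 = enc (f x) & n <= F x].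

Definition poly A B {eA : Enc A} {eB : Enc B} (f : A -> B) : Prop :=
  exists c F, pb F /\ computes c F f.

(** A program shifted by [k] runs on the registers from [k] on, so that its caller can keep data in
    the registers below. *)
Fixpoint eshift k e :=
  match e with
  | EVar x => EVar (k + x)
  | ENil => ENil
  | ECons e1 e2 => ECons (eshift k e1) (eshift k e2)
  | EHd e1 => EHd (eshift k e1)
  | ETl e1 => ETl (eshift k e1)
  end.

Fixpoint cshift k c :=
  match c with
  | Skip => Skip
  | Assign x e => Assign (k + x) (eshift k e)
  | Seq c1 c2 => Seq (cshift k c1) (cshift k c2)
  | If e c1 c2 => If (eshift k e) (cshift k c1) (cshift k c2)
  | While e c1 => While (eshift k e) (cshift k c1)
  end.

Lemma eval_shift k e s S :
  (forall i, S (k + i) = s i) -> eval S (eshift k e) = eval s e.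
Proof.
move=> E; elim: e => [x||e1 IH1 e2 IH2|e1 IH1|e1 IH1] /=; rewrite ?E ?IH1 ?IH2 //.
Qed.

Lemma exec_shift k c s n s' : exec c s n s' ->
  forall S, (forall i, S (k + i) = s i) ->
  exists S', [/\ exec (cshift k c) S n S', forall i, S' (k + i) = s' i
                & forall i, i < k -> S' i = S i].
Proof.
elim=> {c s n s'} [s|s x e|c1 c2 s1 s2 s3 n1 n2 _ IH1 _ IH2
  |e c1 c2 s s' n te _ IH|e c1 c2 s s' n te _ IH|e c s te
  |e c s1 s2 s3 n1 n2 te _ IH1 _ IH2] S E /=.
- by exists S; split=> //; constructor.
- exists (update S (k + x) (eval S (eshift k e))); split.
  + by rewrite -(eval_shift e E); constructor.
  + by move=> i; rewrite /update eqn_add2l E (eval_shift _ E).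
  + by move=> i ik; rewrite /update ltn_eqF // ltn_addr.
- have [S2 [X1 E1 F1]] := IH1 S E; have [S3 [X2 E2 F2]] := IH2 S2 E1.
  exists S3; split=> //; first exact: ExecSeq X1 X2.
  by move=> i ik; rewrite F2 ?F1.
- have [S1 [X1 E1 F1]] := IH S E; exists S1; split=> //.
  by apply: ExecIfTrue X1; rewrite (eval_shift _ E).
- have [S1 [X1 E1 F1]] := IH S E; exists S1; split=> //.
  by apply: ExecIfFalse X1; rewrite (eval_shift _ E).
- by exists S; split=> //; constructor; rewrite (eval_shift _ E).
- have [S2 [X1 E1 F1]] := IH1 S E; have [S3 [X2 E2 F2]] := IH2 S2 E1.
  exists S3; split=> //; last by move=> i ik; rewrite F2 ?F1.
  by apply: ExecWhileTrue X1 X2; rewrite (eval_shift _ E).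
Qed.

Lemma computes_shift k A B {eA : Enc A} {eB : Enc B} c F (f : A -> B) :
  computes c F f -> forall x s, s k = enc x ->
  exists n s', [/\ exec (cshift k c) s n s', s' k = enc (f x),
                    forall i, i < k -> s' i = s i & n <= F x].
Proof.
move=> H x s sk; have [|n [s1 [X E le]]] := H x (fun i => s (k + i)).
  by rewrite addn0.
have [s2 [X2 E2 F2]] := exec_shift X (fun=> erefl).
by exists n, s2; split=> //; rewrite -(addn0 k) E2.
Qed.

(** Only assignments create trees, and they pay for the size. Hence outputs of polynomial-time
    programs have polynomial size, which closes [poly] under composition. *)
Lemma exec_size c s n s' : exec c s n s' ->
  forall v, tsize (s' v) <= maxn (tsize (s v)) n.
Proof.
elim=> {c s n s'} [s|s x e|c1 c2 s1 s2 s3 n1 n2 _ IH1 _ IH2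
  |e c1 c2 s s' n te _ IH|e c1 c2 s s' n te _ IH|e c s te
  |e c s1 s2 s3 n1 n2 te _ IH1 _ IH2] v; try by rewrite leq_maxl.
- by rewrite /update; case: eqP => _; [rewrite leq_max leqnSn orbT|rewrite leq_maxl].
- by have := IH1 v; have := IH2 v; lia.
- by have := IH v; lia.
- by have := IH v; lia.
- by have := IH1 v; have := IH2 v; lia.
Qed.

Lemma poly_pb A B {eA : Enc A} {eB : Enc B} (f : A -> B) :
  poly f -> pb (fun x => esize (f x)).
Proof.
move=> [c [F [bF H]]]; apply: pb_le (pb_add pb_size bF) _ => x.
have [n [s [/exec_size/(_ 0)]]] := H x (fun=> enc x) erefl.
by move=> le <- nF; apply: leq_trans le _; lia.
Qed.

Lemma poly_eq A B {eA : Enc A} {eB : Enc B} (f g : A -> B) :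
  poly f -> f =1 g -> poly g.
Proof.
move=> [c [F [bF H]]] E; exists c, F; split=> // x s /H [n [s' [X Y Z]]].
by exists n, s'; rewrite -E.
Qed.

(** A program sees trees only, so it also computes every function with the same encodings. This
    moves programs between types: from pairs to nonempty lists, from numbers to lists of units, from
    bare data to instances that carry proofs. *)
Lemma poly_recode A A' B B' {eA : Enc A} {eA' : Enc A'} {eB : Enc B}
    {eB' : Enc B'} (f : A -> B) (f' : A' -> B') (h : A' -> A) :
  poly f -> (forall x, enc (h x) = enc x) ->
  (forall x, enc (f' x) = enc (f (h x))) -> poly f'.
Proof.
move=> [c [F [[a [e bF]] H]]] E1 E2; exists c, (fun x => F (h x)); split.
  by exists a, e => x; rewrite -E1.
move=> x s s0; have [|n [s' [X Y Z]]] := H (h x) s; first by rewrite E1.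
by exists n, s'; rewrite E2.
Qed.

Lemma poly_expr A B {eA : Enc A} {eB : Enc B} (f : A -> B) e :
  (forall x s, s 0 = enc x -> eval s e = enc (f x)) ->
  pb (fun x => esize (f x)) -> poly f.
Proof.
move=> H bf; exists (Assign 0 e), (fun x => (esize (f x)).+1); split.
  exact: pb_S.
move=> x s s0; exists (tsize (eval s e)).+1, (update s 0 (eval s e)).
by split; [constructor|rewrite /update eqxx; apply: H|rewrite (H _ _ s0)].
Qed.

Lemma poly_id A {eA : Enc A} : poly (fun x : A => x).
Proof. by apply: (poly_expr (e := EVar 0)) => //; apply: pb_size. Qed.

Arguments poly_id {A eA}.

Fixpoint equote t := if t is Node l r then ECons (equote l) (equote r) else ENil.

Lemma poly_const A B {eA : Enc A} {eB : Enc B} (b : B) : poly (fun _ : A => b).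
Proof.
apply: (poly_expr (e := equote (enc b))); last exact: pb_const.
by move=> _ s _; elim: (enc b) => //= l -> r ->.
Qed.

Arguments poly_const {A B eA eB} b.

Lemma poly_comp A B C {eA : Enc A} {eB : Enc B} {eC : Enc C}
    (g : B -> C) (f : A -> B) :
  poly g -> poly f -> poly (fun x => g (f x)).
Proof.
move=> [cg [G [bG Hg]]] /[dup] /poly_pb sf [cf [F [bF Hf]]].
exists (Seq cf cg), (fun x => F x + G (f x)); split.
  exact: pb_add bF (pb_comp bG sf).
move=> x s /Hf [n [s1 [X1 E1 L1]]]; have [m [s2 [X2 E2 L2]]] := Hg _ _ E1.
by exists (n + m), s2; split=> //; [apply: ExecSeq X1 X2|rewrite leq_add].
Qed.

Lemma poly_pair A B C {eA : Enc A} {eB : Enc B} {eC : Enc C}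
    (f : A -> B) (g : A -> C) :
  poly f -> poly g -> poly (fun x => (f x, g x)).
Proof.
move=> /[dup] /poly_pb sf [cf [F [bF Hf]]] /[dup] /poly_pb sg [cg [G [bG Hg]]].
exists (Seq (Assign 1 (EVar 0)) (Seq (cshift 1 cf)
         (Seq (Assign 2 (EVar 0)) (Seq (cshift 2 cg)
           (Assign 0 (ECons (EVar 1) (EVar 2))))))),
  (fun x => (esize x).+1 + F x + (esize x).+1 + G x
            + (esize (f x) + esize (g x)).+2); split.
  have bx := pb_S pb_size.
  by do !apply: pb_add => //; do 2!apply: pb_S; apply: pb_add.
move=> x s s0; have X1 := ExecAssign s 1 (EVar 0).
have [|n2 [s2 [X2 E2 K2 L2]]] := computes_shift (k := 1) Hf (x := x) (s := update s 1 (s 0)).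
  by [].
have X3 := ExecAssign s2 2 (EVar 0).
have e0 : s2 0 = enc x by rewrite K2.
have [|n4 [s4 [X4 E4 K4 L4]]] :=
  computes_shift (k := 2) Hg (x := x) (s := update s2 2 (s2 0)).
  by [].
have X5 := ExecAssign s4 0 (ECons (EVar 1) (EVar 2)).
have e1 : s4 1 = enc (f x) by rewrite K4.
eexists; eexists; split.
- exact: ExecSeq X1 (ExecSeq X2 (ExecSeq X3 (ExecSeq X4 X5))).
- by rewrite /update /= e1 E4.
- by rewrite /= e0 s0 e1 E4; lia.
Qed.

Lemma poly_fst A B C {eA : Enc A} {eB : Enc B} {eC : Enc C} (f : A -> B * C) :
  poly f -> poly (fun x => (f x).1).
Proof.
move=> pf; apply: (poly_comp (g := fst)) => //.
apply: (poly_expr (e := EHd (EVar 0))) => [x s /= -> //|].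
by apply: pb_le pb_size _ => x; rewrite esize_pair; lia.
Qed.

Lemma poly_snd A B C {eA : Enc A} {eB : Enc B} {eC : Enc C} (f : A -> B * C) :
  poly f -> poly (fun x => (f x).2).
Proof.
move=> pf; apply: (poly_comp (g := snd)) => //.
apply: (poly_expr (e := ETl (EVar 0))) => [x s /= -> //|].
by apply: pb_le pb_size _ => x; rewrite esize_pair; lia.
Qed.

Lemma poly_cons A B {eA : Enc A} {eB : Enc B} (f : A -> B) (g : A -> seq B) :
  poly f -> poly g -> poly (fun x => f x :: g x).
Proof.
move=> pf pg; apply: (poly_comp (g := fun p : B * seq B => p.1 :: p.2) (f := fun x => (f x, g x))).
  exact: (@poly_recode (B * seq B)%type _ (B * seq B)%type _ _ _ _ _ id _ id poly_id).
exact: poly_pair.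
Qed.

Lemma poly_if A B {eA : Enc A} {eB : Enc B} (b : A -> bool) (f g : A -> B) :
  poly b -> poly f -> poly g -> poly (fun x => if b x then f x else g x).
Proof.
move=> [cb [D [bD Hb]]] [cf [F [bF Hf]]] [cg [G [bG Hg]]].
exists (Seq (Assign 1 (EVar 0)) (Seq (cshift 1 cb) (If (EVar 1) cf cg))),
  (fun x => (esize x).+1 + D x + (F x + G x).+1); split.
  by do !apply: pb_add => //; do ?apply: pb_S => //; [apply: pb_size|apply: pb_add].
move=> x s s0; have X1 := ExecAssign s 1 (EVar 0).
have [|n2 [s2 [X2 E2 K2 L2]]] := computes_shift (k := 1) Hb (x := x) (s := update s 1 (s 0)).
  by [].
have e0 : s2 0 = enc x by rewrite K2.
have tb : truthy (s2 1) = b x by rewrite E2; case: (b x).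
case bx: (b x) in tb *.
- have [n3 [s3 [X3 E3 L3]]] := Hf x s2 e0.
  exists ((tsize (eval s (EVar 0))).+1 + (n2 + n3.+1)), s3; split=> //.
  + by apply: ExecSeq X1 (ExecSeq X2 (ExecIfTrue _ _ X3)); rewrite /= tb.
  + by rewrite /= s0; lia.
- have [n3 [s3 [X3 E3 L3]]] := Hg x s2 e0.
  exists ((tsize (eval s (EVar 0))).+1 + (n2 + n3.+1)), s3; split=> //.
  + by apply: ExecSeq X1 (ExecSeq X2 (ExecIfFalse _ _ X3)); rewrite /= tb.
  + by rewrite /= s0; lia.
Qed.

(** The only loop; all list and number operations below are derived from it. Register 1 holds the
    rest of the list, register 2 the accumulator, and register 3 is where [h] is computed. Iterating
    a polynomial step may blow up, hence the bound [M] on the accumulators of all prefixes. *)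
Lemma poly_foldl A B C {eA : Enc A} {eB : Enc B} {eC : Enc C}
    (h : A -> C -> B -> C) (b : A -> C) (l : A -> seq B) :
  poly l -> poly b -> poly (fun p : A * C * B => h p.1.1 p.1.2 p.2) ->
  (exists2 M, pb M & forall x i, esize (foldl (h x) (b x) (take i (l x))) <= M x) ->
  poly (fun x => foldl (h x) (b x) (l x)).
Proof.
move=> /[dup] /poly_pb sl [cl [L [bL Hl]]] [cb [D [bD Hb]]].
move=> [ch [K [[a [e bK]] Hh]]] [M bM HM].
(* [E x] bounds the argument of [h] in any round, and [R x] the cost of a round. *)
pose E (x : A) := (tsize (@enc A eA x) + M x + tsize (@enc _ (@enc_seq B eB) (l x))).+2.
pose R (x : A) := E x + tsize (@enc _ (@enc_seq B eB) (l x)) + M x + a * E x ^ e + 4.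
exists (Seq (Assign 1 (EVar 0)) (Seq (cshift 1 cl)
         (Seq (Assign 2 (EVar 0)) (Seq (cshift 2 cb)
           (Seq (While (EVar 1)
              (Seq (Assign 3 (ECons (ECons (EVar 0) (EVar 2)) (EHd (EVar 1))))
                (Seq (cshift 3 ch) (Seq (Assign 2 (EVar 3))
                   (Assign 1 (ETl (EVar 1)))))))
             (Assign 0 (EVar 2))))))),
  (fun x => (esize x).+1 + L x + (esize x).+1 + D x
    + (esize (l x) * R x).+1 + (M x).+1); split.
  have bE : pb E by do 2!apply: pb_S; do !apply: pb_add => //; apply: pb_size.
  have bEe : pb (fun x => E x ^ e).
    by elim: e {bK R} => [|e IH]; [exact: pb_const|apply: pb_le (pb_mul bE IH) _ => x; rewrite expnS].
  have bR : pb R by do !apply: pb_add => //; do ?apply: pb_mul => //; apply: pb_const.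
  by do !apply: pb_add => //; do ?apply: pb_S => //; do ?apply: pb_size; apply: pb_mul.
move=> x s s0; have X1 := ExecAssign s 1 (EVar 0).
have [|n2 [s2 [X2 E2 K2 L2]]] := computes_shift (k := 1) Hl (x := x) (s := update s 1 (s 0)).
  by [].
have X3 := ExecAssign s2 2 (EVar 0).
have e0 : s2 0 = enc x by rewrite K2.
have [|n4 [s4 [X4 E4 K4 L4]]] :=
  computes_shift (k := 2) Hb (x := x) (s := update s2 2 (s2 0)).
  by [].
have e40 : s4 0 = enc x by rewrite K4.
have e41 : s4 1 = enc (l x) by rewrite K4.
set body := Seq (Assign 3 _) _.
have loop: forall l2 l1 S, l x = l1 ++ l2 -> S 0 = enc x -> S 1 = enc l2 ->
    S 2 = enc (foldl (h x) (b x) l1) ->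
    exists n S', [/\ exec (While (EVar 1) body) S n S',
      S' 2 = enc (foldl (h x) (b x) (l x)) & n <= (size l2 * R x).+1].
  elim=> [|y l2 IH] l1 S El S0 S1 S2.
    exists 1, S; split=> //; first by constructor; rewrite /= S1.
    by rewrite El cats0.
  pose acc := foldl (h x) (b x) l1.
  have Y1 := ExecAssign S 3 (ECons (ECons (EVar 0) (EVar 2)) (EHd (EVar 1))).
  set T1 := update S 3 _ in Y1.
  have Z1 : eval S (ECons (ECons (EVar 0) (EVar 2)) (EHd (EVar 1))) = enc (x, acc, y).
    by rewrite /= S0 S1 S2.
  have T13 : T1 3 = enc (x, acc, y) by rewrite /T1 /update /= S0 S1 S2.
  have [m2 [T2 [Y2 F2 G2 N2]]] := computes_shift Hh T13.
  have Y3 := ExecAssign T2 2 (EVar 3).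
  set T3 := update T2 2 _ in Y3.
  have Y4 := ExecAssign T3 1 (ETl (EVar 1)).
  set T4 := update T3 1 _ in Y4.
  have T31 : T3 1 = enc (y :: l2) by rewrite /T3 /update /= G2.
  have [||||n [S' [X5 E5 L5]]] := IH (rcons l1 y) T4.
  - by rewrite cat_rcons.
  - by rewrite /T4 /T3 /update /= G2.
  - by rewrite /T4 /update /= T31.
  - by rewrite /T4 /T3 /update /= F2 foldl_rcons.
  eexists; exists S'; split.
  - apply: ExecWhileTrue X5; first by rewrite /= S1.
    exact: ExecSeq Y1 (ExecSeq Y2 (ExecSeq Y3 Y4)).
  - exact: E5.
  - have sz: size (y :: l2) = (size l2).+1 by [].
    rewrite sz mulSn Z1.
    have A1 : esize acc <= M x.
      by have := HM x (size l1); rewrite El take_size_cat.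
    have A2 : esize y <= esize (l x).
      by rewrite El; have := esize_cat (eA := eB) l1 (y :: l2); rewrite esize_cons; lia.
    have A3 : esize (x, acc, y) <= E x.
      by rewrite !esize_pair /=; rewrite /E; lia.
    have A4 : esize (h x acc y) <= M x.
      have := HM x (size l1).+1; rewrite El -cat_rcons take_size_cat ?size_rcons //.
      by rewrite foldl_rcons.
    have A5 : m2 <= a * E x ^ e.
      apply: leq_trans N2 _; apply: leq_trans (bK _) _.
      by rewrite leq_mul2l leq_exp ?orbT.
    have A6 : tsize (eval T3 (ETl (EVar 1))) <= esize (l x).
      rewrite /= T31 /= El; have := esize_cat (eA := eB) l1 (y :: l2).
      by rewrite esize_cons; have := tsize_gt0 (enc l1); change (tseq (map enc l2)) with (enc l2); lia.
    have A7 : tsize (eval T2 (EVar 3)) <= M x by rewrite /= F2.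
    have ER : R x = E x + tsize (@enc _ (@enc_seq B eB) (l x)) + M x + a * E x ^ e + 4 by [].
    move: (R x) (E x ^ e) ER L5 A5 => r ee ER L5 A5.
    by move: (size l2 * r) (a * ee) ER L5 A5 => u v ER L5 A5; lia.
have [n5 [s5 [X5 E5 L5]]] := loop (l x) [::] s4 erefl e40 e41 E4.
have X6 := ExecAssign s5 0 (EVar 2).
eexists; eexists; split.
- exact: ExecSeq X1 (ExecSeq X2 (ExecSeq X3 (ExecSeq X4 (ExecSeq X5 X6)))).
- by rewrite /update /=.
- have M5 : tsize (eval s5 (EVar 2)) <= M x.
    by rewrite /= E5; have := HM x (size (l x)); rewrite take_size.
  have : size (l x) * R x <= esize (l x) * R x.
    by rewrite leq_mul2r ltnW ?orbT // esize_size.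
  by move: M5; rewrite /= e0 s0; lia.
Qed.

(** * Polynomial-time operations on lists and numbers *)

(** A unary number and the list of that many units are the same tree, so arithmetic reduces to list
    operations. *)
Lemma poly_units A {eA : Enc A} (n : A -> nat) : poly n -> poly (fun x => nseq (n x) tt).
Proof.
move=> pn; apply: (poly_recode (h := id) pn) => // x.
by elim: (n x) => // k /= IH; congr Node.
Qed.

Lemma poly_succ A {eA : Enc A} (n : A -> nat) : poly n -> poly (fun x => (n x).+1).
Proof.
move=> pn; apply: (poly_comp (g := succn) (f := n)) => //.
apply: (poly_expr (e := ECons ENil (EVar 0))) => [x s /= -> //|].
by apply: pb_le (pb_add pb_size (pb_const 2)) _ => x; rewrite !esize_nat; lia.
Qed.

Lemma poly_size A B {eA : Enc A} {eB : Enc B} (l : A -> seq B) : poly l -> poly (fun x => size (l x)).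
Proof.
move=> pl; have E s : foldl (fun n (_ : B) => n.+1) 0 s = size s.
  by rewrite -[RHS]add0n; elim: s 0 => [|b s IH] n /=; rewrite ?addn0 // IH addSnnS.
apply: (@poly_eq _ _ _ _ (fun x => foldl (fun n (_ : B) => n.+1) 0 (l x))); last first.
  by move=> x; rewrite E.
apply: poly_foldl => //; first exact: poly_const.
  by apply: poly_succ; apply: poly_snd; apply: poly_fst; apply: poly_id.
exists (fun x => (esize (l x)).*2.+1).
  by apply: pb_S; apply: pb_le (pb_add (poly_pb pl) (poly_pb pl)) _ => x; rewrite addnn.
move=> x i; rewrite E esize_nat ltnS leq_double size_take_min.
by have := esize_size (eA := eB) (l x); lia.
Qed.

Lemma poly_rev A B {eA : Enc A} {eB : Enc B} (l : A -> seq B) : poly l -> poly (fun x => rev (l x)).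
Proof.
move=> pl; have E (s t : seq B) : foldl (fun r a => a :: r) t s = catrev s t.
  by elim: s t => //= a s IH t; rewrite IH.
apply: (@poly_eq _ _ _ _ (fun x => foldl (fun r a => a :: r) [::] (l x))); last first.
  by move=> x; rewrite E.
apply: poly_foldl => //; first exact: poly_const.
  apply: poly_cons; first by apply: poly_snd; apply: poly_id.
  by apply: poly_snd; apply: poly_fst; apply: poly_id.
exists (fun x => esize (l x)); first exact: poly_pb.
by move=> x i; rewrite E -/(rev _) esize_rev esize_take.
Qed.

Lemma poly_map A B C {eA : Enc A} {eB : Enc B} {eC : Enc C} (l : A -> seq B) (g : A -> B -> C) :
  poly l -> poly (fun p : A * B => g p.1 p.2) ->
  poly (fun x => [seq g x a | a <- l x]).
Proof.
move=> pl pg; have E x (s : seq B) (t : seq C) :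
    foldl (fun r a => g x a :: r) t s = catrev (map (g x) s) t.
  by elim: s t => //= a s IH t; rewrite IH.
apply: (@poly_eq _ _ _ _ (fun x => rev (foldl (fun r a => g x a :: r) [::] (l x)))); last first.
  by move=> x; rewrite E -/(rev _) revK.
apply: poly_rev; apply: (poly_foldl (h := fun x r a => g x a :: r)) => //; first exact: poly_const.
  apply: poly_cons; last by apply: poly_snd; apply: poly_fst; apply: poly_id.
  apply: (poly_comp (g := fun p : A * B => g p.1 p.2) (f := fun q => (q.1.1, q.2))) => //.
  apply: poly_pair; first by do 2!apply: poly_fst; apply: poly_id.
  by apply: poly_snd; apply: poly_id.
have [a [e bg]] := poly_pb pg.
have [M bM HM] : exists2 M : A -> nat, pb M & forall x, (esize x + esize (l x)).+1 <= M x.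
  exists (fun x : A => (esize x + esize (l x)).+1) => //.
  by apply: pb_S; apply: pb_add; [apply: pb_size|apply: poly_pb].
have bMe : pb (fun x => M x ^ e).
  elim: e {bg} => [|e IH]; first exact: pb_const.
  by apply: pb_le (pb_mul bM IH) _ => x; rewrite expnS.
exists (fun x => M x * (a * M x ^ e).+1 + 1).
  apply: pb_add; last exact: pb_const.
  by apply: pb_mul => //; apply: pb_S; apply: pb_mul => //; apply: pb_const.
move=> x i; rewrite E -/(rev _) esize_rev.
have lM : size (take i (l x)) <= M x.
  by rewrite size_take_min; have := esize_size (eA := eB) (l x); have := HM x; lia.
have H s : (forall s1 b s2, s = s1 ++ b :: s2 -> esize b < M x - esize x) ->
    esize (map (g x) s) <= size s * (a * M x ^ e).+1 + 1.
  elim: s => [//|b s IH] Hs; rewrite [map _ _]/= [size _]/=; rewrite esize_cons mulSn.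
  have H1 : esize (g x b) <= a * M x ^ e.
    apply: leq_trans (bg (x, b)) _; rewrite leq_mul2l leq_exp ?orbT // esize_pair /=.
    by have := Hs [::] b s erefl; lia.
  have H2 := IH (fun s1 b' s2 es => Hs (b :: s1) b' s2 (congr1 (cons b) es)).
  by move: H1 H2; move: (a * _) (size s * _) => u v; lia.
apply: leq_trans (H _ _) _; last by rewrite leq_add2r leq_mul2r lM orbT.
move=> s1 b s2 es; have := HM x; rewrite -{1}(cat_take_drop i (l x)) es -catA cat_cons.
have := esize_cat (eA := eB) s1 (b :: s2 ++ drop i (l x)); rewrite esize_cons.
by have := esize_gt0 (eA := enc_seq (eA := eB)) s1; lia.
Qed.

Lemma poly_cat A B {eA : Enc A} {eB : Enc B} (l t : A -> seq B) : poly l -> poly t -> poly (fun x => l x ++ t x).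
Proof.
move=> pl pt; have E (s r : seq B) : foldl (fun r a => a :: r) r s = catrev s r.
  by elim: s r => //= a s IH r; rewrite IH.
apply: (@poly_eq _ _ _ _ (fun x => foldl (fun r a => a :: r) (t x) (rev (l x)))); last first.
  by move=> x; rewrite E catrevE revK.
apply: poly_foldl => //; first exact: poly_rev.
  apply: poly_cons; first by apply: poly_snd; apply: poly_id.
  by apply: poly_snd; apply: poly_fst; apply: poly_id.
exists (fun x => esize (l x) + esize (t x)); first by apply: pb_add; apply: poly_pb.
move=> x i; rewrite E catrevE -(esize_rev (l x)).
have := esize_cat (eA := eB) (rev (take i (rev (l x)))) (t x); rewrite esize_rev.
by have := esize_take (eA := eB) i (rev (l x)); lia.
Qed.

Lemma poly_has A B {eA : Enc A} {eB : Enc B} (l : A -> seq B) (p : A -> B -> bool) :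
  poly l -> poly (fun q : A * B => p q.1 q.2) -> poly (fun x => has (p x) (l x)).
Proof.
move=> pl pp; have E x (s : seq B) r :
    foldl (fun r a => if r then true else p x a) r s = r || has (p x) s.
  by elim: s r => //= [|a s IH] r; [rewrite orbF|rewrite IH orbA; case: r].
apply: (@poly_eq _ _ _ _
    (fun x => foldl (fun r a => if r then true else p x a) false (l x))); last first.
  by move=> x; rewrite E.
apply: (poly_foldl (h := fun x r a => if r then true else p x a)) => //; first exact: poly_const.
  apply: poly_if; [|exact: poly_const|].
    by apply: poly_snd; apply: poly_fst; apply: poly_id.
  apply: (poly_comp (g := fun p0 : A * B => p p0.1 p0.2) (f := fun q => (q.1.1, q.2))) => //.
  apply: poly_pair; first by do 2!apply: poly_fst; apply: poly_id.
  by apply: poly_snd; apply: poly_id.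
by exists (fun=> 3) => [|x i]; [apply: pb_const|case: foldl].
Qed.

Lemma poly_negb A {eA : Enc A} (b : A -> bool) : poly b -> poly (fun x => ~~ b x).
Proof.
move=> pb; apply: (@poly_eq _ _ _ _ (fun x => if b x then false else true)).
  by apply: poly_if => //; apply: poly_const.
by move=> x; case: (b x).
Qed.

Lemma poly_andb A {eA : Enc A} (b c : A -> bool) : poly b -> poly c -> poly (fun x => b x && c x).
Proof.
move=> pb pc; apply: (@poly_eq _ _ _ _ (fun x => if b x then c x else false)).
  by apply: poly_if => //; apply: poly_const.
by move=> x; case: (b x).
Qed.

Lemma poly_implb A {eA : Enc A} (b c : A -> bool) : poly b -> poly c -> poly (fun x => b x ==> c x).
Proof.
move=> pb pc; apply: (@poly_eq _ _ _ _ (fun x => if b x then c x else true)).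
  by apply: poly_if => //; apply: poly_const.
by move=> x; case: (b x).
Qed.

Lemma poly_behead A B {eA : Enc A} {eB : Enc B} (l : A -> seq B) : poly l -> poly (fun x => behead (l x)).
Proof.
move=> pl; apply: (poly_comp (g := behead) (f := l)) => //.
apply: (poly_expr (e := ETl (EVar 0))) => [[|b s] S /= -> //|].
by apply: pb_le pb_size _ => -[|b s] //; rewrite esize_cons /=; lia.
Qed.

Lemma poly_head A B {eA : Enc A} {eB : Enc B} b0 (l : A -> seq B) : poly l -> poly (fun x => head b0 (l x)).
Proof.
move=> pl; have E (s : seq B) : foldl (fun _ a => a) b0 s = last b0 s.
  by elim: s b0 => //= a s IH b1; rewrite IH.
apply: (@poly_eq _ _ _ _ (fun x => foldl (fun _ a => a) b0 (rev (l x)))); last first.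
  by move=> x; rewrite E; case: (l x) => //= b s; rewrite rev_cons last_rcons.
apply: poly_foldl; [exact: poly_rev|exact: poly_const| |].
  by apply: poly_snd; apply: poly_id.
exists (fun x => esize b0 + esize (l x)).
  by apply: pb_add; [apply: pb_const|apply: poly_pb].
move=> x i; rewrite E -(esize_rev (l x)).
have := esize_take (eA := eB) i (rev (l x)).
case/lastP: (take _ _) => [|s b] /=; first by lia.
rewrite last_rcons -cats1; have := esize_cat (eA := eB) s [:: b].
by rewrite esize_cons; have := esize_gt0 (eA := enc_seq (eA := eB)) s; lia.
Qed.

Lemma poly_all A B {eA : Enc A} {eB : Enc B} (l : A -> seq B) (p : A -> B -> bool) :
  poly l -> poly (fun q : A * B => p q.1 q.2) -> poly (fun x => all (p x) (l x)).
Proof.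
move=> pl pp; apply: (@poly_eq _ _ _ _ (fun x => ~~ has (fun a => ~~ p x a) (l x))).
  by apply: poly_negb; apply: (poly_has (p := fun x a => ~~ p x a)) => //; apply: poly_negb.
by move=> x; rewrite has_predC negbK.
Qed.

Lemma poly_flatten A B {eA : Enc A} {eB : Enc B} (l : A -> seq (seq B)) :
  poly l -> poly (fun x => flatten (l x)).
Proof.
move=> pl; have E (s : seq (seq B)) r : foldl (fun r a => r ++ a) r s = r ++ flatten s.
  by elim: s r => //= [|a s IH] r; [rewrite cats0|rewrite IH catA].
apply: (@poly_eq _ _ _ _ (fun x => foldl (fun r a => r ++ a) [::] (l x))); last first.
  by move=> x; rewrite E.
apply: poly_foldl; [exact: pl|exact: poly_const| |].
  apply: poly_cat; last by apply: poly_snd; apply: poly_id.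
  by apply: poly_snd; apply: poly_fst; apply: poly_id.
exists (fun x => esize (l x)); first exact: poly_pb.
move=> x i; rewrite E cat0s; apply: leq_trans (esize_take i (l x)).
have : esize (flatten (take i (l x))) <= esize (take i (l x)).
  elim: (take _ _) => // s t IH; rewrite [flatten _]/= (esize_cons s).
  by have := esize_cat (eA := eB) s (flatten t); lia.
by [].
Qed.

Lemma poly_addn A {eA : Enc A} (m n : A -> nat) :
  poly m -> poly n -> poly (fun x => m x + n x).
Proof.
move=> pm pn.
apply: (@poly_eq _ _ _ _ (fun x => size (nseq (m x) tt ++ nseq (n x) tt))).
  by apply: poly_size; apply: poly_cat; apply: poly_units.
by move=> x; rewrite size_cat !size_nseq.
Qed.

Lemma poly_muln A {eA : Enc A} (m n : A -> nat) :
  poly m -> poly n -> poly (fun x => m x * n x).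
Proof.
move=> pm pn.
apply: (@poly_eq _ _ _ _
  (fun x => size (flatten [seq nseq (n x) tt | _ <- nseq (m x) tt]))).
  apply: poly_size; apply: poly_flatten.
  apply: (poly_map (g := fun x _ => nseq (n x) tt)); first exact: poly_units.
  apply: poly_units; apply: (poly_comp (g := n) (f := fst)) => //.
  by apply: poly_fst; apply: poly_id.
by move=> x; elim: (m x) => //= k IH; rewrite size_cat IH size_nseq.
Qed.

Lemma poly_iter A C {eA : Enc A} {eC : Enc C} (h : A -> C -> C) (b : A -> C)
    (n : A -> nat) :
  poly n -> poly b -> poly (fun p : A * C => h p.1 p.2) ->
  (exists2 M, pb M & forall x i, i <= n x -> esize (iter i (h x) (b x)) <= M x) ->
  poly (fun x => iter (n x) (h x) (b x)).
Proof.
move=> pn bb ph [M bM HM]; have E x k c : foldl (fun r _ => h x r) c (nseq k tt) = iter k (h x) c.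
  by elim: k c => //= k IH c; rewrite IH -iterSr.
apply: (@poly_eq _ _ _ _ (fun x => foldl (fun r (_ : unit) => h x r) (b x) (nseq (n x) tt))); last first.
  by move=> x; rewrite E.
apply: (poly_foldl (h := fun x r _ => h x r)) => //; first exact: poly_units.
  apply: (poly_comp (g := fun p : A * C => h p.1 p.2) (f := fst)) => //.
  by apply: poly_fst; apply: poly_id.
exists M => // x i; have -> : take i (nseq (n x) tt) = nseq (minn i (n x)) tt.
  have [le|lt] := leqP i (n x); first by rewrite take_nseq // (minn_idPl le).
  by rewrite take_oversize ?size_nseq 1?ltnW // (minn_idPr (ltnW lt)).
by rewrite E HM // geq_minr.
Qed.

Lemma poly_drop A B {eA : Enc A} {eB : Enc B} (n : A -> nat) (l : A -> seq B) :
  poly n -> poly l -> poly (fun x => drop (n x) (l x)).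
Proof.
move=> pn pl; have E k (s : seq B) : iter k behead s = drop k s.
  by elim: k s => [|k IH] s; rewrite ?drop0 // iterSr IH; case: s.
apply: (@poly_eq _ _ _ _ (fun x => iter (n x) behead (l x))); last by move=> x; rewrite E.
apply: (poly_iter (h := fun _ => behead)) => //.
  by apply: poly_behead; apply: poly_snd; apply: poly_id.
exists (fun x => esize (l x)); first exact: poly_pb.
move=> x i _; rewrite E -(esize_rev (drop _ _)) -(esize_rev (l x)) rev_drop.
exact: esize_take.
Qed.

Lemma poly_nth A B {eA : Enc A} {eB : Enc B} b (n : A -> nat) (l : A -> seq B) :
  poly n -> poly l -> poly (fun x => nth b (l x) (n x)).
Proof.
move=> pn pl; apply: (@poly_eq _ _ _ _ (fun x => head b (drop (n x) (l x)))).
  by apply: poly_head; apply: poly_drop.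
by move=> x; rewrite -nth0 nth_drop addn0.
Qed.

Lemma poly_subn A {eA : Enc A} (m n : A -> nat) :
  poly m -> poly n -> poly (fun x => m x - n x).
Proof.
move=> pm pn.
apply: (@poly_eq _ _ _ _ (fun x => size (drop (n x) (nseq (m x) tt)))).
  by apply: poly_size; apply: poly_drop => //; apply: poly_units.
by move=> x; rewrite size_drop size_nseq.
Qed.

Lemma poly_leq A {eA : Enc A} (m n : A -> nat) :
  poly m -> poly n -> poly (fun x => m x <= n x).
Proof.
move=> pm pn.
apply: (@poly_eq _ _ _ _ (fun x => ~~ has predT (nseq (m x - n x) tt))).
  apply: poly_negb; apply: (poly_has (p := fun _ _ => true)); last exact: poly_const.
  by apply: poly_units; apply: poly_subn.
by move=> x; rewrite has_predT size_nseq lt0n negbK.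
Qed.

Lemma poly_eqn A {eA : Enc A} (m n : A -> nat) :
  poly m -> poly n -> poly (fun x => m x == n x).
Proof.
move=> pm pn; apply: (@poly_eq _ _ _ _ (fun x => (m x <= n x) && (n x <= m x))).
  by apply: poly_andb; apply: poly_leq.
by move=> x; rewrite eqn_leq.
Qed.

Lemma poly_iota A {eA : Enc A} (n : A -> nat) :
  poly n -> poly (fun x => iota 0 (n x)).
Proof.
move=> pn; have E k : iter k (fun s => size s :: s) [::] = rev (iota 0 k).
  by elim: k => // k IH; rewrite iterS IH size_rev size_iota -[k.+1]addn1 iotaD rev_cat.
apply: (@poly_eq _ _ _ _ (fun x => rev (iter (n x) (fun s => size s :: s) [::]))); last first.
  by move=> x; rewrite E revK.
apply: poly_rev; apply: (poly_iter (h := fun _ s => size s :: s)) => //; first exact: poly_const.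
  apply: poly_cons; last by apply: poly_snd; apply: poly_id.
  by apply: poly_size; apply: poly_snd; apply: poly_id.
exists (fun x => esize (n x) * esize (n x) * 2).
  apply: pb_mul; last exact: pb_const.
  by apply: pb_mul; apply: poly_pb.
move=> x i le; rewrite E esize_rev esize_seq.
apply: (@leq_trans (\sum_(a <- iota 0 i) (esize (n x)).+1 + 1)).
  rewrite leq_add2r; rewrite big_seq [leqRHS]big_seq; apply: leq_sum => a.
  by rewrite mem_iota ltnS !esize_nat; lia.
by rewrite big_const_seq count_predT iter_addn_0 size_iota !esize_nat; nia.
Qed.

Lemma poly_nseq A B {eA : Enc A} {eB : Enc B} (n : A -> nat) (b : A -> B) :
  poly n -> poly b -> poly (fun x => nseq (n x) (b x)).
Proof.
move=> pn pb; apply: (@poly_eq _ _ _ _ (fun x => [seq b x | _ <- nseq (n x) tt])).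
  apply: (poly_map (g := fun x _ => b x)); first exact: poly_units.
  by apply: (poly_comp (g := b) (f := fst)) => //; apply: poly_fst; apply: poly_id.
by move=> x; rewrite map_nseq.
Qed.

Lemma poly_filter A B {eA : Enc A} {eB : Enc B} (l : A -> seq B) (p : A -> B -> bool) :
  poly l -> poly (fun q : A * B => p q.1 q.2) ->
  poly (fun x => [seq a <- l x | p x a]).
Proof.
move=> pl pp.
apply: (@poly_eq _ _ _ _ (fun x => flatten [seq if p x a then [:: a] else [::] | a <- l x])).
  apply: poly_flatten; apply: (poly_map (g := fun x a => if p x a then [:: a] else [::])) => //.
  apply: poly_if => //; last exact: poly_const.
  by apply: poly_cons; [apply: poly_snd; apply: poly_id|apply: poly_const].
by move=> x; elim: (l x) => //= a s ->; case: (p x a).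
Qed.

Lemma poly_take A B {eA : Enc A} {eB : Enc B} (n : A -> nat) (l : A -> seq B) :
  poly n -> poly l -> poly (fun x => take (n x) (l x)).
Proof.
move=> pn pl.
apply: (@poly_eq _ _ _ _ (fun x => rev (drop (size (l x) - n x) (rev (l x))))).
  apply: poly_rev; apply: poly_drop; last exact: poly_rev.
  by apply: poly_subn => //; apply: poly_size.
by move=> x; rewrite rev_drop revK size_rev; have [le|lt] := leqP (n x) (size (l x));
  [rewrite subKn|rewrite (eqP (ltnW lt : _ - _ == 0)) subn0 take_size take_oversize // ltnW].
Qed.

Lemma poly_zip A B C {eA : Enc A} {eB : Enc B} {eC : Enc C}
    (s : A -> seq B) (t : A -> seq C) :
  poly s -> poly t -> poly (fun x => zip (s x) (t x)).
Proof.
move=> ps pt.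
(* Taking an element as a list of length at most one avoids default values and stops at the end of
   the shorter list. *)
pose f (p : A * nat) := flatten [seq [seq (b, c) | c <- take 1 (drop p.2 (t p.1))]
                                    | b <- take 1 (drop p.2 (s p.1))].
apply: (@poly_eq _ _ _ _ (fun x => flatten [seq f (x, i) | i <- iota 0 (size (s x))])).
  apply: poly_flatten; apply: (poly_map (g := fun x i => f (x, i))).
    by apply: poly_iota; apply: poly_size.
  apply: poly_flatten.
  apply: (poly_map (g := fun p b => [seq (b, c) | c <- take 1 (drop p.2 (t p.1))])).
    apply: poly_take; first exact: poly_const.
    apply: poly_drop; first by apply: poly_snd; apply: poly_id.
    by apply: (poly_comp (g := s) (f := fst)) => //; apply: poly_fst; apply: poly_id.
  apply: (poly_map (g := fun q c => (q.2, c))).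
    apply: poly_take; first exact: poly_const.
    apply: poly_drop; first by apply: poly_snd; apply: poly_fst; apply: poly_id.
    apply: (poly_comp (g := t) (f := fun q => q.1.1)) => //.
    by do 2!apply: poly_fst; apply: poly_id.
  apply: poly_pair; last by apply: poly_snd; apply: poly_id.
  by apply: poly_snd; apply: poly_fst; apply: poly_id.
move=> x; rewrite /f; elim: (s x) (t x) => [|b u IH] [|c v] //.
  have Z T T' (W : seq T) : flatten [seq ([::] : seq T') | _ <- W] = [::] by elim: W.
  rewrite -[RHS](Z _ _ (iota 0 (size (b :: u)))); congr flatten.
  by apply: eq_map => i /=; exact: Z.
rewrite [size _]/= [iota _ _]/= [map _ _]/= take0 /= take0 -[1]/(1 + 0) iotaDl -map_comp -IH.
by congr (_ :: flatten _); apply: eq_map => i /=.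
Qed.

Lemma poly_eqseq A {eA : Enc A} (s t : A -> seq nat) :
  poly s -> poly t -> poly (fun x => s x == t x).
Proof.
move=> ps pt.
apply: (@poly_eq _ _ _ _ (fun x => (size (s x) == size (t x)) &&
                                   all (fun p : nat * nat => p.1 == p.2) (zip (s x) (t x)))).
  apply: poly_andb; first by apply: poly_eqn; apply: poly_size.
  apply: (poly_all (p := fun _ p => p.1 == p.2)); first exact: poly_zip.
  by apply: poly_eqn; [apply: poly_fst|apply: poly_snd]; apply: poly_snd; apply: poly_id.
by move=> x; rewrite eqseq_all -all2E.
Qed.

Lemma poly_mem_nat A {eA : Enc A} (n : A -> nat) (s : A -> seq nat) :
  poly n -> poly s -> poly (fun x => n x \in s x).
Proof.
move=> pn ps; apply: (@poly_eq _ _ _ _ (fun x => has (fun i => i == n x) (s x))).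
  apply: (poly_has (p := fun x i => i == n x)) => //.
  apply: poly_eqn; first by apply: poly_snd; apply: poly_id.
  by apply: (poly_comp (g := n) (f := fst)) => //; apply: poly_fst; apply: poly_id.
by move=> x; rewrite has_pred1.
Qed.

Lemma poly_mem_seq A {eA : Enc A} (n : A -> seq nat) (s : A -> seq (seq nat)) :
  poly n -> poly s -> poly (fun x => n x \in s x).
Proof.
move=> pn ps; apply: (@poly_eq _ _ _ _ (fun x => has (fun i => i == n x) (s x))).
  apply: (poly_has (p := fun x i => i == n x)) => //.
  apply: poly_eqseq; first by apply: poly_snd; apply: poly_id.
  by apply: (poly_comp (g := n) (f := fst)) => //; apply: poly_fst; apply: poly_id.
by move=> x; rewrite has_pred1.
Qed.

Fixpoint words (T : Type) (t : nat) (s : seq T) : seq (seq T) :=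
  if t is t'.+1 then flatten [seq [seq a :: w | w <- words t' s] | a <- s]
  else [:: [::]].

(** The number of words is exponential in [t], which is a constant here and no part of the input. *)
Lemma poly_words A B {eA : Enc A} {eB : Enc B} t (s : A -> seq B) :
  poly s -> poly (fun x => words t (s x)).
Proof.
move=> ps; elim: t => [|t IH] /=; first exact: poly_const.
apply: poly_flatten; apply: (poly_map (g := fun x a => [seq a :: w | w <- words t (s x)])) => //.
apply: (poly_map (g := fun p w => p.2 :: w)).
  by apply: (poly_comp (g := fun x => words t (s x)) (f := fst)) => //; apply: poly_fst; apply: poly_id.
apply: poly_cons; last by apply: poly_snd; apply: poly_id.
by apply: poly_snd; apply: poly_fst; apply: poly_id.
Qed.

Lemma mem_words (T : eqType) t (s w : seq T) :
  (w \in words t s) = (size w == t) && all (mem s) w.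
Proof.
elim: t w => [|t IH] w /=; first by rewrite inE; case: w.
apply/flatten_mapP/idP => [[a sa /mapP[v]]|].
  by rewrite IH => /andP[/eqP <- ?] -> /=; rewrite eqxx sa.
case: w => // a v /= /andP[sv /andP[sa av]].
by exists a => //; apply: map_f; rewrite IH av andbT.
Qed.

Lemma uniq_words (T : eqType) t (s : seq T) : uniq s -> uniq (words t s).
Proof.
move=> us; elim: t => //= t; move: (words t s) => W uW.
elim: s us => //= a s IHs /andP[nas us].
rewrite cat_uniq IHs // andbT map_inj_uniq ?uW /= => [|? ? []//].
apply/hasPn => w /flatten_mapP[b bs /mapP[v _ ->]]; apply/negP => /mapP[v' _ [ba _]].
by rewrite -ba bs in nas.
Qed.

Lemma size_words (T : Type) t (s : seq T) : size (words t s) = size s ^ t.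
Proof.
elim: t => //= t IH; rewrite expnS -IH size_flatten /shape -map_comp.
by move: (words t s) {IH} => W; elim: s => //= a s ->; rewrite size_map mulSn.
Qed.

(** * From off-diagonal grid tiling to fair clustering *)

(** [Cell a b u v _] proposes the words [u] and [v] for the tile [(a, b)].  The
    rows [Hub a b c _] come in every color but [c], and [Side true a],
    [Side false b] are the clusters where row [a] and column [b] of the tiling
    choose their words. *)
Inductive rdesc : Type :=
| Cell of nat & nat & seq nat & seq nat & nat
| Hub of nat & nat & nat & nat
| Side of bool & nat.

Definition rdesc_code (r : rdesc) : seq nat * seq nat * seq nat :=
  match r with
  | Cell a b u v c => ([:: a; b; c], u, v)
  | Hub a b c c' => ([:: a; b; c; c'], [::], [::])
  | Side o a => ([:: nat_of_bool o; a], [::], [::])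
  end.

Definition rdesc_decode (x : seq nat * seq nat * seq nat) : rdesc :=
  match x with
  | ([:: a; b; c], u, v) => Cell a b u v c
  | ([:: a; b; c; c'], _, _) => Hub a b c c'
  | ([:: o; a], _, _) => Side (o == 1) a
  | _ => Side true 0
  end.

Lemma rdesc_codeK : cancel rdesc_code rdesc_decode.
Proof. by case=> // -[] a. Qed.

HB.instance Definition _ := Equality.copy rdesc (can_type rdesc_codeK).

(** The leading number is the kind of the column: hub, tile, side label, vertex. [kap], [class_tags]
    and [tag_copies] branch on it. The boolean is [true] for rows of the tiling and [false] for its
    columns. *)
Definition TB (a b c : nat) : seq nat := [:: 0; a; b; c].
Definition TL (a b : nat) : seq nat := [:: 1; a; b].
Definition lab (o : bool) (x : nat) : seq nat := [:: 2; nat_of_bool o; x].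
Definition vtx (o : bool) (x : nat) (u : seq nat) : seq nat :=
  [:: 3, nat_of_bool o, x & u].

(** The columns in which a row has entry 1. *)
Definition tags (r : rdesc) : seq (seq nat) :=
  match r with
  | Cell a b u v _ => [:: TL a b; lab true a; lab false b; vtx true a u; vtx false b v]
  | Hub a b c _ => [:: TL a b; lab true a; lab false b; TB a b c]
  | Side o a => [:: lab o a]
  end.

Definition color (r : rdesc) : nat :=
  match r with
  | Cell _ _ _ _ c | Hub _ _ _ c | Side _ c => c
  end.

Section Grid.
Variables (C : nat) (U : seq (seq nat)) (S : nat -> nat -> seq nat -> seq nat -> bool).

Definition idx := iota 0 C.
Definition idx2 := [seq p <- [seq (a, b) | a <- idx, b <- idx] | p.1 != p.2].
Definition sel p := [seq w <- [seq (u, v) | u <- U, v <- U] | S p.1 p.2 w.1 w.2].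
Definition others (p : nat * nat) := [seq c <- idx | (c != p.1) && (c != p.2)].

Definition except (c : nat) := [seq c' <- idx | c' != c].

Definition grid_rows : seq rdesc :=
  flatten [seq [seq Cell p.1 p.2 w.1 w.2 c | w <- sel p, c <- idx] | p <- idx2]
  ++ flatten [seq [seq Hub p.1 p.2 c c' | c <- others p, c' <- except c] | p <- idx2]
  ++ [seq Side true a | a <- idx] ++ [seq Side false a | a <- idx].

Definition block_tags : seq (seq nat) :=
  flatten [seq [seq TB p.1 p.2 c | c <- others p] | p <- idx2]
  ++ [seq TL p.1 p.2 | p <- idx2]
  ++ [seq lab true a | a <- idx] ++ [seq lab false a | a <- idx].

Definition vertex_tags : seq (seq nat) :=
  flatten [seq [seq vtx true a u | u <- U] | a <- idx]
  ++ flatten [seq [seq vtx false a u | u <- U] | a <- idx].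

(** The budget exceeds the least cost [copies * block_cost] of the block columns
    by [slack < copies], so that one copy of each block column is edited at
    least cost. *)
Definition slack := 2 * (C * C.-1 * C.-2) + 2 * (C * C).
Definition copies := slack.+1.
Definition grid_cols : seq (seq nat) :=
  flatten [seq nseq copies t | t <- block_tags] ++ vertex_tags.
(** Hub columns cost 1 each, tile columns 2, and the [2 * C] label columns [C.-1]. *)
Definition block_cost := C * C.-1 * C.-2 + 2 * (C * C.-1) + 2 * (C * C.-1).
Definition grid_budget := copies * block_cost + slack.

Definition pick (o : bool) (p : nat * nat) : nat := if o then p.1 else p.2.

Lemma mem_idx a : (a \in idx) = (a < C).
Proof. by rewrite mem_iota. Qed.

Lemma mem_idx2 p : (p \in idx2) = [&& p.1 < C, p.2 < C & p.1 != p.2].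
Proof.
rewrite mem_filter andbC -!mem_idx; apply/andP/and3P => [[]|[p1 p2 n]].
  by case/allpairsP => q [q1 q2 ->].
by split=> //; apply/allpairsP; exists p; rewrite -surjective_pairing.
Qed.

Lemma mem_sel p w : (w \in sel p) = [&& w.1 \in U, w.2 \in U & S p.1 p.2 w.1 w.2].
Proof.
rewrite mem_filter andbC; apply/andP/and3P => [[]|[p1 p2 n]].
  by case/allpairsP => q [q1 q2 ->].
by split=> //; apply/allpairsP; exists w; rewrite -surjective_pairing.
Qed.

Lemma mem_others p c : (c \in others p) = [&& c < C, c != p.1 & c != p.2].
Proof. by rewrite mem_filter mem_idx andbC. Qed.

Lemma mem_except c c' : (c' \in except c) = (c' < C) && (c' != c).
Proof. by rewrite mem_filter mem_idx andbC. Qed.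

Definition is_row r :=
  match r with
  | Cell a b u v c => [&& (a, b) \in idx2, (u, v) \in sel (a, b) & c < C]
  | Hub a b c c' => [&& (a, b) \in idx2, c \in others (a, b), c' < C & c' != c]
  | Side _ a => a < C
  end.

Lemma mem_rows r : (r \in grid_rows) = is_row r.
Proof.
rewrite !mem_cat; apply/or4P/idP => [[]|].
- case/flatten_mapP=> -[a b] pp /allpairsPdep[[u v] [c [ws cC ->]]] /=.
  by rewrite pp ws -mem_idx cC.
- case/flatten_mapP=> -[a b] pp /allpairsPdep[c [c' [co]]].
  by rewrite mem_except => /andP[lt ne] -> /=; rewrite pp co lt ne.
- by case/mapP=> a; rewrite mem_idx => lt ->.
- by case/mapP=> a; rewrite mem_idx => lt ->.
case: r => [a b u v c /and3P[pp ws lt]|a b c c' /and4P[pp co lt ne]|o a lt].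
- constructor 1; apply/flatten_mapP; exists (a, b) => //.
  by apply/allpairsPdep; exists (u, v), c; rewrite mem_idx.
- constructor 2; apply/flatten_mapP; exists (a, b) => //.
  by apply/allpairsPdep; exists c, c'; rewrite mem_except lt ne.
- by case: o lt => lt; [constructor 3|constructor 4]; apply: map_f; rewrite mem_idx.
Qed.

Lemma uniq_idx : uniq idx. Proof. exact: iota_uniq. Qed.

Lemma uniq_idx2 : uniq idx2.
Proof.
by apply/filter_uniq/allpairs_uniq; rewrite ?uniq_idx // => -[? ?] [? ?] _ _ [-> ->].
Qed.

Lemma uniq_sel p : uniq U -> uniq (sel p).
Proof. by move=> uU; apply/filter_uniq/allpairs_uniq => // -[? ?] [? ?] _ _ [-> ->]. Qed.

Lemma uniq_others p : uniq (others p).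
Proof. exact/filter_uniq/uniq_idx. Qed.

Lemma uniq_flatten_map (T T' : eqType) (s : seq T) (f : T -> seq T') :
  uniq s -> (forall x, x \in s -> uniq (f x)) ->
  (forall x y z, z \in f x -> z \in f y -> x = y) ->
  uniq (flatten (map f s)).
Proof.
move=> + uf inj; elim: s uf => //= x s IH uf /andP[xs us].
rewrite cat_uniq uf ?mem_head // IH // => [|y ys]; last by rewrite uf // inE ys orbT.
rewrite andbT; apply/hasPn => z /flatten_mapP[y ys zy]; apply: contra xs => zx.
by rewrite (inj _ _ _ zx zy).
Qed.

Lemma uniq_rows : uniq U -> uniq grid_rows.
Proof.
move=> uU; rewrite !cat_uniq !(map_inj_uniq _) ?uniq_idx => [|? ? []//|? ? []//].
rewrite !uniq_flatten_map ?uniq_idx2 //=.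
- rewrite andbT; apply/and3P; split.
  + apply/hasPn => r; rewrite !mem_cat => /or3P[]; last 2 first.
    * by case/mapP=> x _ ->; apply/negP => /flatten_mapP[? _ /allpairsPdep[? [? []]]].
    * by case/mapP=> x _ ->; apply/negP => /flatten_mapP[? _ /allpairsPdep[? [? []]]].
    case/flatten_mapP=> ? _ /allpairsPdep[? [? [_ _ ->]]].
    by apply/negP => /flatten_mapP[? _ /allpairsPdep[? [? []]]].
  + apply/hasPn => r; rewrite !mem_cat => /orP[] /mapP[x _ ->];
    by apply/negP => /flatten_mapP[? _ /allpairsPdep[? [? []]]].
  + by apply/hasPn => r /mapP[x _ ->]; apply/negP => /mapP[].
- move=> p pp; apply: allpairs_uniq_dep; first exact: uniq_others.
    by move=> c _; apply/filter_uniq/uniq_idx.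
  by move=> [c c1] [c' c1'] _ _ /= [-> ->].
- by move=> [a b] [a' b'] z /allpairsPdep[? [? [_ _ ->]]] /allpairsPdep[? [? [_ _ [-> ->]]]].
- move=> p pp; apply: allpairs_uniq; [exact: uniq_sel|exact: uniq_idx|].
  by move=> [[u v] c] [[u' v'] c'] _ _ /= [-> -> ->].
- by move=> [a b] [a' b'] z /allpairsPdep[? [? [_ _ ->]]] /allpairsPdep[? [? [_ _ [-> ->]]]].
Qed.

Lemma sum_rows (F : rdesc -> nat) : \sum_(r <- grid_rows) F r =
  \sum_(p <- idx2) \sum_(w <- sel p) \sum_(c <- idx) F (Cell p.1 p.2 w.1 w.2 c)
  + \sum_(p <- idx2) \sum_(c <- others p) \sum_(c' <- except c) F (Hub p.1 p.2 c c')
  + \sum_(a <- idx) F (Side true a) + \sum_(a <- idx) F (Side false a).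
Proof.
rewrite !big_cat !big_flatten !big_map /= -!addnA; congr (_ + (_ + _)).
  by apply: eq_bigr => p _; rewrite big_allpairs_dep.
by apply: eq_bigr => p _; rewrite big_allpairs_dep.
Qed.

Lemma sum_pick1 (T : eqType) (s : seq T) (x : T) (F : T -> nat) : uniq s ->
  \sum_(y <- s) (y == x) * F y = (x \in s) * F x.
Proof.
move=> us; have [xs|xs] := boolP (x \in s).
  rewrite (big_rem x) //= eqxx mul1n big_seq big1 ?addn0 ?mul1n // => y.
  by rewrite mem_rem_uniq // inE => /andP[/negPf->].
by rewrite big_seq big1 // => y ys; case: eqP => // e; rewrite -e ys in xs.
Qed.

Lemma size_others p : p \in idx2 -> size (others p) = C.-2.
Proof.
rewrite mem_idx2 => /and3P[p1 p2 n].
have := size_filter (fun c => (c != p.1) && (c != p.2)) idx; rewrite -/(others p) => ->.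
have := count_predC (fun c => (c != p.1) && (c != p.2)) idx.
rewrite (@eq_count _ (predC _) (predU (pred1 p.1) (pred1 p.2))); last first.
  by move=> c /=; rewrite negb_and !negbK.
have := count_predUI (pred1 p.1) (pred1 p.2) idx.
rewrite (@eq_count _ (predI _ _) pred0); last first.
  by move=> c /=; case: eqP => //= ->; rewrite (negPf n).
rewrite count_pred0 addn0 => ->; rewrite !count_uniq_mem ?uniq_idx // !mem_idx p1 p2 size_iota.
by lia.
Qed.

Lemma size_except c : c < C -> size (except c) = C.-1.
Proof.
move=> cC; rewrite size_filter; have := count_predC (pred1 c) idx.
by rewrite count_uniq_mem ?uniq_idx // mem_idx cC size_iota => <-.
Qed.

Lemma sum_idx2 (F : nat * nat -> nat) :
  \sum_(p <- idx2) F p = \sum_(a <- idx) \sum_(b <- except a) F (a, b).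
Proof.
rewrite big_filter big_mkcond big_allpairs_dep; apply: eq_bigr => a _.
by rewrite big_filter [RHS]big_mkcond; apply: eq_bigr => b _; rewrite /= eq_sym.
Qed.

Lemma sum_idx2_sym (F : nat * nat -> nat) :
  \sum_(p <- idx2) F p = \sum_(a <- idx) \sum_(b <- except a) F (b, a).
Proof.
rewrite sum_idx2; under eq_bigr do rewrite big_filter big_mkcond.
rewrite exchange_big; apply: eq_bigr => b _.
by rewrite big_filter [RHS]big_mkcond; apply: eq_bigr => a _; rewrite /= eq_sym.
Qed.

Lemma size_idx2 : size idx2 = C * C.-1.
Proof.
rewrite -sum1_size sum_idx2 big_seq.
rewrite (eq_bigr (fun=> C.-1)); last first.
  by move=> a; rewrite mem_idx sum1_size => /size_except.
by rewrite -big_seq big_const_seq count_predT iter_addn_0 size_iota mulnC.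
Qed.

Definition tcount t c := \sum_(r <- grid_rows) ((t \in tags r) && (color r == c)).

Definition opair (o : bool) (x y : nat) := if o then (x, y) else (y, x).

Lemma tcount_TB a b c1 c : (a, b) \in idx2 -> c1 \in others (a, b) -> c < C ->
  tcount (TB a b c1) c = (c != c1).
Proof.
move=> pp co cC; rewrite /tcount sum_rows.
rewrite big1 => [|p _]; last by rewrite big1 // => w _; rewrite big1.
rewrite ![X in _ + X + _]big1 // ![X in _ + X]big1 // add0n !addn0.
rewrite (eq_bigr (fun p => (p == (a, b)) * \sum_(c2 <- others p) (c2 == c1) * (c != c2))).
  by rewrite sum_pick1 ?uniq_idx2 // pp mul1n sum_pick1 ?uniq_others // co mul1n.
move=> [a' b'] _; rewrite big_distrr; apply: eq_bigr => c2 _ /=.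
rewrite (eq_bigr (fun c' => (c' == c) * (((a', b') == (a, b)) * (c2 == c1)))) => [|c' _].
  by rewrite sum_pick1 ?filter_uniq ?uniq_idx // mem_except cC /= mulnC -mulnA.
rewrite !inE !eqseq_cons !eqxx /= xpair_eqE (eq_sym a) (eq_sym b) (eq_sym c1).
by case: (a' == a) (b' == b) (c2 == c1) (c' == c) => [] [] [] [].
Qed.

(** Color [c] has one row for each admissible pair and one for each hub other than hub [c]. The
    colors [a] and [b] have no hub in this tile and so miss none, hence their surplus of one. *)
Lemma tcount_TL a b c : (a, b) \in idx2 -> c < C ->
  tcount (TL a b) c + ((c != a) && (c != b)) = size (sel (a, b)) + C.-2.
Proof.
move=> pp cC.
have -> : tcount (TL a b) c = size (sel (a, b)) + \sum_(c2 <- others (a, b)) (c != c2).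
  rewrite /tcount sum_rows [X in _ + X]big1 // addn0 [X in _ + X]big1 // addn0.
  congr (_ + _).
    rewrite (eq_bigr (fun p => (p == (a, b)) * size (sel p))).
      by rewrite sum_pick1 ?uniq_idx2 // pp mul1n.
    move=> [a' b'] _; rewrite -sum1_size big_distrr; apply: eq_bigr => w _ /=.
    rewrite (eq_bigr (fun c' => (c' == c) * ((a', b') == (a, b)))) => [|c' _].
      by rewrite sum_pick1 ?uniq_idx // mem_idx cC mul1n muln1.
    rewrite !inE !eqseq_cons !eqxx /= xpair_eqE (eq_sym a) (eq_sym b).
    by case: (a' == a) (b' == b) (c' == c) => [] [] [].
  rewrite (eq_bigr (fun p => (p == (a, b)) * \sum_(c2 <- others p) (c != c2))).
    by rewrite sum_pick1 ?uniq_idx2 // pp mul1n.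
  move=> [a' b'] _; rewrite big_distrr; apply: eq_bigr => c2 _ /=.
  rewrite (eq_bigr (fun c' => (c' == c) * ((a', b') == (a, b)))) => [|c' _].
    by rewrite sum_pick1 ?filter_uniq ?uniq_idx // mem_except cC /= mulnC.
  rewrite !inE !eqseq_cons !eqxx /= xpair_eqE (eq_sym a) (eq_sym b).
  by case: (a' == a) (b' == b) (c' == c) => [] [] [].
rewrite -(size_others pp) -addnA; congr (_ + _).
rewrite -(count_predC (pred1 c) (others (a, b))) addnC.
rewrite (count_uniq_mem _ (uniq_others _)) mem_others cC /=; congr (_ + _).
by rewrite -sum1_count [RHS]big_mkcond; apply: eq_bigr => c' _; rewrite /= eq_sym; case: eqP.
Qed.

Lemma sum_idx2_o (o : bool) (F : nat * nat -> nat) :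
  \sum_(p <- idx2) F p = \sum_(x <- idx) \sum_(y <- except x) F (opair o x y).
Proof. by case: o; [apply: sum_idx2|apply: sum_idx2_sym]. Qed.

(** Color [x] has a row in every hub of its [C.-1] tiles, and the side row in addition. Any other
    color misses its own hub in all of these tiles but the one that it indexes, that is in [C.-2] of
    them. The difference is [C.-1]. *)
Lemma tcount_lab o x : 1 < C -> x < C -> exists K, forall c, c < C ->
  tcount (lab o x) c = K + (c == x) * C.-1.
Proof.
move=> C2 xC; exists (\sum_(y <- except x) size (sel (opair o x y)) + (C.-1 * C.-2 - C.-2)).
move=> c cC; pose R p := size (sel p) + \sum_(c2 <- others p) (c != c2).
have -> : tcount (lab o x) c = \sum_(y <- except x) R (opair o x y) + (c == x).
  rewrite /tcount sum_rows -addnA; congr (_ + _).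
    rewrite -big_split (sum_idx2_o o).
    transitivity (\sum_(z <- idx) (z == x) * \sum_(y <- except z) R (opair o z y)); last first.
      by rewrite sum_pick1 ?uniq_idx // mem_idx xC mul1n.
    apply: eq_bigr => z _; rewrite big_distrr; apply: eq_bigr => y _ /=; rewrite /R mulnDr; congr (_ + _).
      rewrite -sum1_size big_distrr; apply: eq_bigr => w _ /=.
      rewrite (eq_bigr (fun c' => (c' == c) * (z == x))) => [|c' _].
        by rewrite sum_pick1 ?uniq_idx // mem_idx cC mul1n muln1.
      by case: o; rewrite !inE !eqseq_cons !eqxx /= (eq_sym x); case: (z == x) (c' == c) => [] [].
    rewrite big_distrr; apply: eq_bigr => c2 _ /=.
    rewrite (eq_bigr (fun c' => (c' == c) * (z == x))) => [|c' _].
      by rewrite sum_pick1 ?filter_uniq ?uniq_idx // mem_except cC /= mulnC.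
    by case: o; rewrite !inE !eqseq_cons !eqxx /= (eq_sym x); case: (z == x) (c' == c) => [] [].
  have E b : \sum_(a <- idx) ((lab o x \in tags (Side b a)) && (color (Side b a) == c))
           = (o == b) && (c == x).
    rewrite (eq_bigr (fun a => (a == x) * ((o == b) && (c == x)))).
      by rewrite sum_pick1 ?uniq_idx // mem_idx xC mul1n.
    move=> a _ /=; rewrite inE !eqseq_cons !eqxx /= andbT (eq_sym x).
    by case: (a =P x) => [->|_]; case: o b => [] [] //=; rewrite mul1n eq_sym.
  by rewrite !E; case: (o); rewrite ?addn0.
rewrite /R big_split /= -!addnA; congr (_ + _).
have memo y : y \in except x -> opair o x y \in idx2.
  by rewrite mem_except mem_idx2 => /andP[yC nxy]; case: o; rewrite /= xC yC // eq_sym.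
have H : \sum_(y <- except x) \sum_(c2 <- others (opair o x y)) (c != c2) + (c != x) * C.-2
       = C.-1 * C.-2.
  have -> : C.-1 * C.-2 = \sum_(y <- except x) C.-2.
    by rewrite big_const_seq count_predT iter_addn_0 size_except // mulnC.
  have -> : (c != x) * C.-2 = \sum_(y <- except x) ((c != x) && (c != y)).
    case: (c =P x) => [_|/eqP ncx] /=; first by rewrite big1.
    have := sum1_count (except x) (fun y => y != c).
    rewrite big_mkcond (eq_bigr (fun y => nat_of_bool (c != y))) => [->|y _]; last first.
      by rewrite eq_sym; case: (c == y).
    have := count_predC (pred1 c) (except x).
    rewrite (count_uniq_mem _ (filter_uniq _ uniq_idx)) mem_except cC ncx size_except //.
    by rewrite /= mul1n => /(congr1 predn) /= <-.
  rewrite -big_split; apply: eq_big_seq => y /memo pp /=.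
  rewrite -(size_others pp) -(count_predC (pred1 c) (others (opair o x y))).
  rewrite (count_uniq_mem _ (uniq_others _)) mem_others cC /= addnC; congr (_ + _).
    by case: (o) => //=; rewrite andbC.
  by rewrite -sum1_count [RHS]big_mkcond; apply: eq_bigr => c' _; rewrite /= eq_sym; case: eqP.
have : C.-2 <= C.-1 * C.-2 by rewrite leq_pmull //; lia.
move: H; move: (\sum_(y <- except x) _) (C.-1 * C.-2) => s1 s2.
by case: (c == x) => /=; lia.
Qed.

End Grid.

(** * The cheapest common count of a column *)

Definition dist (a b : nat) := (a - b) + (b - a).

(** A strict majority value is the unique median: moving from [B] to [T] adds [dist B T] for each
    color of the majority and saves at most as much for each other color. Here [e c] is the number
    of edits in color [c], which may exceed the distance; a total at the optimum excludes this. *)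
Lemma median_cost (C : nat) (b e : nat -> nat) B T :
  (forall c, c < C -> dist (b c) T <= e c) ->
  C < 2 * \sum_(0 <= c < C) (b c == B) ->
  \sum_(0 <= c < C) dist (b c) B <= \sum_(0 <= c < C) e c /\
  (\sum_(0 <= c < C) e c <= \sum_(0 <= c < C) dist (b c) B ->
   T = B /\ forall c, c < C -> e c = dist (b c) B).
Proof.
move=> He maj; set D := dist B T.
have key : \sum_(0 <= c < C) dist (b c) B + D * \sum_(0 <= c < C) (b c == B)
        <= \sum_(0 <= c < C) e c + D * \sum_(0 <= c < C) (b c != B).
  rewrite !big_distrr -!big_split /= !big_nat; apply: leq_sum => c /andP[_ cC].
  have := He c cC; rewrite /D /dist; case: eqP => [->|_] /=; lia.
have sumC : \sum_(0 <= c < C) (b c == B) + \sum_(0 <= c < C) (b c != B) = C.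
  rewrite -big_split /= (eq_bigr (fun=> 1)) => [|c _]; last by case: eqP.
  by rewrite sum_nat_const_nat muln1 subn0.
split; first by move: key; rewrite /D; nia.
move=> le; have D0 : D = 0 by nia.
have TB : T = B by move: D0; rewrite /D /dist; lia.
split=> // c cC; move: le; rewrite TB in He.
have cI : c \in index_iota 0 C by rewrite mem_index_iota cC.
rewrite !(big_rem c cI) /=; have: \sum_(i <- rem c (index_iota 0 C)) dist (b i) B
    <= \sum_(i <- rem c (index_iota 0 C)) e i.
  rewrite big_seq [leqRHS]big_seq; apply: leq_sum => i /mem_rem.
  by rewrite mem_index_iota => /andP[_ /He].
have := He c cC; move: (\sum_(i <- rem _ _) e i) (\sum_(i <- rem _ _) _) => s1 s2; lia.
Qed.

(** * Soundness: a cheap fair matrix yields a tiling *)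

Section Soundness.
Variables (C : nat) (U : seq (seq nat)) (S : nat -> nat -> seq nat -> seq nat -> bool).
Hypothesis uniqU : uniq U.
Hypothesis C5 : 4 < C.
Local Notation is_row := (is_row C U S).
Local Notation idx2 := (idx2 C).
Local Notation others := (others C).
Local Notation idx := (idx C).
Local Notation tcount := (tcount C U S).

(** The least number of edits that give a column of tag [t] as many ones in each color. *)
Definition kap (t : seq nat) : nat :=
  match t with 0 :: _ => 1 | 1 :: _ => 2 | 2 :: _ => C.-1 | _ => 0 end.

Lemma mem_block_tags t : t \in block_tags C ->
  [\/ exists2 p, p \in idx2 & exists2 c, c \in others p & t = TB p.1 p.2 c,
      exists2 p, p \in idx2 & t = TL p.1 p.2
    | exists o, exists2 x, x < C & t = lab o x].
Proof.
rewrite !mem_cat => /or4P[/flatten_mapP[p pp /mapP[c cp ->]]|/mapP[p pp ->]|/mapP[x]|/mapP[x]].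
- by constructor 1; exists p => //; exists c.
- by constructor 2; exists p.
- by rewrite mem_iota => xC ->; constructor 3; exists true, x.
- by rewrite mem_iota => xC ->; constructor 3; exists false, x.
Qed.

Lemma TB_block p c : p \in idx2 -> c \in others p -> TB p.1 p.2 c \in block_tags C.
Proof.
move=> pp cp; rewrite !mem_cat; apply/orP; left.
by apply/flatten_mapP; exists p => //; apply: map_f.
Qed.

Lemma TL_block p : p \in idx2 -> TL p.1 p.2 \in block_tags C.
Proof. by move=> pp; rewrite !mem_cat (map_f (fun p => TL p.1 p.2) pp) orbT. Qed.

Lemma lab_block o x : x < C -> lab o x \in block_tags C.
Proof.
by rewrite -(mem_idx C) => xC; rewrite !mem_cat; case: o; rewrite (map_f _ xC) ?orbT.
Qed.

Lemma uniq_block_tags : uniq (block_tags C).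
Proof.
rewrite !cat_uniq !map_inj_uniq ?uniq_idx ?uniq_idx2; try by [move=> ? ? []|move=> [? ?] [? ?] [-> ->]].
rewrite uniq_flatten_map ?uniq_idx2 //=; last 2 first.
- by move=> p _; rewrite map_inj_uniq ?uniq_others // => ? ? [].
- by move=> [a b] [a' b'] t /mapP[? _ ->] /mapP[? _ [-> ->]].
rewrite andbT; apply/and3P; split.
- apply/hasPn => t; rewrite !mem_cat => /or3P[] /mapP[? _ ->];
  by apply/negP => /flatten_mapP[? _ /mapP[]].
- by apply/hasPn => t; rewrite !mem_cat => /orP[] /mapP[? _ ->]; apply/negP => /mapP[].
- by apply/hasPn => t /mapP[? _ ->]; apply/negP => /mapP[].
Qed.

Lemma sum_kap : \sum_(t <- block_tags C) kap t = block_cost C.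
Proof.
rewrite !big_cat !big_flatten !big_map /= !big_const_seq !count_predT !iter_addn_0 size_iota.
rewrite size_idx2 /block_cost -!addnA; congr (_ + _); last by lia.
rewrite (eq_big_seq (fun=> C.-2)) => [|p pp].
  by rewrite big_const_seq count_predT iter_addn_0 size_idx2 // mulnC.
by rewrite big_map big_const_seq count_predT iter_addn_0 size_others // mul1n.
Qed.

Lemma sum_delta x : x < C -> \sum_(0 <= c < C) (c == x) = 1.
Proof.
move=> xC; rewrite (eq_bigr (fun c => (c == x) * 1)) => [|c _]; last by rewrite muln1.
by rewrite /index_iota subn0 sum_pick1 ?iota_uniq // mem_iota xC.
Qed.

Lemma sum_ndelta x : x < C -> \sum_(0 <= c < C) (c != x) = C.-1.
Proof.
move=> xC; have: \sum_(0 <= c < C) ((c == x) + (c != x)) = C.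
  by rewrite (eq_bigr (fun=> 1)) => [|c _]; [rewrite sum_nat_const_nat muln1 subn0|case: eqP].
by rewrite big_split /= sum_delta // add1n => /(congr1 predn).
Qed.

Definition profile t B :=
  C < 2 * \sum_(0 <= c < C) (tcount t c == B) /\
  \sum_(0 <= c < C) dist (tcount t c) B = kap t.

Lemma profile_TB a b c1 : (a, b) \in idx2 -> c1 \in others (a, b) -> profile (TB a b c1) 1.
Proof.
move=> pp co.
have c1C : c1 < C by move: co; rewrite mem_others => /andP[].
split.
  rewrite (@eq_big_nat _ _ _ _ _ _ (fun c => nat_of_bool (c != c1))) ?sum_ndelta //; first by lia.
  by move=> c /andP[_ cC]; rewrite (tcount_TB U S pp co cC); case: (c == c1).
rewrite (@eq_big_nat _ _ _ _ _ _ (fun c => nat_of_bool (c == c1))) ?sum_delta //.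
by move=> c /andP[_ cC]; rewrite (tcount_TB U S pp co cC); case: (c == c1).
Qed.

(** All colors but [a] and [b] have the count [K]. They are a strict majority when [C > 4], the
    origin of this bound on [C]. *)
Lemma profile_TL a b : (a, b) \in idx2 -> exists2 K, profile (TL a b) K &
  forall c, c < C -> tcount (TL a b) c = K + ((c == a) + (c == b)).
Proof.
move=> pp.
have /and3P[aC bC nab] : [&& a < C, b < C & a != b] by rewrite -(mem_idx2 C (a, b)).
pose K := size (sel U S (a, b)) + C.-2 - 1.
have cnt c : c < C -> tcount (TL a b) c = K + ((c == a) + (c == b)).
  move=> cC; have := tcount_TL U S pp cC; rewrite /K.
  case: (c =P a) => [->|_] /=; first by rewrite (negPf nab); lia.
  by case: (c == b) => /=; lia.
exists K => //; split; last first.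
  rewrite (@eq_big_nat _ _ _ _ _ _ (fun c => (c == a) + (c == b))) ?big_split ?sum_delta //.
  by move=> c /andP[_ cC]; rewrite (cnt c cC) /dist; lia.
have : \sum_(0 <= c < C) ((tcount (TL a b) c == K) + ((c == a) + (c == b))) >= C.
  rewrite -[leqLHS]subn0 -[leqLHS]muln1 -sum_nat_const_nat !big_nat.
  apply: leq_sum => c /andP[_ cC]; rewrite (cnt c cC).
  by case: (c == a); case: (c == b); rewrite ?addn0 ?eqxx //=; lia.
by rewrite !big_split /= !sum_delta //; lia.
Qed.

Lemma profile_lab o x : x < C -> exists2 K, profile (lab o x) K &
  forall c, c < C -> tcount (lab o x) c = K + (c == x) * C.-1.
Proof.
move=> xC; have [K HK] := tcount_lab U S o (ltnW (ltnW (ltnW C5))) xC.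
exists K => //; split; last first.
  rewrite (@eq_big_nat _ _ _ _ _ _ (fun c => (c == x) * C.-1)).
    by rewrite -big_distrl /= sum_delta // mul1n.
  by move=> c /andP[_ cC]; rewrite HK // /dist; lia.
rewrite (@eq_big_nat _ _ _ _ _ _ (fun c => nat_of_bool (c != x))) ?sum_ndelta //; first by lia.
move=> c /andP[_ cC]; rewrite HK //; case: (c == x) => /=; last by rewrite addn0 eqxx.
by rewrite mul1n; case: eqP => //; lia.
Qed.

(** In a block column the majority count is the cheapest common value. *)
Lemma block_profile t : t \in block_tags C -> exists B, profile t B.
Proof.
case/mem_block_tags => [[[a b] pp [c1 co ->]]|[[a b] pp ->]|[o [x xC ->]]].
- by exists 1; apply: profile_TB.
- by have [K ? _] := profile_TL pp; exists K.
- by have [K ? _] := profile_lab o xC; exists K.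
Qed.

Variables (nr nc : nat) (desc : 'I_nr -> rdesc) (tag : 'I_nc -> seq nat).
Variable M' : 'I_nr -> 'I_nc -> bool.
Hypothesis desc_inj : injective desc.
Hypothesis desc_row : forall i, is_row (desc i).
Hypothesis desc_surj : forall r, is_row r -> exists i, desc i = r.
Hypothesis sum_desc : forall F : rdesc -> nat,
  \sum_i F (desc i) = \sum_(r <- grid_rows C U S) F r.
Hypothesis tag_block : forall t, t \in block_tags C -> #|[set j | tag j == t]| = copies C.
Hypothesis tag_vertex : forall t, t \in vertex_tags C U -> exists j, tag j = t.

Definition M (i : 'I_nr) (j : 'I_nc) := tag j \in tags (desc i).
Definition cl (i : 'I_nr) := color (desc i).
Definition final (i : 'I_nr) : {ffun 'I_nc -> bool} := [ffun j => M' i j].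

Hypothesis fairM' : forall w c c', c < C -> c' < C ->
  #|[set i | (final i == w) && (cl i == c)]| = #|[set i | (final i == w) && (cl i == c')]|.
Hypothesis cheap : \sum_j \sum_i (M i j != M' i j) <= grid_budget C.

Lemma cl_lt i : cl i < C.
Proof.
have := desc_row i; rewrite /cl; case: (desc i) => [a b u v c|a b c c'|o a] //=.
  by case/and3P.
by case/and4P.
Qed.

(** Fairness holds for each final row content, hence for every set [Q] of contents. It is applied to
    the ones of a column and to a single cluster. *)
Lemma fair_sum (Q : pred {ffun 'I_nc -> bool}) c c' : c < C -> c' < C ->
  \sum_i (Q (final i) && (cl i == c)) = \sum_i (Q (final i) && (cl i == c')).
Proof.
have E d : d < C -> \sum_i (Q (final i) && (cl i == d))
    = \sum_(w | Q w) #|[set i | (final i == w) && (cl i == d)]|.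
  move=> dC; rewrite (eq_bigr (fun i => if Q (final i) && (cl i == d) then 1 else 0)) => [|i _].
    rewrite -big_mkcond (partition_big final Q) => [|i /andP[]//].
    apply: eq_bigr => w Qw; rewrite -sum1_card; apply: eq_bigl => i.
    by rewrite inE andbC; case: eqP => //= ->; rewrite Qw.
  by case: ifP.
by move=> cC c'C; rewrite !E //; apply: eq_bigr => w _; apply: fairM'.
Qed.

Definition cost j := \sum_i (M i j != M' i j).

Lemma sum_cl (P : 'I_nr -> bool) :
  \sum_i P i = \sum_(0 <= c < C) \sum_i (P i && (cl i == c)).
Proof.
rewrite exchange_big; apply: eq_bigr => i _ /=.
rewrite (eq_bigr (fun c => P i * (c == cl i))) => [|c _]; last by rewrite mulnb eq_sym.
by rewrite -big_distrr /= sum_delta ?cl_lt ?muln1.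
Qed.

Lemma tcountE t c : tcount t c = \sum_i ((t \in tags (desc i)) && (cl i == c)).
Proof. by rewrite /tcount -sum_desc. Qed.

Lemma lost_gained (P Q R : 'I_nr -> bool) :
  \sum_i (P i && R i) + \sum_i (~~ P i && Q i && R i)
  = \sum_i (Q i && R i) + \sum_i (P i && ~~ Q i && R i).
Proof.
by rewrite -!big_split; apply: eq_bigr => i _; case: (P i) (Q i) (R i) => [] [] [].
Qed.

Lemma changed (P Q R : 'I_nr -> bool) :
  \sum_i ((P i != Q i) && R i)
  = \sum_i (~~ P i && Q i && R i) + \sum_i (P i && ~~ Q i && R i).
Proof.
by rewrite -!big_split; apply: eq_bigr => i _; case: (P i) (Q i) (R i) => [] [] [].
Qed.

(** Fairness gives every color the same number [T] of ones in the column, so [median_cost] applies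
    with the edits of each color as [e]. *)
Lemma block_col j B : profile (tag j) B ->
  kap (tag j) <= cost j /\ (cost j <= kap (tag j) ->
    forall c, c < C -> \sum_i (M' i j && (cl i == c)) = B /\
      \sum_i ((M i j != M' i j) && (cl i == c)) = dist (tcount (tag j) c) B).
Proof.
move=> [maj sumk]; pose T := \sum_i (M' i j && (cl i == 0)).
have HT c : c < C -> \sum_i (M' i j && (cl i == c)) = T.
  move=> cC; have := @fair_sum (fun w => w j) c 0 cC (ltnW (ltnW (ltnW (ltnW C5)))).
  by rewrite /T; under eq_bigr do rewrite ffunE; under [RHS]eq_bigr do rewrite ffunE.
pose e c := \sum_i ((M i j != M' i j) && (cl i == c)).
have He c : c < C -> dist (tcount (tag j) c) T <= e c.
  move=> cC; rewrite /e changed tcountE -(HT c cC).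
  have := lost_gained (M^~ j) (M'^~ j) (fun i => cl i == c).
  rewrite /dist /M; move: (\sum_i _) (\sum_i _) (\sum_i _) (\sum_i _) => s1 s2 s3 s4; lia.
have [lb eqc] := median_cost He maj.
rewrite sumk -/(e _) in lb eqc; rewrite /cost sum_cl; split=> // /eqc [TB E] c cC.
by rewrite HT // TB; split=> //; apply: E.
Qed.

Definition is_block j := tag j \in block_tags C.

Lemma block_lb j : is_block j -> kap (tag j) <= cost j.
Proof. by move=> /block_profile [B /block_col []]. Qed.

Lemma sum_by_tag (F : 'I_nc -> nat) :
  \sum_(j | is_block j) F j = \sum_(t <- block_tags C) \sum_(j | tag j == t) F j.
Proof.
rewrite big_mkcond (eq_bigr (fun t => \sum_j (t == tag j) * F j)) => [|t _]; last first.
  by rewrite big_mkcond; apply: eq_bigr => j _; rewrite eq_sym; case: eqP => _; rewrite ?mul1n.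
rewrite exchange_big; apply: eq_bigr => j _; rewrite /is_block.
rewrite (sum_pick1 (tag j) (fun=> F j) uniq_block_tags).
by case: (_ \in _); rewrite ?mul1n.
Qed.

Lemma block_total : \sum_(j | is_block j) kap (tag j) = copies C * block_cost C.
Proof.
rewrite sum_by_tag -sum_kap big_distrr; apply: eq_big_seq => t tb /=.
rewrite -(tag_block tb) -sum_nat_const; apply: eq_big => [j|j /eqP ->//].
by rewrite inE.
Qed.

Lemma cheap_split :
  \sum_(j | is_block j) (cost j - kap (tag j)) + \sum_(j | ~~ is_block j) cost j <= slack C.
Proof.
rewrite sumnB; last by move=> j; apply: block_lb.
have := cheap; rewrite (bigID is_block) /= -/(cost _) block_total /grid_budget.
have : \sum_(j | is_block j) kap (tag j) <= \sum_(j | is_block j) cost j.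
  by apply: leq_sum => j; apply: block_lb.
rewrite block_total; rewrite -![\sum_(j | _) \sum_i _]/(\sum_(j | _) cost j).
by move: (\sum_(j | is_block j) cost j) (\sum_(j | ~~ _) cost j) (copies C * _) => a b c; lia.
Qed.

Lemma vertex_cost : \sum_(j | ~~ is_block j) cost j <= slack C.
Proof. exact: leq_trans (leq_addl _ _) cheap_split. Qed.

(** Otherwise each of the [slack.+1] copies would exceed the least cost by at least one. *)
Lemma good_copy t : t \in block_tags C -> exists2 j, tag j = t & cost j <= kap t.
Proof.
move=> tb; have [/existsP[j /andP[/eqP jt jc]]|] := boolP [exists j, (tag j == t) && (cost j <= kap t)].
  by exists j.
rewrite negb_exists => /forallP no.
have: copies C <= \sum_(j | is_block j) (cost j - kap (tag j)).
  rewrite -(tag_block tb) -sum1_card (eq_bigl (fun j => tag j == t)) => [|j]; last by rewrite inE.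
  rewrite big_mkcond [leqRHS]big_mkcond; apply: leq_sum => j _.
  case: eqP => // jt; rewrite /is_block jt tb; have := no j; rewrite jt eqxx /=; lia.
by have := cheap_split; rewrite /copies; lia.
Qed.

Variable i0 : 'I_nr.

(** The entry of row [i] in a copy of the column [t] that is edited at least cost. *)
Definition final_bit (t : seq nat) (i : 'I_nr) : bool :=
  if [pick j | (tag j == t) && (cost j <= kap t)] is Some j then M' i j else false.
Local Notation F := final_bit.
Local Notation I t i := (t \in tags (desc i)).

Lemma final_bit_eq t i k : final i = final k -> F t i = F t k.
Proof.
rewrite /F; case: pickP => // j _ E.
by have := congr1 (fun w : {ffun 'I_nc -> bool} => w j) E; rewrite !ffunE.
Qed.

Lemma final_bit_col t B c : t \in block_tags C -> profile t B -> c < C ->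
  \sum_i (F t i && (cl i == c)) = B /\
  \sum_i ((I t i != F t i) && (cl i == c)) = dist (tcount t c) B.
Proof.
move=> tb pB cC; rewrite /F; case: pickP => [j /andP[/eqP jt jc]|no].
  by rewrite -jt in pB jc *; have [_ /(_ jc c cC)] := block_col pB.
by have [j jt jc] := good_copy tb; have := no j; rewrite jt eqxx jc.
Qed.

Lemma sum0P (P : 'I_nr -> bool) i : \sum_k P k = 0 -> ~~ P i.
Proof. by move=> /eqP; rewrite sum_nat_eq0 => /forallP /(_ i); case: (P i). Qed.

Lemma sum1P (P : 'I_nr -> bool) : \sum_k P k = 1 -> exists x, forall i, P i = (i == x).
Proof.
move=> E; have : #|[pred i | P i]| == 1.
  rewrite -sum1_card big_mkcond -E; apply/eqP; apply: eq_bigr => i _.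
  by rewrite inE; case: (P i).
case/card1P => x H; by exists x => i; have := H i; rewrite !inE.
Qed.

Section Column.
Variables (t : seq nat) (B : nat).
Hypotheses (tb : t \in block_tags C) (pB : profile t B).

(** The number of edits equals the difference of the counts, so no color both gains and loses
    ones. *)
Lemma gained_lost c : c < C ->
  \sum_i (~~ I t i && F t i && (cl i == c)) = B - tcount t c /\
  \sum_i (I t i && ~~ F t i && (cl i == c)) = tcount t c - B.
Proof.
move=> cC; have [Fc] := final_bit_col tb pB cC; rewrite changed tcountE /dist -Fc.
have := lost_gained (fun i => I t i) (F t) (fun i => cl i == c).
by move: (\sum_i _) (\sum_i _) (\sum_i _) (\sum_i _) => s1 s2 s3 s4; lia.
Qed.

Lemma no_gain i : B <= tcount t (cl i) -> F t i -> I t i.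
Proof.
move=> le; have [g _] := gained_lost (cl_lt i); have := @sum0P _ i (etrans g _).
by rewrite eqxx andbT; case: (F t i) => //; case: (I t i) => // H _; apply/H/eqP.
Qed.

Lemma no_loss i : tcount t (cl i) <= B -> I t i -> F t i.
Proof.
move=> le; have [_ g] := gained_lost (cl_lt i); have := @sum0P _ i (etrans g _).
by rewrite eqxx andbT; case: (I t i) => //; case: (F t i) => // H _; apply/H/eqP.
Qed.

End Column.

(** A cluster contains the color of [i], hence by fairness all colors. Most arguments below inspect
    a row of a well-chosen color in a given cluster. *)
Lemma same_color i c : c < C -> exists2 k, final k = final i & cl k = c.
Proof.
move=> cC; have := fair_sum (pred1 (final i)) cC (cl_lt i).
rewrite [RHS](bigD1 i) //= !eqxx /= add1n.
have [/existsP[k /andP[/eqP fk /eqP ck]] _|] := boolP [exists k, (final k == final i) && (cl k == c)].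
  by exists k.
by rewrite negb_exists => /forallP no; rewrite big1 // => k _; rewrite (negPf (no k)).
Qed.

Definition reg (r : rdesc) : option (nat * nat) :=
  match r with Cell a b _ _ _ | Hub a b _ _ => Some (a, b) | Side _ _ => None end.

Definition side_val (o : bool) (r : rdesc) : seq nat :=
  if r is Cell _ _ u v _ then (if o then u else v) else [::].

Lemma tags_TL p r : (TL p.1 p.2 \in tags r) = (reg r == Some p).
Proof.
case: p r => a b [a' b' u v c|a' b' c c'|[] a'] /=; rewrite !inE !eqseq_cons !eqxx //=;
by rewrite !andbT ?orbF -[RHS]/((a', b') == (a, b)) xpair_eqE (eq_sym a) (eq_sym b).
Qed.

Lemma tags_lab o x r : (lab o x \in tags r) =
  (r == Side o x) || (if reg r is Some p then pick o p == x else false).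
Proof.
have NS r' p : reg r' = Some p -> (r' == Side o x) = false.
  by move=> rr; apply/eqP => E; rewrite E in rr.
case: r => [a b u v c|a b c c'|o' a]; rewrite ?(NS _ (a, b)) // !inE !eqseq_cons !eqxx /=.
- by case: o {NS}; rewrite /= ?andbT ?orbF eq_sym.
- by case: o {NS}; rewrite /= ?andbT ?orbF eq_sym.
rewrite orbF andbT; apply/andP/eqP => [[/eqP oo /eqP ->]|[-> ->]]; last by rewrite !eqxx.
by case: o o' oo {NS} => [] [].
Qed.

Lemma tags_TB a b c r : (TB a b c \in tags r) =
  if r is Hub a' b' c' _ then [&& a' == a, b' == b & c' == c] else false.
Proof.
case: r => [a' b' u v c1|a' b' c1 c'|o' a'] /=; rewrite !inE ?eqseq_cons ?eqxx //=.
by rewrite andbT (eq_sym a) (eq_sym b) (eq_sym c).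
Qed.

Lemma tags_vtx o x u r : (vtx o x u \in tags r) =
  if r is Cell a b _ _ _ then (pick o (a, b) == x) && (side_val o r == u) else false.
Proof.
case: r => [a b u1 v1 c|a b c c'|o' a] /=; rewrite !inE ?eqseq_cons ?eqxx //=.
by case: o; rewrite /= ?orbF eq_sym (eq_sym u).
Qed.

Lemma fresh (s : seq nat) : size s < C -> exists2 d, d < C & d \notin s.
Proof.
move=> sC; have [/allP H|/allPn[d]] := boolP (all (mem s) (iota 0 C)).
  by have := uniq_leq_size (iota_uniq 0 C) H; rewrite size_iota leqNgt sC.
by rewrite mem_iota; exists d.
Qed.

Lemma desc_cell i a b : reg (desc i) = Some (a, b) ->
  (exists u v, desc i = Cell a b u v (cl i)) \/ (exists c, desc i = Hub a b c (cl i)).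
Proof.
rewrite /cl; case: (desc i) => //= [a' b' u v c|a' b' c c'] [-> ->].
  by left; exists u, v.
by right; exists c.
Qed.

(** * Hub clusters *)

Section HubClass.
Variables (a b c : nat).
Hypotheses (pp : (a, b) \in idx2) (co : c \in others (a, b)).
Local Notation t := (TB a b c).

Lemma hub_mem i : I t i -> desc i = Hub a b c (cl i) /\ cl i != c.
Proof.
rewrite tags_TB /cl; have := desc_row i.
case: (desc i) => //= a' b' c1 c' /and4P[_ _ _ ne] /and3P[/eqP <- /eqP <- /eqP <-].
by split.
Qed.

Lemma hub_row d : d < C -> d != c -> exists2 h, desc h = Hub a b c d & I t h.
Proof.
move=> dC ndc; have [|h hd] := desc_surj (r := Hub a b c d).
  by rewrite /= pp co dC.
by exists h => //; rewrite hd tags_TB !eqxx.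
Qed.

(** The majority count is 1, and only color [c] is off, with no row at all. So the column gains a
    single row, of color [c], and changes nowhere else. *)
Lemma hub_col : exists x, [/\ cl x = c, ~~ I t x & forall i, F t i = I t i || (i == x)].
Proof.
have tb := TB_block pp co; have pB := profile_TB pp co.
have cC : c < C by move: co; rewrite mem_others => /andP[].
have [+ _] := gained_lost tb pB cC; rewrite (tcount_TB U S pp co cC) eqxx subn0 => /sum1P[x Hx].
have := Hx x; rewrite eqxx => /andP[/andP[nIx Fx] /eqP cx].
exists x; split=> // i; have [ci|nci] := eqVneq (cl i) c.
  have nI : ~~ I t i by apply/negP => /hub_mem[_]; rewrite ci eqxx.
  by rewrite -Hx ci eqxx andbT nI (negPf nI).
have tc : tcount t (cl i) = 1 by rewrite (tcount_TB U S pp co (cl_lt i)) nci.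
have -> : (i == x) = false by apply/eqP => E; rewrite E cx eqxx in nci.
rewrite orbF; apply/idP/idP; [apply: (no_gain tb pB)|apply: (no_loss tb pB)];
by rewrite tc.
Qed.

(** The column ends with one row of each color, and any cluster among these rows needs all
    colors. *)
Lemma hub_class i k : F t i -> F t k -> final i = final k.
Proof.
have [x [cx nIx Fx]] := hub_col.
have uniq_cl z w : F t z -> F t w -> cl z = cl w -> z = w.
  rewrite !Fx => /orP[/hub_mem[dz nz]|/eqP->] /orP[/hub_mem[dw nw]|/eqP->] // E.
  - by apply: desc_inj; rewrite dz dw E.
  - by rewrite E cx eqxx in nz.
  - by rewrite -E cx eqxx in nw.
move=> Fi Fk; have [z zi zk] := same_color i (cl_lt k).
by rewrite -zi (uniq_cl z k) // (final_bit_eq _ zi).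
Qed.

End HubClass.

(** * Rows that leave their tile *)

Section Leavers.
Variable p : nat * nat.
Hypothesis pp : p \in idx2.
Local Notation t := (TL p.1 p.2).

Lemma TL_no_gain i : F t i -> I t i.
Proof.
case: p pp => a b /= pp'; have [K pK cnt] := profile_TL pp'.
by apply: (no_gain (TL_block pp') pK); rewrite cnt ?cl_lt // leq_addr.
Qed.

Lemma TL_lost_cl i : I t i -> ~~ F t i -> cl i = p.1 \/ cl i = p.2.
Proof.
case: p pp => a b /= pp'; have [K pK cnt] := profile_TL pp' => Ii nFi.
have [->|na] := eqVneq (cl i) a; first by left.
have [->|nb] := eqVneq (cl i) b; first by right.
case/negP: nFi; apply: (no_loss (TL_block pp') pK) => //.
by rewrite cnt ?cl_lt // (negPf na) (negPf nb) addn0.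
Qed.

Lemma TL_lost1 c : c = p.1 \/ c = p.2 -> exists l, forall i,
  (I t i && ~~ F t i && (cl i == c)) = (i == l).
Proof.
case: p pp => a b /= pp'; have [K pK cnt] := profile_TL pp' => cab.
have /and3P[aC bC nab] : [&& a < C, b < C & a != b] by rewrite -(mem_idx2 C (a, b)).
have cC : c < C by case: cab => ->.
have [_] := gained_lost (TL_block pp') pK cC; rewrite cnt // => lost.
apply: sum1P; rewrite lost addKn.
by case: cab => ->; rewrite eqxx ?(negPf nab) // eq_sym (negPf nab).
Qed.

(** If a hub row lost the tile tag, so would its whole cluster, with a hub row whose color [d] is
    not one of the two colors of the tile; but only these two lose the tag. *)
Lemma leaver_cell i : I t i -> ~~ F t i -> exists u v, desc i = Cell p.1 p.2 u v (cl i).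
Proof.
move=> Ii nFi; have := Ii; rewrite tags_TL => /eqP.
rewrite {1}[p]surjective_pairing => /desc_cell[//|[c di]].
have := desc_row i; rewrite di => /and4P[_ co' _ _].
have pp' : (p.1, p.2) \in idx2 by rewrite -surjective_pairing.
have [d dC] := fresh (s := [:: p.1; p.2; c]) (ltnW C5).
rewrite !inE !negb_or => /and3P[d1 d2 d3].
have [h hd Ih] := hub_row pp' co' dC d3.
have [x [_ _ Fx]] := hub_col pp' co'.
have E : final i = final h.
  by apply: (hub_class pp' co'); rewrite Fx ?Ih // di tags_TB !eqxx.
have Ith : I t h by rewrite tags_TL hd /= -surjective_pairing.
have := TL_lost_cl Ith; rewrite -(final_bit_eq _ E) /cl hd /= => /(_ nFi) [] dE.
  by rewrite dE eqxx in d1.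
by rewrite dE eqxx in d2.
Qed.

End Leavers.

(** The hub row [h] keeps the tile tag, hence so does [x], which thus comes from the same tile. Were
    [x] a row of another hub [c2], the rows [h] and [g] of hub [c] would both gain the tag of [c2],
    whose column gains a single row. *)
Lemma exchanged_cell a b c x : (a, b) \in idx2 -> c \in others (a, b) ->
  ~~ I (TB a b c) x -> F (TB a b c) x -> exists u v, desc x = Cell a b u v (cl x).
Proof.
move=> pp co nIx Fx; have [d dC] := fresh (s := [:: a; b; c]) (ltnW C5).
rewrite !inE !negb_or => /and3P[d1 d2 d3].
have /and3P[aC bC nab] : [&& a < C, b < C & a != b] by rewrite -(mem_idx2 C (a, b)).
have nac : a != c by move: co; rewrite mem_others eq_sym => /and3P[].
have [x1 [_ _ Fx1]] := hub_col pp co.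
have [h hd Ih] := hub_row pp co dC d3; have [g gd Ig] := hub_row pp co aC nac.
have Eh : final x = final h by apply: (hub_class pp co); rewrite // Fx1 Ih.
have Eg : final x = final g by apply: (hub_class pp co); rewrite // Fx1 Ig.
have FTLh : F (TL a b) h.
  apply/negPn/negP => nF; have := TL_lost_cl pp (i := h).
  rewrite tags_TL hd /= /cl hd /= eqxx => /(_ isT nF) [] E.
    by rewrite E eqxx in d1.
  by rewrite E eqxx in d2.
have : I (TL a b) x by apply: (TL_no_gain pp); rewrite (final_bit_eq _ Eh).
rewrite (tags_TL (a, b)) => /eqP/desc_cell[//|[c2 dx]].
have := desc_row x; rewrite dx /= => /and4P[_ co2 _ _].
have n2 : c2 != c by apply: contra nIx => /eqP E; rewrite dx E tags_TB !eqxx.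
have [x2 [_ _ Fx2]] := hub_col pp co2.
have F2x : F (TB a b c2) x by rewrite Fx2 dx tags_TB !eqxx.
have := F2x; rewrite (final_bit_eq _ Eh) Fx2 hd tags_TB (eq_sym c) (negPf n2) !andbF /= => /eqP hx2.
have := F2x; rewrite (final_bit_eq _ Eg) Fx2 gd tags_TB (eq_sym c) (negPf n2) !andbF /= => /eqP gx2.
by move: gd; rewrite gx2 -hx2 hd => -[E]; rewrite E eqxx in d1.
Qed.

(** The row of color [y] that loses the tag of its tile [opair o x y]: it ends up
    in the cluster of [Side o x]. *)
Definition leaver o x y : 'I_nr :=
  let p := opair o x y in
  odflt i0 [pick i | I (TL p.1 p.2) i && ~~ F (TL p.1 p.2) i && (cl i == y)].

Lemma opairP o x y : x < C -> y < C -> x != y -> opair o x y \in idx2.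
Proof. by move=> xC yC n; rewrite mem_idx2; case: o; rewrite /= xC yC // eq_sym. Qed.

Lemma pick_opair o x y : pick o (opair o x y) = x. Proof. by case: o. Qed.
Lemma pickN_opair o x y : pick (~~ o) (opair o x y) = y. Proof. by case: o. Qed.

Lemma opair_pick o p : opair o (pick o p) (pick (~~ o) p) = p.
Proof. by case: o; case: p. Qed.

Section LeaverFacts.
Variables (o : bool) (x y : nat).
Hypotheses (xC : x < C) (yC : y < C) (nxy : x != y).
Local Notation p := (opair o x y).
Local Notation l := (leaver o x y).

Lemma leaverP : [/\ I (TL p.1 p.2) l, ~~ F (TL p.1 p.2) l, cl l = y
  & forall i, I (TL p.1 p.2) i -> ~~ F (TL p.1 p.2) i -> cl i = y -> i = l].
Proof.
have pp := opairP o xC yC nxy.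
have [|k Hk] := TL_lost1 pp (c := y); first by case: (o); [right|left].
have Hl : I (TL p.1 p.2) l && ~~ F (TL p.1 p.2) l && (cl l == y).
  rewrite /l; case: pickP => //= no.
  by have := no k; rewrite Hk eqxx.
have /andP[/andP[? ?] /eqP ?] := Hl; split=> // i Ii nFi ci.
by move: Hl; rewrite Hk => /eqP ->; apply/eqP; rewrite -Hk Ii nFi ci eqxx.
Qed.

Lemma leaver_desc : exists u, exists v, desc l = Cell p.1 p.2 u v y.
Proof.
have [Il nFl cly _] := leaverP.
by have [u [v dl]] := leaver_cell (opairP o xC yC nxy) Il nFl; exists u, v; rewrite dl cly.
Qed.

End LeaverFacts.

(** * Side clusters *)

Section SideColumns.
Variables (o : bool) (x : nat).
Hypothesis xC : x < C.
Local Notation t := (lab o x).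

Lemma lab_no_gain i : F t i -> I t i.
Proof.
have [K pK cnt] := profile_lab o xC.
by apply: (no_gain (lab_block o xC) pK); rewrite cnt ?cl_lt // leq_addr.
Qed.

Lemma lab_no_loss i : cl i != x -> I t i -> F t i.
Proof.
move=> ni; have [K pK cnt] := profile_lab o xC.
by apply: (no_loss (lab_block o xC) pK); rewrite cnt ?cl_lt // (negPf ni) addn0.
Qed.

Lemma lab_lost_card : #|[set i | I t i && ~~ F t i]| = C.-1.
Proof.
have [K pK cnt] := profile_lab o xC.
have [_] := gained_lost (lab_block o xC) pK xC; rewrite cnt // eqxx mul1n addKn => <-.
rewrite -sum1_card big_mkcond; apply: eq_bigr => i _; rewrite inE.
have [_|ni] := eqVneq (cl i) x; first by rewrite andbT; case: (_ && _).
by rewrite andbF; case: (boolP (I t i)) => //= Ii; rewrite lab_no_loss.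
Qed.

End SideColumns.

Lemma lab_reg o x i : I (lab o x) i ->
  desc i = Side o x \/ exists2 y, y < C & y != x /\ reg (desc i) = Some (opair o x y).
Proof.
rewrite tags_lab => /orP[/eqP ->|]; first by left.
case E: (reg (desc i)) => [p|//] /eqP px; right.
have pp : p \in idx2.
  have := desc_row i; case: (desc i) E => [a b u v c|a b c c'|//] [<-] /=; first by case/and3P.
  by case/and4P.
have /and3P[p1 p2 n] : [&& p.1 < C, p.2 < C & p.1 != p.2] by rewrite -mem_idx2.
exists (pick (~~ o) p); first by case: (o).
by rewrite -px opair_pick; split=> //; case: (o) => //=; rewrite eq_sym.
Qed.

Lemma reg_TL i p : reg (desc i) = Some p -> I (TL p.1 p.2) i.
Proof. by rewrite tags_TL => ->. Qed.

Lemma leaver_keeps o x y : x < C -> y < C -> x != y -> F (lab o x) (leaver o x y).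
Proof.
move=> xC yC n; have [Il _ cly _] := leaverP o xC yC n.
apply: lab_no_loss => //; first by rewrite cly eq_sym.
move: Il; rewrite tags_TL tags_lab => /eqP ->.
by rewrite pick_opair eqxx orbT.
Qed.

(** If both labels stayed, a row of the same cluster with a color other than [x] and [y] would have
    had both labels, hence come from the same tile, and would have lost its tile tag. Only colors
    [x] and [y] lose it. *)
Lemma leaver_leaves o x y : x < C -> y < C -> x != y ->
  I (lab (~~ o) y) (leaver o x y) && ~~ F (lab (~~ o) y) (leaver o x y).
Proof.
move=> xC yC n; have [Il nFl cly _] := leaverP o xC yC n.
have -> : I (lab (~~ o) y) (leaver o x y).
  by move: Il; rewrite tags_TL tags_lab => /eqP ->; rewrite pickN_opair eqxx orbT.
apply/negP => Fy; have Fx := leaver_keeps o xC yC n.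
have [d dC] := fresh (s := [:: x; y]) (ltnW (ltnW C5)).
rewrite !inE !negb_or => /andP[d1 d2].
have [k kl kd] := same_color (leaver o x y) dC.
have Ikx : I (lab o x) k by apply: lab_no_gain => //; rewrite (final_bit_eq _ kl).
have Iky : I (lab (~~ o) y) k by apply: lab_no_gain => //; rewrite (final_bit_eq _ kl).
have [Ek|[z zC [nz rk]]] := lab_reg Ikx.
  by move: Iky; rewrite Ek tags_lab orbF => /eqP [E _]; case: (o) E.
have zy : z = y.
  have [Ek|[w wC [nw rk']]] := lab_reg Iky; first by rewrite Ek in rk.
  by move: rk; rewrite rk' => -[]; case: (o) => -[].
rewrite zy in rk; have Ik := reg_TL rk.
have nFk : ~~ F (TL (opair o x y).1 (opair o x y).2) k by rewrite (final_bit_eq _ kl).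
have := TL_lost_cl (opairP o xC yC n) Ik nFk; rewrite kd.
by case=> E; [move: d1 d2|move: d1 d2]; rewrite E; case: (o); rewrite /= eqxx ?andbF.
Qed.

Definition side_row o x : 'I_nr := odflt i0 [pick i | desc i == Side o x].

Lemma side_rowE o x : x < C -> desc (side_row o x) = Side o x.
Proof.
move=> xC; rewrite /side_row; case: pickP => [i /eqP //|no].
by have [i di] := desc_surj (r := Side o x) xC; have := no i; rewrite di eqxx.
Qed.

Lemma leaver_inj o x y x' y' : x < C -> y < C -> x != y -> x' < C -> y' < C -> x' != y' ->
  leaver o x y = leaver o x' y' -> x = x' /\ y = y'.
Proof.
move=> xC yC n1 xC' yC' n1' E.
have [+ _ _ _] := leaverP o xC yC n1; have [+ _ _ _] := leaverP o xC' yC' n1'.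
rewrite !tags_TL -E => /eqP-> /eqP[H]; have := congr1 (pick o) H; have := congr1 (pick (~~ o)) H.
by rewrite !pick_opair !pickN_opair.
Qed.

(** The label column loses [C.-1] rows. The rows of color [x] that leave their tiles for clusters of
    the opposite side are already that many. *)
Lemma side_keeps o x : x < C -> F (lab o x) (side_row o x).
Proof.
move=> xC; apply/negPn/negP => nF.
pose s := side_row o x :: [seq leaver (~~ o) y x | y <- except C x].
pose Lo := [set i | I (lab o x) i && ~~ F (lab o x) i].
have sLo : {subset s <= enum Lo}.
  move=> i; rewrite mem_enum inE /s inE => /orP[/eqP ->|/mapP[y]].
    by rewrite nF side_rowE // tags_lab eqxx.
  rewrite mem_except => /andP[yC nyx] ->.
  by have := leaver_leaves (~~ o) yC xC nyx; rewrite negbK.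
have us : uniq s.
  rewrite /s /= map_inj_in_uniq ?filter_uniq ?iota_uniq // ?andbT.
    apply/mapP => -[y]; rewrite mem_except => /andP[yC nyx] E.
    have [+ _ _ _] := leaverP (~~ o) yC xC nyx.
    by rewrite tags_TL -E side_rowE.
  move=> y y'; rewrite !mem_except => /andP[yC n1] /andP[yC' n1'].
  by case/leaver_inj.
have := uniq_leq_size us sLo; rewrite -cardE /Lo lab_lost_card //= size_map size_except //.
by rewrite ltnn.
Qed.

(** The cluster of the side row contains a row of color [y]. It has the label of [x], so it comes
    from a tile [opair o x z], and like the side row it ends without the tile tag. Only colors [x]
    and [z] lose that tag, so [z = y] and the row is the leaver. *)
Lemma side_class o x y : x < C -> y < C -> x != y ->
  final (leaver o x y) = final (side_row o x).
Proof.
move=> xC yC nxy; have [k kf kc] := same_color (side_row o x) yC.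
have Ik : I (lab o x) k by apply: lab_no_gain => //; rewrite (final_bit_eq _ kf) side_keeps.
have [Ek|[z zC [nz rk]]] := lab_reg Ik; first by rewrite /cl Ek /= in kc; rewrite kc eqxx in nxy.
have zx : x != z by rewrite eq_sym.
have pp := opairP o xC zC zx; have Itk := reg_TL rk.
have nFk : ~~ F (TL (opair o x z).1 (opair o x z).2) k.
  rewrite (final_bit_eq _ kf); apply/negP => /(TL_no_gain pp).
  by rewrite tags_TL side_rowE.
have zy : z = y.
  have := TL_lost_cl pp Itk nFk; rewrite kc; case: (o) => /= -[] E //; by rewrite E eqxx in nxy.
subst z; have [_ _ _ lu] := leaverP o xC yC nxy.
by rewrite -(lu k).
Qed.

(** ** Edits in the vertex columns *)

Definition vedits i := \sum_(j | ~~ is_block j) (M i j != M' i j).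

Lemma vedits_total : \sum_i vedits i <= slack C.
Proof. by rewrite exchange_big; apply: vertex_cost. Qed.

Lemma mem_vertex_tags o x u : x < C -> u \in U -> vtx o x u \in vertex_tags C U.
Proof.
rewrite -(mem_idx C) => xC uU; rewrite mem_cat; apply/orP; case: o; [left|right];
by apply/flatten_mapP; exists x => //; apply: map_f.
Qed.

Lemma vertex_not_block o x u : vtx o x u \notin block_tags C.
Proof. by apply/negP => /mem_block_tags[[? _ [? _]]|[]|[? [? _]]]. Qed.

(** Two rows that differ in a column at first and agree in the end cost an edit there, and distinct
    tags belong to distinct columns. Only edits of rows in [K] are counted, so the bounds for
    disjoint classes add up. *)
Lemma class_edits (K : pred 'I_nr) (ts : seq (seq nat)) : uniq ts ->
  (forall t, t \in ts -> [/\ t \in vertex_tags C U, t \notin block_tags C &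
    exists i k, [/\ K i, K k, final i = final k & I t i && ~~ I t k]]) ->
  size ts <= \sum_(i | K i) vedits i.
Proof.
move=> uts H; rewrite exchange_big /=; set D := fun j => \sum_(i | K i) (M i j != M' i j).
apply: (@leq_trans (\sum_j (tag j \in ts) * D j)); last first.
  rewrite [leqRHS]big_mkcond; apply: leq_sum => j _.
  by case: ifP => [_|/negbFE jb]; [case: (_ \in _); rewrite ?mul1n|
    case: (boolP (_ \in ts)) => // /H[_ /negP]].
rewrite (eq_bigr (fun j => \sum_(t <- ts) (t == tag j) * D j)) => [|j _]; last first.
  by rewrite (sum_pick1 (tag j) (fun=> D j) uts).
rewrite exchange_big -sum1_size big_seq [leqRHS]big_seq; apply: leq_sum => t tts /=.
have [/tag_vertex[j jt] _ [i [k [Ki Kk E /andP[Ii nIk]]]]] := H t tts.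
rewrite (bigD1 j) //= jt eqxx mul1n; apply: leq_trans (leq_addr _ _).
have Ej : M' i j = M' k j.
  by have := congr1 (fun w : {ffun 'I_nc -> bool} => w j) E; rewrite !ffunE.
have [Ei|Ei] := eqVneq (M i j) (M' i j).
  rewrite /D (bigD1 k) //= -Ej -Ei; apply: leq_trans (leq_addr _ _).
  by rewrite /M jt Ii (negPf nIk).
by rewrite /D (bigD1 i) //= Ei.
Qed.

(** Tags of hubs and sides, without those of tiles. The side row is the row whose only tag is its
    label; [in_class] finds it in this way. *)
Definition class_tags := [seq t <- block_tags C | head 0 t != 1].

Definition in_class t i :=
  if head 0 t == 0 then F t i
  else [exists y, (tags (desc y) == [:: t]) && (final i == final y)].

Definition class_cost (t : seq nat) := if head 0 t == 0 then 2 else C.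

Lemma mem_class_tags t : t \in class_tags ->
  (exists a b c, [/\ (a, b) \in idx2, c \in others (a, b) & t = TB a b c]) \/
  (exists o x, x < C /\ t = lab o x).
Proof.
rewrite mem_filter => /andP[ht /mem_block_tags[]].
- by case=> -[a b] pp [c co E]; left; exists a, b, c.
- by case=> p _ E; rewrite E in ht.
- by case=> o [x xC E]; right; exists o, x.
Qed.

Lemma uniq_class_tags : uniq class_tags.
Proof. exact: filter_uniq uniq_block_tags. Qed.

(** The origin of [slack]: 2 for each of the [C * C.-1 * C.-2] hubs, and [C] for each of the [2 * C]
    side clusters. *)
Lemma sum_class_cost : \sum_(t <- class_tags) class_cost t = slack C.
Proof.
rewrite big_filter big_mkcond !big_cat !big_flatten !big_map /= !big_const_seq !count_predT.
rewrite !iter_addn_0 size_iota /slack mul0n add0n addnA -mulnDr.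
have -> : \sum_(p <- idx2) \sum_(i <- [seq TB p.1 p.2 c | c <- others p])
    (if head 0 i != 1 then class_cost i else 0) = 2 * (C * C.-1 * C.-2).
  rewrite (eq_big_seq (fun=> 2 * C.-2)) => [|p pp].
    by rewrite big_const_seq count_predT iter_addn_0 size_idx2 -mulnA (mulnC C.-2).
  by rewrite big_map big_const_seq count_predT iter_addn_0 size_others.
by rewrite mulnDr -addnA addnn -mul2n.
Qed.

Lemma in_class_lab o x i : x < C -> in_class (lab o x) i = (final i == final (side_row o x)).
Proof.
move=> xC; rewrite /in_class /=; apply/existsP/idP => [[y /andP[/eqP ty E]]|E]; last first.
  by exists (side_row o x); rewrite E side_rowE // eqxx.
have : I (lab o x) y by rewrite ty inE.
rewrite tags_lab; case dy: (desc y) ty => [a b u v c|a b c c'|o' a] //=.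
by rewrite orbF -dy => _ /eqP yE; rewrite -(_ : y = side_row o x) //; apply: desc_inj; rewrite side_rowE.
Qed.

Lemma TB_side a b c o x : (a, b) \in idx2 -> c \in others (a, b) -> x < C ->
  ~~ F (TB a b c) (side_row o x).
Proof.
move=> pp co xC; have nI : ~~ I (TB a b c) (side_row o x) by rewrite side_rowE // tags_TB.
by apply/negP => /(exchanged_cell pp co nI) [u [v]]; rewrite side_rowE.
Qed.

(** If two hub clusters coincide, two rows of the one hub both gain the tag of the other, which
    gains a single row. A hub cluster takes in no side row, since its new row is a cell, and a label
    is never gained, so side clusters differ as well. *)
Lemma class_disjoint t t' i : t \in class_tags -> t' \in class_tags ->
  in_class t i -> in_class t' i -> t = t'.
Proof.
case/mem_class_tags=> [[a [b [c [pp co ->]]]]|[o [x [xC ->]]]];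
case/mem_class_tags=> [[a' [b' [c' [pp' co' ->]]]]|[o' [x' [xC' ->]]]].
- rewrite /in_class /= => Ft Ft'; apply/eqP/negPn/negP => ne.
  have [d dC] := fresh (s := [:: c]) (ltnW (ltnW (ltnW C5))); rewrite inE => d1.
  have [e eC] := fresh (s := [:: c; d]) (ltnW (ltnW C5)); rewrite !inE negb_or => /andP[e1 e2].
  have [h hd Ih] := hub_row pp co dC d1; have [g gd Ig] := hub_row pp co eC e1.
  have [x1 [_ _ Fx1]] := hub_col pp co; have [x2 [_ _ Fx2]] := hub_col pp' co'.
  have H k k' : desc k = Hub a b c k' -> I (TB a b c) k -> k = x2.
    move=> dk Ik; have E : final i = final k by apply: (hub_class pp co); rewrite // Fx1 Ik.
    move: Ft'; rewrite (final_bit_eq _ E) Fx2 dk tags_TB => /orP[/and3P[/eqP e3 /eqP e4 /eqP e5]|/eqP//].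
    by case/negP: ne; rewrite e3 e4 e5.
  have E := etrans (H _ _ gd Ig) (esym (H _ _ hd Ih)).
  by move: gd e2; rewrite E hd => -[->]; rewrite eqxx.
- rewrite in_class_lab // /in_class /= => Ft /eqP E.
  by have := TB_side o' pp co xC'; rewrite -(final_bit_eq _ E) Ft.
- rewrite in_class_lab // /in_class /= => /eqP E Ft.
  by have := TB_side o pp' co' xC; rewrite -(final_bit_eq _ E) Ft.
- rewrite !in_class_lab // => /eqP -> /eqP E.
  have := side_keeps o xC; rewrite (final_bit_eq _ E) => /(lab_no_gain xC).
  by rewrite tags_lab side_rowE // orbF => /eqP [-> ->].
Qed.

(** The cell taken in has two vertex tags, the hub rows have none. *)
Lemma hub_class_cost a b c : (a, b) \in idx2 -> c \in others (a, b) ->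
  2 <= \sum_(i | in_class (TB a b c) i) vedits i.
Proof.
move=> pp co; have [x [cx nIx Fx]] := hub_col pp co.
have Fxx : F (TB a b c) x by rewrite Fx eqxx orbT.
have [u [v dx]] := exchanged_cell pp co nIx Fxx.
have /and3P[aC bC nab] : [&& a < C, b < C & a != b] by rewrite -(mem_idx2 C (a, b)).
have := desc_row x; rewrite dx => /and3P[_]; rewrite mem_sel => /and3P[/= uU vU _] _.
have nac : a != c by move: co; rewrite mem_others eq_sym => /and3P[].
have [h hd Ih] := hub_row pp co aC nac.
apply: (class_edits (ts := [:: vtx true a u; vtx false b v])); first by [].
move=> t tt; split.
- by move: tt; rewrite !inE => /orP[] /eqP ->; apply: mem_vertex_tags.
- by move: tt; rewrite !inE => /orP[] /eqP ->; apply: vertex_not_block.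
exists x, h; rewrite /in_class /= Fxx Fx Ih; split=> //.
  by apply: (hub_class pp co); rewrite // Fx Ih.
by move: tt; rewrite !inE => /orP[] /eqP ->; rewrite dx hd !tags_vtx /= !eqxx.
Qed.

Definition leaver_val o x y := side_val o (desc (leaver o x y)).

Lemma leaver_vals o x y : x < C -> y < C -> x != y ->
  [/\ leaver_val o x y \in U, side_val (~~ o) (desc (leaver o x y)) \in U,
      I (vtx o x (leaver_val o x y)) (leaver o x y) &
      I (vtx (~~ o) y (side_val (~~ o) (desc (leaver o x y)))) (leaver o x y)].
Proof.
move=> xC yC nxy; have [u [v dl]] := leaver_desc o xC yC nxy.
have := desc_row (leaver o x y); rewrite /leaver_val !tags_vtx dl => /and3P[_].
rewrite mem_sel -surjective_pairing pick_opair pickN_opair !eqxx => /and3P[/= uU vU _] _.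
by split=> //; case: (o).
Qed.

Lemma side_class_mem o x : x < C -> in_class (lab o x) (side_row o x).
Proof. by move=> xC; rewrite in_class_lab. Qed.

Lemma leaver_class o x y : x < C -> y < C -> x != y -> in_class (lab o x) (leaver o x y).
Proof. by move=> xC yC nxy; rewrite in_class_lab // side_class. Qed.

(** The leavers come from different tiles, so their vertex tags for the opposite side lie in [C.-1]
    different columns. Their tags for side [o] occupy one column per distinct word. The side row has
    none of these tags. *)
Lemma side_class_cost o x (us : seq (seq nat)) : x < C -> uniq us ->
  {subset us <= [seq leaver_val o x y | y <- except C x]} ->
  C.-1 + size us <= \sum_(i | in_class (lab o x) i) vedits i.
Proof.
move=> xC uus sub.
pose ws := [seq vtx (~~ o) y (side_val (~~ o) (desc (leaver o x y))) | y <- except C x].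
have -> : C.-1 + size us = size (ws ++ [seq vtx o x u | u <- us]).
  by rewrite size_cat !size_map size_except.
apply: class_edits.
  rewrite cat_uniq !map_inj_uniq ?filter_uniq ?iota_uniq ?uus ?andbT //=.
  - apply/hasPn => t /mapP[u _ ->]; apply/mapP => -[y _] [] E; move: E.
    by case: (o).
  - by move=> u u' [].
  - by move=> y y' [].
move=> t; rewrite mem_cat => /orP[/mapP[y]|/mapP[u /sub/mapP[y]]];
  rewrite mem_except => /andP[yC nyx]; have nxy : x != y by rewrite eq_sym.
- have [_ wU _ Iw] := leaver_vals o xC yC nxy; move=> ->; split.
  + exact: mem_vertex_tags.
  + exact: vertex_not_block.
  exists (leaver o x y), (side_row o x); split; rewrite ?leaver_class ?side_class_mem ?side_class //.
  by rewrite Iw side_rowE // tags_vtx.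
- have [uU _ Iu _] := leaver_vals o xC yC nxy; move=> -> ->; split.
  + exact: mem_vertex_tags.
  + exact: vertex_not_block.
  exists (leaver o x y), (side_row o x); split; rewrite ?leaver_class ?side_class_mem ?side_class //.
  by rewrite Iu side_rowE // tags_vtx.
Qed.

Lemma except_ex x : exists2 y, y < C & y != x.
Proof. by have [y yC] := fresh (s := [:: x]) (ltnW (ltnW (ltnW C5))); rewrite inE; exists y. Qed.

Lemma class_cost_lb t : t \in class_tags -> class_cost t <= \sum_(i | in_class t i) vedits i.
Proof.
case/mem_class_tags=> [[a [b [c [pp co ->]]]]|[o [x [xC ->]]]]; first exact: hub_class_cost.
have [y yC nyx] := except_ex x.
have := @side_class_cost o x [:: leaver_val o x y] xC isT; rewrite /class_cost /= addn1.
rewrite prednK ?(ltnW (ltnW (ltnW (ltnW C5)))) //; apply => u; rewrite inE => /eqP ->.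
by apply: map_f; rewrite mem_except yC.
Qed.

Lemma class_split : \sum_(t <- class_tags) \sum_(i | in_class t i) vedits i
  + \sum_(i | ~~ has (in_class^~ i) class_tags) vedits i <= \sum_i vedits i.
Proof.
have -> : \sum_(t <- class_tags) \sum_(i | in_class t i) vedits i
        = \sum_i \sum_(t <- class_tags) in_class t i * vedits i.
  rewrite exchange_big; apply: eq_bigr => t _; rewrite big_mkcond.
  by apply: eq_bigr => i _; case: in_class; rewrite ?mul1n.
rewrite [X in _ + X]big_mkcond -big_split; apply: leq_sum => i _ /=.
case: hasP => [[t tc ti]|no] /=.
  rewrite addn0 (big_rem t) //= ti mul1n big_seq big1 ?addn0 // => t' t't.
  have t'c := mem_rem t't; case: (boolP (in_class t' i)) => // t'i.
  have E := class_disjoint tc t'c ti t'i.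
  by move: t't; rewrite -E mem_rem_uniq ?uniq_class_tags // inE eqxx.
rewrite big_seq big1 ?add0n // => t tc; case: (boolP (in_class t i)) => // ti.
by case: no; exists t.
Qed.

(** The lower bounds of the disjoint classes sum to [slack], which is also an upper bound for all
    edits in vertex columns. *)
Lemma class_tight :
  (forall t, t \in class_tags -> \sum_(i | in_class t i) vedits i <= class_cost t) /\
  (forall i, (forall t, t \in class_tags -> ~~ in_class t i) -> vedits i = 0).
Proof.
have := leq_trans class_split vedits_total; rewrite -sum_class_cost => le.
have ge : \sum_(t <- class_tags) class_cost t
       <= \sum_(t <- class_tags) \sum_(i | in_class t i) vedits i.
  by rewrite big_seq [leqRHS]big_seq; apply: leq_sum => t; apply: class_cost_lb.
split=> [t tc|i no].
  move: le; rewrite !(big_rem t tc) /= => le.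
  have H : \sum_(t' <- rem t class_tags) class_cost t'
      <= \sum_(t' <- rem t class_tags) \sum_(i | in_class t' i) vedits i.
    by rewrite big_seq [leqRHS]big_seq; apply: leq_sum => t' /mem_rem; apply: class_cost_lb.
  have arith x c L R k : x + R + k <= c + L -> L <= R -> x <= c by lia.
  exact: arith le H.
have : \sum_(i | ~~ has (in_class^~ i) class_tags) vedits i = 0.
  have arith L R k : R + k <= L -> L <= R -> k = 0 by lia.
  exact: arith le ge.
move=> /eqP; rewrite sum_nat_eq0 => /forallP /(_ i) /implyP H; apply/eqP/H.
by apply/hasPn => t; apply: no.
Qed.

(** Two different words would raise the cost of the side cluster to [C + 1]. *)
Lemma leaver_val_const o x y z : x < C -> y < C -> x != y -> z < C -> x != z ->
  leaver_val o x y = leaver_val o x z.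
Proof.
move=> xC yC nxy zC nxz; apply/eqP/negPn/negP => ne.
have lc : lab o x \in class_tags by rewrite mem_filter lab_block.
have [/(_ _ lc) le _] := class_tight.
have := @side_class_cost o x [:: leaver_val o x y; leaver_val o x z] xC.
rewrite /= inE ne => /(_ isT) H; have {H} : C.-1 + 2 <= C.
  apply: leq_trans (H _) le => u.
  by rewrite !inE => /orP[] /eqP ->; apply: map_f; rewrite mem_except ?yC ?zC eq_sym.
lia.
Qed.

Lemma unedited i j : vedits i = 0 -> ~~ is_block j -> M' i j = M i j.
Proof.
move=> /eqP; rewrite sum_nat_eq0 => /forallP /(_ j) /implyP H jb; have := H jb.
by rewrite eqb0 negbK => /eqP.
Qed.

(** The tile tag excludes the side clusters, whose side row never gains it, and the hubs of other
    tiles. *)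
Lemma out_of_class a b i : (a, b) \in idx2 -> I (TL a b) i -> F (TL a b) i ->
  (forall c, c \in others (a, b) -> ~~ F (TB a b c) i) -> (forall t, t \in class_tags -> ~~ in_class t i).
Proof.
move=> pp Ii Fi nF t /mem_class_tags[[a' [b' [c' [pp' co' ->]]]]|[o [x [xC ->]]]]; last first.
  rewrite in_class_lab //; apply/eqP => E; move: Fi; rewrite (final_bit_eq _ E).
  by move=> /(TL_no_gain pp); rewrite side_rowE.
rewrite /in_class /=; apply/negP => Ft.
have [x1 [_ _ Fx1]] := hub_col pp' co'.
have [h hd Ih] : exists2 h, reg (desc h) = Some (a', b') & F (TB a' b' c') h /\ (cl h != a) && (cl h != b).
  have [d dC] := fresh (s := [:: c'; a; b]) (ltnW C5); rewrite !inE !negb_or => /and3P[d1 d2 d3].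
  have [h hd Ih] := hub_row pp' co' dC d1; exists h; first by rewrite hd.
  by rewrite Fx1 Ih /cl hd /= d2 d3.
have E : final i = final h by apply: (hub_class pp' co') => //; case: Ih.
have := Fi; rewrite (final_bit_eq _ E) => /(TL_no_gain pp).
rewrite (tags_TL (a, b)) hd => /eqP [ea eb]; rewrite ea eb in Ft co'.
by rewrite (negPf (nF c' co')) in Ft.
Qed.

(** Suppose the row [k] with these words and color [a] keeps its tile tag. It is in no hub cluster,
    as these take in cells of colors other than [a] and [b]. So it has no edits in vertex columns,
    and neither has the row [z] of color [b] in its cluster. Hence [z] has the same words, so it is
    the leaver, which has lost the tile tag. *)
Lemma same_cell a b u v : (a, b) \in idx2 -> desc (leaver true a b) = Cell a b u v b ->
  desc (leaver false b a) = Cell a b u v a.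
Proof.
move=> pp dl.
have /and3P[aC bC nab] : [&& a < C, b < C & a != b] by rewrite -(mem_idx2 C (a, b)).
have nba : b != a by rewrite eq_sym.
have := desc_row (leaver true a b); rewrite dl => /and3P[_ us _].
have [|k dk] := desc_surj (r := Cell a b u v a); first by rewrite /= pp us aC.
have Ik : I (TL a b) k by rewrite (tags_TL (a, b)) dk.
suff nFk : ~~ F (TL a b) k.
  have [_ _ _ lu] := leaverP false bC aC nba.
  by rewrite -(lu k) // /cl dk.
apply/negP => Fk.
have nTB c : c \in others (a, b) -> ~~ F (TB a b c) k.
  move=> co; have [x [cx _ Fx]] := hub_col pp co; rewrite Fx dk tags_TB /=; apply/eqP => E.
  by move: co; rewrite -cx -E /cl dk mem_others /= eqxx andbF.
have [_ zero] := class_tight.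
have k0 := zero k (out_of_class pp Ik Fk nTB).
have [z zk zb] := same_color k bC.
have Fz : F (TL a b) z by rewrite (final_bit_eq _ zk).
have Iz : I (TL a b) z by exact: (TL_no_gain pp).
have nTBz c : c \in others (a, b) -> ~~ F (TB a b c) z by rewrite (final_bit_eq _ zk); apply: nTB.
have z0 := zero z (out_of_class pp Iz Fz nTBz).
have := Iz; rewrite (tags_TL (a, b)) => /eqP/desc_cell[[u' [v' dz]]|[c dz]]; last first.
  have := desc_row z; rewrite dz => /and4P[_ co _ _].
  have [x [_ _ Fx]] := hub_col pp co.
  by have := nTBz c co; rewrite Fx dz tags_TB !eqxx.
have vt o x w : x < C -> w \in U -> I (vtx o x w) k -> I (vtx o x w) z.
  move=> xC wU; have [j jt] := tag_vertex (mem_vertex_tags o xC wU); rewrite -jt => Ikj.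
  have jb : ~~ is_block j by rewrite /is_block jt vertex_not_block.
  have := congr1 (fun w0 : {ffun 'I_nc -> bool} => w0 j) zk; rewrite !ffunE.
  by rewrite !unedited // /M => ->.
have := us; rewrite mem_sel /= => /and3P[uU vU _].
have := vt true a u aC uU; rewrite dk dz !tags_vtx /= !eqxx /= => /(_ isT) /eqP eu.
have := vt false b v bC vU; rewrite dk dz !tags_vtx /= !eqxx /= => /(_ isT) /eqP ev.
have [_ _ _ lu] := leaverP true aC bC nab.
have zl : z = leaver true a b by apply: desc_inj; rewrite dl dz eu ev zb.
by have [_ /negP[]] := leaverP true aC bC nab; rewrite -zl.
Qed.

Theorem grid_sound : exists u v : nat -> seq nat,
  forall a b, a < C -> b < C -> a != b ->
  [/\ u a \in U, v b \in U & S a b (u a) (v b)].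
Proof.
(* The word of a side cluster can be read off any of its leavers; [nb x] is an index other than
   [x]. *)
pose nb x := if x == 0 then 1 else 0.
have nbP x : nb x < C /\ x != nb x.
  by rewrite /nb; case: (x =P 0) => [->|/eqP //]; split=> //; lia.
exists (fun a => leaver_val true a (nb a)), (fun b => leaver_val false b (nb b)) => a b aC bC nab.
have nba : b != a by rewrite eq_sym.
have [nC nn] := nbP a; have [nC' nn'] := nbP b.
rewrite (leaver_val_const true aC nC nn bC nab) (leaver_val_const false bC nC' nn' aC nba).
have [u [v dl]] := leaver_desc true aC bC nab.
have pp := opairP true aC bC nab.
have dk := same_cell pp dl.
have := desc_row (leaver true a b); rewrite /leaver_val dl dk => /and3P[_].
by rewrite mem_sel /= => /and3P[].
Qed.

End Soundness.

(** * Completeness: a tiling yields a cheap fair matrix *)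

Section Completeness.
Variables (C : nat) (U : seq (seq nat)) (S : nat -> nat -> seq nat -> seq nat -> bool).
Hypothesis uniqU : uniq U.
Local Notation idx2 := (idx2 C).
Local Notation others := (others C).
Local Notation except := (except C).
Local Notation idx := (idx C).
Local Notation sel := (sel U S).
Local Notation grid_rows := (grid_rows C U S).

Lemma sum_split_others (h : nat -> nat) p c : c \in others p ->
  \sum_(c2 <- others p) h c2 = h c + \sum_(c2 <- others p) (c != c2) * h c2.
Proof.
move=> co; rewrite (big_rem c) //= [in RHS](big_rem c) //= eqxx mul0n add0n; congr (_ + _).
apply: eq_big_seq => c2; rewrite mem_rem_uniq ?uniq_others // inE eq_sym => /andP[-> _].
by rewrite mul1n.
Qed.

(** Fairness in weighted form: [h p c] is the weight of hub [c] of tile [p], and [s o a] that of a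
    side cluster. On the left are the rows of color [c]: one cell per tile, which joins a side
    cluster or hub [c], the rows of all other hubs, and two side rows. The cells of color [c] reach
    every side cluster but the two of index [c], where the side rows of this color are. *)
Lemma color_balance (h : nat * nat -> nat -> nat) (s : bool -> nat -> nat) c : c < C ->
  \sum_(p <- idx2) ((if c == p.1 then s false p.2 else if c == p.2 then s true p.1 else h p c)
                    + \sum_(c2 <- others p) (c != c2) * h p c2) + (s true c + s false c)
  = \sum_(p <- idx2) \sum_(c2 <- others p) h p c2 + (\sum_(a <- idx) s true a + \sum_(a <- idx) s false a).
Proof.
move=> cC; pose X p := (p.1 == c) * s false p.2 + (p.2 == c) * s true p.1.
have -> : \sum_(p <- idx2) ((if c == p.1 then s false p.2 else if c == p.2 then s true p.1 else h p c)
                    + \sum_(c2 <- others p) (c != c2) * h p c2)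
   = \sum_(p <- idx2) (\sum_(c2 <- others p) h p c2 + X p).
  apply: eq_big_seq => p; rewrite mem_idx2 /X => /and3P[p1 p2 n].
  have [e1|n1] := eqVneq c p.1.
    rewrite -e1 mul1n (_ : (p.2 == c) = false) ?mul0n ?addn0; last first.
      by apply: contraNF n => /eqP ->; rewrite e1.
    rewrite addnC; congr (_ + _); apply: eq_big_seq => c2; rewrite mem_others -e1 => /and3P[_ + _].
    by rewrite eq_sym => ->; rewrite mul1n.
  rewrite mul0n add0n.
  have [e2|n2] := eqVneq c p.2.
    rewrite mul1n addnC; congr (_ + _); apply: eq_big_seq => c2.
    by rewrite mem_others -e2 => /and3P[_ _]; rewrite eq_sym => ->; rewrite mul1n.
  by rewrite mul0n addn0 -sum_split_others // mem_others cC n1.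
rewrite big_split /= -!addnA; congr (_ + _); rewrite /X big_split /=.
have E1 : \sum_(p <- idx2) (p.1 == c) * s false p.2 = \sum_(b <- except c) s false b.
  rewrite sum_idx2; transitivity (\sum_(a <- idx) (a == c) * \sum_(b <- except a) s false b).
    by apply: eq_bigr => a _; rewrite big_distrr.
  by rewrite sum_pick1 ?uniq_idx // mem_idx cC mul1n.
have E2 : \sum_(p <- idx2) (p.2 == c) * s true p.1 = \sum_(b <- except c) s true b.
  rewrite sum_idx2_sym; transitivity (\sum_(a <- idx) (a == c) * \sum_(b <- except a) s true b).
    by apply: eq_bigr => a _; rewrite big_distrr.
  by rewrite sum_pick1 ?uniq_idx // mem_idx cC mul1n.
have E3 f : \sum_(a <- idx) f a = f c + \sum_(b <- except c) f b :> nat.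
  rewrite big_filter (bigD1_seq c) ?uniq_idx ?mem_idx //=.
by rewrite E1 E2 !E3; lia.
Qed.

Lemma color_sum (f : rdesc -> nat) c : c < C ->
  \sum_(r <- grid_rows) f r * (color r == c) =
  \sum_(p <- idx2) (\sum_(w <- sel p) f (Cell p.1 p.2 w.1 w.2 c)
                    + \sum_(c2 <- others p) (c != c2) * f (Hub p.1 p.2 c2 c))
  + (f (Side true c) + f (Side false c)).
Proof.
move=> cC; rewrite sum_rows -big_split -addnA; congr (_ + _).
  apply: eq_bigr => p _; congr (_ + _); apply: eq_bigr => x _.
    rewrite (eq_bigr (fun c' => (c' == c) * f (Cell p.1 p.2 x.1 x.2 c'))) => [|c' _].
      by rewrite sum_pick1 ?uniq_idx // mem_idx cC mul1n.
    by rewrite mulnC.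
  rewrite (eq_bigr (fun c' => (c' == c) * f (Hub p.1 p.2 x c'))) => [|c' _].
    by rewrite sum_pick1 ?filter_uniq ?uniq_idx // mem_except cC.
  by rewrite mulnC.
have E b : \sum_(a <- idx) f (Side b a) * (a == c) = f (Side b c).
  rewrite (eq_bigr (fun a => (a == c) * f (Side b a))) => [|a _]; last by rewrite mulnC.
  by rewrite sum_pick1 ?uniq_idx // mem_idx cC mul1n.
by rewrite /= !E.
Qed.

(** This is [color_balance] with all weights 1. It accounts for one additional cell per tile, hence
    the correction by [size idx2]. *)
Lemma color_rows c c' : c < C -> c' < C ->
  \sum_(r <- grid_rows) (color r == c) = \sum_(r <- grid_rows) (color r == c').
Proof.
have E d : d < C -> \sum_(r <- grid_rows) (color r == d) + size idx2 =
    \sum_(p <- idx2) \sum_(w <- sel p) 1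
    + (\sum_(p <- idx2) \sum_(c2 <- others p) 1 + (\sum_(a <- idx) 1 + \sum_(a <- idx) 1)).
  move=> dC; have := color_balance (fun _ _ => 1) (fun _ _ => 1) dC.
  have := color_sum (fun=> 1) dC; under eq_bigr do rewrite mul1n.
  move=> -> <-; rewrite -sum1_size !big_split /=.
  have -> : \sum_(p <- idx2) (if d == p.1 then 1 else if d == p.2 then 1 else 1) = \sum_(p <- idx2) 1.
    by apply: eq_bigr => p _; case: ifP => _; [|case: ifP].
  by rewrite -!addnA; congr (_ + _); rewrite [RHS]addnC -!addnA.
by move=> cC c'C; apply/eqP; rewrite -(eqn_add2r (size idx2)) !E.
Qed.

Variables (u v : nat -> seq nat).
Hypothesis uvS : forall a b, a < C -> b < C -> a != b ->
  [/\ u a \in U, v b \in U & S a b (u a) (v b)].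

(** Keeping the vertex tag costs one edit at the side row instead of one at each of the [C.-1] cells
    that join it. *)
Definition side_tags o a := [:: lab o a; vtx o a (if o then u a else v a)].

Definition dest (r : rdesc) : seq (seq nat) :=
  match r with
  | Cell a b u' v' c =>
      if (u' == u a) && (v' == v b) then
        if c == a then side_tags false b
        else if c == b then side_tags true a
        else [:: TL a b; lab true a; lab false b; TB a b c]
      else [:: TL a b; lab true a; lab false b; vtx true a u'; vtx false b v']
  | Hub a b c _ => [:: TL a b; lab true a; lab false b; TB a b c]
  | Side o a => side_tags o a
  end.

Lemma sel_uv p : p \in idx2 -> (u p.1, v p.2) \in sel p.
Proof.
by rewrite mem_idx2 mem_sel => /and3P[p1 p2 n]; have [-> -> ->] := uvS p1 p2 n.
Qed.

Lemma dest_fair (Q : seq (seq nat) -> nat) c c' : c < C -> c' < C ->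
  \sum_(r <- grid_rows) Q (dest r) * (color r == c)
  = \sum_(r <- grid_rows) Q (dest r) * (color r == c').
Proof.
pose K := \sum_(p <- idx2) \sum_(w <- rem (u p.1, v p.2) (sel p))
  Q [:: TL p.1 p.2; lab true p.1; lab false p.2; vtx true p.1 w.1; vtx false p.2 w.2].
pose h p c := Q [:: TL p.1 p.2; lab true p.1; lab false p.2; TB p.1 p.2 c].
pose s o a := Q (side_tags o a).
suff E d : d < C -> \sum_(r <- grid_rows) Q (dest r) * (color r == d) = K +
    (\sum_(p <- idx2) \sum_(c2 <- others p) h p c2
     + (\sum_(a <- idx) s true a + \sum_(a <- idx) s false a)).
  by move=> cC c'C; rewrite !E.
move=> dC; rewrite (color_sum (fun r => Q (dest r)) dC) -(color_balance h s dC) [RHS]addnA.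
congr (_ + _); rewrite /K -big_split; apply: eq_big_seq => p pp /=; rewrite [RHS]addnA.
congr (_ + _); rewrite (big_rem _ (sel_uv pp)) /= !eqxx addnC; congr (_ + _).
  apply: eq_big_seq => -[u' v']; rewrite mem_rem_uniq ?uniq_sel // inE.
  by rewrite xpair_eqE /= => /andP[/negPf -> _].
by rewrite (fun_if Q) [in RHS]/h (fun_if Q).
Qed.

Definition row_edits (r : rdesc) := \sum_(t <- grid_cols C U) ((t \in tags r) != (t \in dest r)).

Definition tag_copies (t : seq nat) := if head 0 t < 3 then copies C else 1.

Lemma uniq_vertex_tags : uniq (vertex_tags C U).
Proof.
rewrite cat_uniq !uniq_flatten_map ?uniq_idx //=.
- rewrite andbT; apply/hasPn => t /flatten_mapP[a _ /mapP[w _ ->]].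
  by apply/negP => /flatten_mapP[b _ /mapP[w' _ []]].
- by move=> a _; rewrite map_inj_uniq // => w w' [].
- by move=> a b t /mapP[w _ ->] /mapP[w' _ []].
- by move=> a _; rewrite map_inj_uniq // => w w' [].
- by move=> a b t /mapP[w _ ->] /mapP[w' _ []].
Qed.

Lemma head_vertex t : t \in vertex_tags C U -> head 0 t = 3.
Proof. by rewrite mem_cat => /orP[] /flatten_mapP[a _ /mapP[w _ ->]]. Qed.

Lemma head_block t : t \in block_tags C -> head 0 t < 3.
Proof.
by case/mem_block_tags => [[p _ [c _ ->]]|[p _ ->]|[o [x _ ->]]].
Qed.

Lemma count_cols t : count_mem t (grid_cols C U) <= tag_copies t.
Proof.
rewrite count_cat count_flatten -map_comp (count_uniq_mem _ uniq_vertex_tags).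
rewrite sumnE big_map (eq_bigr (fun t' => (t' == t) * copies C)) => [|t' _]; last first.
  exact: count_nseq.
rewrite (sum_pick1 t (fun=> copies C)) ?uniq_block_tags // /tag_copies.
have [tv|_] := boolP (t \in vertex_tags C U).
  rewrite (head_vertex tv) /= (_ : t \in block_tags C = false) ?mul0n //.
  by apply/negP => /head_block; rewrite (head_vertex tv).
have [/head_block ->|_] := boolP (t \in block_tags C); first by rewrite mul1n addn0.
by rewrite mul0n.
Qed.

Lemma row_edits_le r (ts : seq (seq nat)) :
  (forall t, (t \in tags r) != (t \in dest r) -> t \in ts) ->
  row_edits r <= \sum_(t <- ts) tag_copies t.
Proof.
move=> H; apply: (@leq_trans (\sum_(t <- ts) count_mem t (grid_cols C U))); last first.
  by apply: leq_sum => t _; apply: count_cols.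
rewrite (eq_bigr (fun t => \sum_(t' <- grid_cols C U) (t' == t))) => [|t _]; last first.
  by rewrite -sum1_count big_mkcond; apply: eq_bigr => t' _; rewrite /=; case: (t' == t).
rewrite exchange_big; apply: leq_sum => t _ /=; case: (boolP (_ != _)) => // /H tts.
by rewrite (big_rem t) //= eqxx.
Qed.

Lemma cell_edits p c : p \in idx2 ->
  row_edits (Cell p.1 p.2 (u p.1) (v p.2) c) <=
  if (c == p.1) || (c == p.2) then 2 * copies C + 1 else copies C + 2.
Proof.
case: p => a b /=; rewrite mem_idx2 => /and3P[_ _ /= nab].
have [->|na] := eqVneq c a.
  rewrite /=; apply: leq_trans (row_edits_le (ts := [:: TL a b; lab true a; vtx true a (u a)]) _) _.
    move=> t; rewrite /dest !eqxx !inE.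
    by case: (t == TL _ _); case: (t == lab true _); case: (t == lab false _);
      case: (t == vtx true _ _); case: (t == vtx false _ _).
  by rewrite !big_cons big_nil /tag_copies /=; lia.
have [->|nb] := eqVneq c b.
  rewrite /=; apply: leq_trans (row_edits_le (ts := [:: TL a b; lab false b; vtx false b (v b)]) _) _.
    move=> t; rewrite /dest !eqxx (eq_sym b) (negPf nab) !inE.
    by case: (t == TL _ _); case: (t == lab true _); case: (t == lab false _);
      case: (t == vtx true _ _); case: (t == vtx false _ _).
  by rewrite !big_cons big_nil /tag_copies /=; lia.
rewrite /=; apply: leq_trans (row_edits_le (ts := [:: TB a b c; vtx true a (u a); vtx false b (v b)]) _) _.
  move=> t; rewrite /dest !eqxx (negPf na) (negPf nb) !inE.
  by case: (t == TL _ _); case: (t == lab true _); case: (t == lab false _);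
    case: (t == vtx true _ _); case: (t == vtx false _ _); case: (t == TB _ _ _).
by rewrite !big_cons big_nil /tag_copies /=; lia.
Qed.

Lemma side_edits o a : row_edits (Side o a) <= 1.
Proof.
apply: leq_trans (row_edits_le (ts := [:: vtx o a (if o then u a else v a)]) _) _.
  by move=> t; rewrite !inE; case: (t == lab _ _); case: (t == vtx _ _ _).
by rewrite big_cons big_nil.
Qed.

Lemma row_edits0 r : tags r = dest r -> row_edits r = 0.
Proof. by move=> E; rewrite /row_edits E big1 // => t _; rewrite eqxx. Qed.

Hypothesis C5 : 4 < C.

(** The estimates sum to exactly the budget: in each tile [C.-2] cells at [copies + 2] and two at
    [2 * copies + 1], and one edit for each of the [2 * C] side rows. *)
Lemma total_edits : \sum_(r <- grid_rows) row_edits r <= grid_budget C.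
Proof.
rewrite sum_rows [X in _ + X + _ + _]big1 ?addn0 => [|p _]; last first.
  by rewrite big1 // => c _; rewrite big1 // => c' _; apply: row_edits0.
have S1 o : \sum_(a <- idx) row_edits (Side o a) <= C.
  apply: (@leq_trans (\sum_(a <- idx) 1)); first by apply: leq_sum => a _; apply: side_edits.
  by rewrite sum1_size size_iota.
have S2 : \sum_(p <- idx2) \sum_(w <- sel p) \sum_(c <- idx) row_edits (Cell p.1 p.2 w.1 w.2 c)
   <= C * C.-1 * (C.-2 * (copies C + 2) + 2 * (2 * copies C + 1)).
  rewrite -size_idx2 -sum1_size big_distrl /= big_seq [leqRHS]big_seq; apply: leq_sum => p pp.
  rewrite mul1n (big_rem _ (sel_uv pp)) /=.
  have -> : \sum_(w <- rem (u p.1, v p.2) (sel p)) \sum_(c <- idx) row_edits (Cell p.1 p.2 w.1 w.2 c) = 0.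
    rewrite big_seq big1 // => -[u' v']; rewrite mem_rem_uniq ?uniq_sel // inE xpair_eqE /= => /andP[/negPf n _].
    by rewrite big1 // => c _; apply: row_edits0; rewrite /= n.
  rewrite addn0.
  apply: (@leq_trans (\sum_(c <- idx) if (c == p.1) || (c == p.2) then 2 * copies C + 1 else copies C + 2)).
    by apply: leq_sum => c _; apply: cell_edits.
  rewrite (bigID (fun c => (c != p.1) && (c != p.2))) /= -big_filter -/(others p).
  rewrite (eq_big_seq (fun=> copies C + 2)) => [|c]; last first.
    by rewrite mem_others => /and3P[_ /negPf -> /negPf ->].
  rewrite big_const_seq count_predT iter_addn_0 size_others // mulnC leq_add2l.
  rewrite (eq_bigr (fun=> 2 * copies C + 1)) => [|c]; last by rewrite -negb_or negbK => ->.
  rewrite big_const_seq iter_addn_0 mulnC leq_mul2r; apply/orP; right.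
  rewrite (@eq_count _ _ (predC (fun c => (c != p.1) && (c != p.2)))) //.
  have := count_predC (fun c => (c != p.1) && (c != p.2)) idx.
  by rewrite -size_filter -/(others p) size_others // size_iota; lia.
have := S1 true; have := S1 false; move: S2; rewrite /grid_budget /block_cost /slack.
move: (\sum_(p <- _) _) (\sum_(a <- _) _) (\sum_(a <- _) _) => s1 s2 s3 H1 H2 H3.
apply: leq_trans (leq_add (leq_add H1 H3) H2) _.
move: (copies C) => L; case: C C5 => [//|[//|c]] _ /=; nia.
Qed.

End Completeness.

Lemma sum_nth_ord (T : Type) (x0 : T) (s : seq T) (F : T -> nat) :
  \sum_(i < size s) F (nth x0 s i) = \sum_(x <- s) F x.
Proof. by rewrite (big_nth x0) big_mkord. Qed.

Lemma map_nth_enum (T T' : Type) (x0 : T) (s : seq T) (f : T -> T') :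
  [seq f (nth x0 s (val i)) | i <- enum 'I_(size s)] = map f s.
Proof.
by rewrite -[in RHS](mkseq_nth x0 s) /mkseq -val_enum_ord -!map_comp.
Qed.

(** * The clustering instance *)

Section GridInstance.
Variables (C : nat) (U : seq (seq nat)) (S : nat -> nat -> seq nat -> seq nat -> bool).
Hypothesis uniqU : uniq U.
Hypothesis C5 : 4 < C.
Local Notation rows := (grid_rows C U S).
Local Notation cols := (grid_cols C U).

Lemma C_gt0 : 0 < C. Proof. exact: leq_trans C5. Qed.

Lemma rows_gt0 : 0 < size rows.
Proof.
have : Side true 0 \in rows by rewrite mem_rows /= C_gt0.
by case: rows.
Qed.

Lemma cols_gt0 : 0 < size cols.
Proof.
have : lab true 0 \in cols.
  rewrite mem_cat; apply/orP; left; apply/flatten_mapP; exists (lab true 0).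
    exact: lab_block C_gt0.
  by rewrite mem_nseq eqxx.
by case: cols.
Qed.

Lemma budget_gt0' : 0 < grid_budget C.
Proof. by rewrite /grid_budget /slack; have := C5; rewrite !mulnn; lia. Qed.

(** The remainder modulo [C] turns a color into an ordinal without changing it, by [color_lt]. The
    bound on distinct rows is the number of rows, so the input matrix meets it. *)
Definition grid_inst : fdmc bool :=
  @Fdmc bool (size rows) (size cols) C
    (\matrix_(i, j) (nth [::] cols j \in tags (nth (Side true 0) rows i)))
    [ffun i : 'I_(size rows) => Ordinal (ltn_pmod (color (nth (Side true 0) rows i)) C_gt0)]
    (grid_budget C) (size rows) rows_gt0 cols_gt0 budget_gt0' rows_gt0.

Local Notation desc := (fun i : 'I_(size rows) => nth (Side true 0) rows i).
Local Notation tag := (fun j : 'I_(size cols) => nth [::] cols j).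
Local Notation gamma := (coloring grid_inst).

Lemma grid_desc_row i : is_row C U S (desc i).
Proof. by rewrite -mem_rows mem_nth. Qed.

Lemma color_lt r : is_row C U S r -> color r < C.
Proof. by case: r => [a b u v c /and3P[]|a b c c' /and4P[]|o a]. Qed.

Lemma gammaE i c : (val (gamma i) == c) = (color (desc i) == c).
Proof. by rewrite ffunE /= modn_small // color_lt ?grid_desc_row. Qed.

Lemma gamma_eq i (c : 'I_C) : (gamma i == c) = (color (desc i) == c).
Proof. by rewrite -gammaE. Qed.

Lemma grid_code : tfdmc2 grid_inst =
  tseq [:: tseq [seq tseq [seq tbool (t \in tags r) | t <- cols] | r <- rows];
           tnat C; tseq [seq tnat (color r) | r <- rows];
           tnat (grid_budget C); tnat (size rows)].
Proof.
rewrite /tfdmc2 /=; congr (Node (tseq _) (Node _ (Node (tseq _) _))).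
  rewrite -(map_nth_enum (Side true 0) rows); apply: eq_map => i.
  congr tseq; rewrite -(map_nth_enum [::] cols); apply: eq_map => j.
  by rewrite mxE.
rewrite -(map_nth_enum (Side true 0) rows); apply: eq_map => i.
by congr tnat; apply/eqP; rewrite gammaE.
Qed.

Lemma card_color (c : 'I_C) : color_count gamma c = \sum_(r <- rows) (color r == c).
Proof.
rewrite /color_count -sum1_card big_mkcond -(sum_nth_ord (Side true 0)); apply: eq_bigr => i _.
by rewrite inE gamma_eq; case: eqP.
Qed.

Lemma card_color_eq (c c' : 'I_C) : color_count gamma c = color_count gamma c'.
Proof. by rewrite !card_color; apply: color_rows. Qed.

Lemma sum_color_count : \sum_(c < C) color_count gamma c = size rows.
Proof.
rewrite -[RHS]card_ord -sum1_card (partition_big (fun i => gamma i) xpredT) //=.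
by apply: eq_bigr => c _; rewrite /color_count -sum1_card; apply: eq_bigl => i; rewrite inE.
Qed.

Definition c0 : 'I_C := Ordinal C_gt0.

Lemma rows_color : size rows = C * color_count gamma c0.
Proof.
rewrite -sum_color_count (eq_bigr (fun=> color_count gamma c0)) => [|c _].
  by rewrite sum_nat_const card_ord.
exact: card_color_eq.
Qed.

Lemma color_count_gt0 : 0 < color_count gamma c0.
Proof. by have := rows_gt0; rewrite rows_color muln_gt0 => /andP[]. Qed.

Lemma grid_fairlet : fairlet_size gamma = C.
Proof.
rewrite /fairlet_size (eq_bigr (fun=> color_count gamma c0)) => [|c _]; last exact: card_color_eq.
have -> : \big[gcdn/0]_(i < C) color_count gamma c0 = color_count gamma c0.
  rewrite big_const card_ord; case: (C) C_gt0 => // k _.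
  by elim: k => [|k IH]; rewrite iterS ?gcdn0 // IH gcdnn.
change (size rows %/ color_count gamma c0 = C).
by rewrite rows_color mulnK // color_count_gt0.
Qed.

Section Fairness.
Variable A : 'M[bool]_(size rows, size cols).

Definition class_count (w : 'rV[bool]_(size cols)) (c : nat) :=
  #|[set i | (row i A == w) && (color (desc i) == c)]|.

Lemma sum_class_count w : \sum_(c < C) class_count w c = #|[set i | row i A == w]|.
Proof.
rewrite -[RHS]sum1_card (partition_big (fun i => gamma i) xpredT) //=.
apply: eq_bigr => c _; rewrite /class_count -sum1_card; apply: eq_bigl => i.
by rewrite !inE gamma_eq.
Qed.

Lemma clusterP S0 : cluster A S0 <-> exists i, S0 = [set k | row k A == row i A].
Proof.
split=> [/maxsetP[idS maxS]|[i ->]].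
  have [S00|[i iS]] := set_0Vmem S0.
    have := maxS [set Ordinal rows_gt0]; rewrite S00 sub0set => /(_ _ isT) H.
    have /setP/(_ (Ordinal rows_gt0)) : [set Ordinal rows_gt0] = set0.
      apply: H; apply/forall_inP => i; rewrite inE => /eqP ->.
      by apply/forall_inP => j; rewrite inE => /eqP ->.
    by rewrite !inE eqxx.
  exists i; apply/esym/maxS.
    apply/forall_inP => k; rewrite inE => /eqP ->.
    by apply/forall_inP => l; rewrite inE => /eqP ->.
  apply/subsetP => k kS; rewrite inE.
  by have /forall_inP/(_ _ kS)/forall_inP/(_ _ iS) := idS.
apply/maxsetP; split.
  apply/forall_inP => k; rewrite inE => /eqP ->.
  by apply/forall_inP => l; rewrite inE => /eqP ->.
move=> B idB sB; apply/eqP; rewrite eqEsubset sB andbT; apply/subsetP => k kB.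
rewrite inE; have iB : i \in B by apply: (subsetP sB); rewrite inE.
by have /forall_inP/(_ _ kB)/forall_inP/(_ _ iB) := idB.
Qed.

Lemma cluster_color i (c : 'I_C) :
  #|[set x in [set k | row k A == row i A] | gamma x == c]| = class_count (row i A) c.
Proof. by apply: eq_card => k; rewrite !inE gamma_eq. Qed.

(** All colors are equally frequent in the instance, so each prescribed proportion is [1/C]. *)
Lemma fairP : fair gamma A <->
  (forall w (c c' : 'I_C), class_count w c = class_count w c').
Proof.
split=> [H w c c'|H S0 /clusterP[i ->] c].
  have [/existsP[i /eqP iw]|no] := boolP [exists i, row i A == w]; last first.
    have Z d : class_count w d = 0.
      apply/eqP; rewrite cards_eq0; apply/eqP/setP => i; rewrite !inE.
      by apply/negP => /andP[iw _]; case/existsP: no; exists i.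
    by rewrite !Z.
  have cl : cluster A [set k | row k A == row i A] by apply/clusterP; exists i.
  have := H _ cl c; have := H _ cl c'; rewrite !cluster_color iw.
  rewrite -(card_color_eq c0 c) -(card_color_eq c0 c') => <- /eqP.
  by rewrite eqn_pmul2r ?rows_gt0 // => /eqP.
rewrite cluster_color -(card_color_eq c0 c) -sum_class_count.
rewrite (eq_bigr (fun=> class_count (row i A) c)) => [|c' _]; last exact: H.
rewrite sum_nat_const card_ord; apply: etrans (congr1 (muln _) rows_color) _.
by rewrite mulnC mulnAC -mulnA mulnCA mulnC -mulnA mulnCA.
Qed.

End Fairness.

Lemma edits_sum (A : 'M[bool]_(size rows, size cols)) : edits (mat grid_inst) A
  = \sum_(i < size rows) \sum_(j < size cols) ((tag j \in tags (desc i)) != A i j).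
Proof.
rewrite /edits -sum1dep_card big_mkcond pair_bigA; apply: eq_bigr => -[i j] _ /=.
by rewrite mxE; case: (_ != _).
Qed.

Theorem grid_inst_yes : fdmc_yes grid_inst <->
  exists u v : nat -> seq nat, forall a b, a < C -> b < C -> a != b ->
    [/\ u a \in U, v b \in U & S a b (u a) (v b)].
Proof.
have sum_desc F : \sum_i F (desc i) = \sum_(r <- rows) F r by rewrite sum_nth_ord.
split=> [[A [fA eA _]]|[u [v uvS]]].
  have desc_inj : injective desc.
    by move=> i k /eqP; rewrite nth_uniq ?uniq_rows // => /eqP/val_inj.
  have desc_surj r : is_row C U S r -> exists i, desc i = r.
    rewrite -mem_rows => rr; have lt : index r rows < size rows by rewrite index_mem.
    by exists (Ordinal lt); rewrite /= nth_index.
  apply: (@grid_sound C U S uniqU C5 _ _ desc tag (fun i j => A i j)) => //.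
  - exact: grid_desc_row.
  - move=> t tb; rewrite -sum1dep_card big_mkcond.
    rewrite (sum_nth_ord [::] cols (fun x => if x == t then 1 else 0)) -big_mkcond sum1_count.
    rewrite count_cat count_flatten -map_comp sumnE big_map.
    rewrite (eq_bigr (fun t' => (t' == t) * copies C)) => [|t' _]; last exact: count_nseq.
    rewrite (sum_pick1 t (fun=> copies C)) ?uniq_block_tags // tb mul1n.
    rewrite (count_uniq_mem _ (uniq_vertex_tags _ uniqU)) (_ : t \in vertex_tags C U = false) ?addn0 //.
    by apply/negP => /head_vertex h; have := head_block tb; rewrite h.
  - move=> t tv; have tc : t \in cols by rewrite mem_cat tv orbT.
    have lt : index t cols < size cols by rewrite index_mem.
    by exists (Ordinal lt); rewrite /= nth_index.
  - move=> w c c' cC c'C.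
    have := (fairP A).1 fA (\row_j w j)%R (Ordinal cC) (Ordinal c'C).
    have E i : (final (fun i j => A i j) i == w) = (row i A == (\row_j w j)%R).
      apply/eqP/eqP => [<-|H]; first by apply/rowP => j; rewrite !mxE ffunE.
      by apply/ffunP => j; have /rowP/(_ j) := H; rewrite !mxE ffunE.
    rewrite /class_count /= => H.
    by under eq_finset do rewrite E; under [in RHS]eq_finset do rewrite E.
  - by rewrite exchange_big -edits_sum.
  - exact: Ordinal rows_gt0.
pose A : 'M[bool]_(size rows, size cols) :=
  (\matrix_(i, j) (tag j \in dest u v (desc i)))%R.
exists A; split.
- apply/fairP => w c c'.
  have E (d : 'I_C) : class_count A w d =
      \sum_(r <- rows) ((\row_j (tag j \in dest u v r))%R == w) * (color r == d).
    rewrite /class_count -sum1_card big_mkcond -(sum_nth_ord (Side true 0)); apply: eq_bigr => i _.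
    rewrite inE (_ : row i A = (\row_j (tag j \in dest u v (desc i)))%R); last first.
      by apply/rowP => j; rewrite !mxE.
    by rewrite mulnb; case: (_ && _).
  by rewrite !E; apply: (dest_fair uniqU uvS (fun d => nat_of_bool ((\row_j (tag j \in d))%R == w))).
- apply: leq_trans (total_edits uniqU uvS C5).
  rewrite edits_sum leq_eqVlt -(sum_nth_ord (Side true 0)); apply/orP; left; apply/eqP.
  apply: eq_bigr => i _; rewrite /row_edits -(sum_nth_ord [::]).
  by apply: eq_bigr => j _; rewrite mxE.
- rewrite /distinct_rows; apply: leq_trans (leq_imset_card _ _) _.
  by rewrite card_ord.
Qed.
End GridInstance.

(** * From circuits of weft one to off-diagonal grid tiling *)

Section Run.
Variables (A : Type) (a0 : A) (step : nat -> gate -> (nat -> A) -> A).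
Hypothesis step_ext : forall i g v v',
  (forall j, j \in gate_args g -> v j = v' j) -> step i g v = step i g v'.

Lemma run_rcons gs g : run a0 step (rcons gs g) =
  rcons (run a0 step gs) (step (size (run a0 step gs)) g (nth a0 (run a0 step gs))).
Proof. by rewrite /run foldl_rcons. Qed.

Lemma size_run gs : size (run a0 step gs) = size gs.
Proof. by elim/last_ind: gs => // gs g IH; rewrite run_rcons !size_rcons IH. Qed.

(** Arguments precede their gate, so the final list of values satisfies the recursion. Every
    function on circuits is used through this equation. *)
Lemma run_nth gs i :
  (forall i, i < size gs -> gate_ok i (nth GInput gs i)) -> i < size gs ->
  nth a0 (run a0 step gs) i = step i (nth GInput gs i) (nth a0 (run a0 step gs)).
Proof.
elim/last_ind: gs i => // gs g IH i ok; rewrite size_rcons ltnS => le.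
have okg : gate_ok (size gs) g.
  by have := ok (size gs); rewrite size_rcons nth_rcons ltnn eqxx; apply.
rewrite run_rcons size_run !nth_rcons size_run.
have [lt|ge] := ltnP i (size gs).
  rewrite IH //; last first.
    by move=> j jlt; have := ok j; rewrite size_rcons nth_rcons jlt; apply; apply: ltnW.
  apply: step_ext => j ja; rewrite nth_rcons size_run.
  have := ok i; rewrite size_rcons nth_rcons lt => /(_ (ltnW lt)) /andP[_ /allP/(_ j ja) ji].
  by rewrite (ltn_trans ji lt).
have -> : i = size gs by apply/eqP; rewrite eqn_leq le ge.
rewrite eqxx; apply: step_ext => j ja; rewrite nth_rcons size_run.
by have /andP[_ /allP/(_ j ja) ->] := okg.
Qed.

End Run.

Definition large (g : gate) : bool := 2 < size (gate_args g).

Section Circuit.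
Variables (gs : seq gate) (out : nat).
Hypothesis gs_ok : forall i, i < size gs -> gate_ok i (nth GInput gs i).
Local Notation N := (size gs).
Local Notation gate_at := (nth GInput gs).

Lemma arg_lt i j : i < N -> j \in gate_args (gate_at i) -> j < i.
Proof. by move=> /gs_ok /andP[_ /allP]; apply. Qed.

(** The inputs and large gates reached from a gate through small gates. *)
Definition cut_step (i : nat) (g : gate) (v : nat -> seq nat) : seq nat :=
  if is_input g || large g then [:: i] else flatten [seq v j | j <- gate_args g].
Definition cut := nth [::] (run [::] cut_step gs).

Lemma cutE i : i < N -> cut i =
  if is_input (gate_at i) || large (gate_at i) then [:: i]
  else flatten [seq cut j | j <- gate_args (gate_at i)].
Proof.
move=> iN; rewrite /cut run_nth // => {iN}i g v v' E; rewrite /cut_step.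
by case: ifP => // _; congr flatten; apply/eq_in_map.
Qed.

Definition path_weight (w : gate -> nat) :=
  nth 0 (run 0 (fun _ g v => w g + \max_(j <- gate_args g) v j) gs).

Lemma path_weightE w i : i < N -> path_weight w i =
  w (gate_at i) + \max_(j <- gate_args (gate_at i)) path_weight w j.
Proof.
move=> iN; rewrite /path_weight run_nth // => {iN}i g v v' E.
by congr (_ + _); apply: eq_big_seq.
Qed.

Lemma path_weight_arg w i j : i < N -> j \in gate_args (gate_at i) ->
  w (gate_at i) + path_weight w j <= path_weight w i.
Proof.
move=> iN ja; rewrite [leqRHS]path_weightE // leq_add2l.
exact: (leq_bigmax_seq (F := path_weight w)).
Qed.

Lemma cut_ind (R : nat -> Prop) i : i < N ->
  (forall l, l \in cut i -> R l) ->
  (forall i, i < N -> ~~ (is_input (gate_at i) || large (gate_at i)) ->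
     (forall j, j \in gate_args (gate_at i) -> R j) -> R i) -> R i.
Proof.
move=> + + H; elim/ltn_ind: i => i IH iN; rewrite cutE //.
case: ifP => [_ Hl|/negbT sm Hl]; first by apply: Hl; rewrite inE.
apply: H => // j ja; have ji := arg_lt iN ja; apply: IH => //; first exact: ltn_trans iN.
by move=> l lj; apply: Hl; apply/flatten_mapP; exists j.
Qed.

Lemma cut_mem i l : i < N -> l \in cut i ->
  [/\ l < N, is_input (gate_at l) || large (gate_at l) &
      forall w, path_weight w l <= path_weight w i].
Proof.
elim/ltn_ind: i => i IH iN; rewrite cutE //; case: ifP => [il|_].
  by rewrite inE => /eqP ->.
case/flatten_mapP=> j ja lj; have ji := arg_lt iN ja.
have [lN ll wl] := IH j ji (ltn_trans ji iN) lj; split=> // w.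
by apply: leq_trans (wl w) _; apply: leq_trans (path_weight_arg w iN ja); apply: leq_addl.
Qed.

Local Notation wt := (path_weight (fun g => large g : nat)).
Local Notation dp := (path_weight (fun g => ~~ is_input g : nat)).

(** Small gates have at most two arguments, each of smaller depth. *)
Lemma size_cut i : i < N -> size (cut i) <= 2 ^ dp i.
Proof.
elim/ltn_ind: i => i IH iN; rewrite cutE //; case: ifP => [_|/negbT]; first by rewrite expn_gt0.
rewrite negb_or /large -leqNgt => /andP[ni s2].
have E (s : seq nat) : {subset s <= gate_args (gate_at i)} ->
    size (flatten [seq cut j | j <- s]) <= size s * 2 ^ (dp i).-1.
  elim: s => //= j s IHs sub; rewrite size_cat mulSn; apply: leq_add.
    have ja := sub j (mem_head _ _); have ji := arg_lt iN ja.
    apply: leq_trans (IH j ji (ltn_trans ji iN)) _; rewrite leq_exp2l //.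
    by have := path_weight_arg (fun g => ~~ is_input g : nat) iN ja; rewrite ni add1n; lia.
  by apply: IHs => l ls; apply: sub; rewrite inE ls orbT.
apply: leq_trans (E _ (fun _ => id)) _.
have dpos : 0 < dp i by rewrite path_weightE // ni.
by rewrite -[in leqRHS](prednK dpos) expnS leq_mul2r s2 orbT.
Qed.

Lemma weft0_cut i l : i < N -> wt i = 0 -> l \in cut i -> is_input (gate_at l).
Proof.
move=> iN w0 lc; have [lN il wl] := cut_mem iN lc.
move: il; case: (is_input _) => //= ll; have := wl (fun g => large g : nat).
by rewrite w0 (path_weightE _ lN) ll.
Qed.

(** The gate [l] uses up the weft, so no large gate is left at or below its arguments. *)
Lemma weft1_arg i l j : i < N -> wt i <= 1 -> l \in cut i -> large (gate_at l) ->
  j \in gate_args (gate_at l) -> [/\ j < N, wt j = 0 & dp j <= dp i].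
Proof.
move=> iN w1 lc ll ja; have [lN _ wl] := cut_mem iN lc; have jl := arg_lt lN ja.
split; first exact: ltn_trans lN.
- have := wl (fun g => large g : nat); have := path_weight_arg (fun g => large g : nat) lN ja.
  by rewrite ll; lia.
- have := wl (fun g => ~~ is_input g : nat).
  by have := path_weight_arg (fun g => ~~ is_input g : nat) lN ja; lia.
Qed.

(** ** Evaluation under partial information *)

Definition value_step (a : nat -> bool) (i : nat) (g : gate) (v : nat -> bool) :=
  match g with
  | GInput => a i
  | GNot j => ~~ v j
  | GAnd js => all v js
  | GOr js => has v js
  end.
Definition value a := nth false (run false (value_step a) gs).

Lemma valueE a i : i < N -> value a i = value_step a i (gate_at i) (value a).
Proof.
move=> iN; rewrite /value run_nth // => {iN}i [|j|js|js] v v' E //=.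
- by rewrite E // inE.
- exact: eq_in_all.
- exact: eq_in_has.
Qed.

(** An assertion [(g, h)] fixes the value of the large gate [g]: [h] names an
    argument that decides it, or no argument at all when it takes the value
    that has to be checked on every argument. *)
Definition claim (g : gate) (h : nat) : bool :=
  match g with GOr js => h \in js | GAnd js => h \notin js | _ => false end.

(** [z] consists of positions with their entries. Entries are input numbers plus one, as 0 is the
    left sentinel. An input is known to be unselected when two consecutive entries enclose it. *)
Definition known_in (z : seq (nat * nat)) (p : nat) := has (fun b => b.2 == p.+1) z.
Definition known_out (z : seq (nat * nat)) (p : nat) :=
  has (fun b => has (fun c => (c.1 == b.1.+1) && ((b.2 < p.+1) && (p.+1 < c.2))) z) z.

(** A rail pair tells whether a gate may still be true, and may still be false. *)
Definition rail_step (z asr : seq (nat * nat)) (i : nat) (g : gate) (v : nat -> bool * bool) :=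
  if large g then
    (has (fun b => (b.1 == i) && claim g b.2) asr,
     has (fun b => (b.1 == i) && ~~ claim g b.2) asr)
  else
    match g with
    | GInput => (~~ known_out z i, ~~ known_in z i)
    | GNot j => ((v j).2, (v j).1)
    | GAnd js => (all (fun j => (v j).1) js, has (fun j => (v j).2) js)
    | GOr js => (has (fun j => (v j).1) js, all (fun j => (v j).2) js)
    end.
Definition rails z asr := nth (false, false) (run (false, false) (rail_step z asr) gs).

Lemma railsE z asr i : i < N -> rails z asr i = rail_step z asr i (gate_at i) (rails z asr).
Proof.
move=> iN; rewrite /rails run_nth // => {iN}i g v v' E; rewrite /rail_step; case: ifP => // _.
case: g E => [|j|js|js] //= E.
- by rewrite E // inE.
- by congr pair; [apply: eq_in_all|apply: eq_in_has] => j /E ->.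
- by congr pair; [apply: eq_in_has|apply: eq_in_all] => j /E ->.
Qed.

(** The check only asks that the claim is not refuted by what is known. Beyond the last gate [nth]
    returns an input, so assertions that serve as padding pass. *)
Definition check_assertion (r : nat -> bool * bool) (b : nat * nat) : bool :=
  match gate_at b.1 with
  | GOr js => if b.2 \in js then (r b.2).1 else all (fun j => (r j).2) js
  | GAnd js => if b.2 \in js then (r b.2).2 else all (fun j => (r j).1) js
  | _ => true
  end.

(** Sound rails are conclusive, which requires that the relevant inputs are decided; complete rails
    never exclude the actual value, whatever is known. *)
Definition sound_rail a r i := ((r i : bool * bool).1 -> value a i) /\ ((r i).2 -> ~~ value a i).
Definition complete_rail a r i := (value a i -> (r i : bool * bool).1) /\ (~~ value a i -> (r i).2).

Lemma sound_rails a z asr i : i < N ->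
  (forall l, l \in cut i -> sound_rail a (rails z asr) l) -> sound_rail a (rails z asr) i.
Proof.
move=> iN H; apply: (cut_ind iN H) => {iN H}i iN; rewrite negb_or => /andP[ni sm] Hj.
rewrite /sound_rail railsE // valueE // /rail_step (negPf sm).
case: (gate_at i) ni Hj => [//|j|js|js] _ /= Hj.
- by have [|H1 H2] := Hj j; [rewrite inE|split=> // /H1; rewrite negbK].
- split=> [/allP H|/hasP[j jj H]]; last by apply/allPn; exists j => //; have [_] := Hj j jj; apply.
  by apply/allP => j jj; have [+ _] := Hj j jj; apply; apply: H.
- split=> [/hasP[j jj H]|/allP H]; first by apply/hasP; exists j => //; have [+ _] := Hj j jj; apply.
  by apply/hasPn => j jj; have [_] := Hj j jj; apply; apply: H.
Qed.

Lemma complete_rails a z asr i : i < N ->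
  (forall l, l \in cut i -> complete_rail a (rails z asr) l) -> complete_rail a (rails z asr) i.
Proof.
move=> iN H; apply: (cut_ind iN H) => {iN H}i iN; rewrite negb_or => /andP[ni sm] Hj.
rewrite /complete_rail railsE // valueE // /rail_step (negPf sm).
case: (gate_at i) ni Hj => [//|j|js|js] _ /= Hj.
- by have [|H1 H2] := Hj j; [rewrite inE|split=> //; rewrite negbK].
- split=> [/allP H|/allPn[j jj H]]; last by apply/hasP; exists j => //; have [_] := Hj j jj; apply.
  by apply/allP => j jj; have [+ _] := Hj j jj; apply; apply: H.
- split=> [/hasP[j jj H]|/hasPn H]; first by apply/hasP; exists j => //; have [+ _] := Hj j jj; apply.
  by apply/allP => j jj; have [_] := Hj j jj; apply; apply: H.
Qed.

(** The default [GNot 0] rejects entries beyond the last gate, which [GInput] would admit. *)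
Definition pos_ok (k : nat) (b : nat * nat) : bool :=
  [&& (b.1 == 0) ==> (b.2 == 0), (b.1 == k.+1) ==> (b.2 == N.+1)
    & (0 < b.1) && (b.1 <= k) ==> (0 < b.2) && is_input (nth (GNot 0) gs b.2.-1)].

Definition wf (k : nat) (z : seq (nat * nat)) : bool :=
  all (pos_ok k) z && all (fun b => all (fun c => (b.1 < c.1) ==> (b.2 < c.2)) z) z.

Definition assertions (q : nat) (ys : seq nat) := zip (take q ys) (drop q ys).

(** The first [2 * q] letters of [w] are the entries at the positions [P]; the others encode [q]
    assertions, gates before hints. *)
Definition check (q k : nat) (P w : seq nat) : bool :=
  let z := zip P (take (2 * q) w) in
  let asr := assertions q (drop (2 * q) w) in
  let r := rails z asr in
  [&& wf k z, (r out).1 & all (check_assertion r) asr].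

Section Positions.
Variables (q k : nat) (x : nat -> nat) (ys : seq nat).
Hypothesis q_gt0 : 0 < q.
Hypothesis outN : out < N.
Hypothesis wt_out : path_weight (fun g => large g : nat) out <= 1.
Hypothesis dp_out : 2 ^ path_weight (fun g => ~~ is_input g : nat) out <= q.
Local Notation wt := (path_weight (fun g => large g : nat)).
Local Notation dp := (path_weight (fun g => ~~ is_input g : nat)).

Definition graph (P : seq nat) := [seq (i, x i) | i <- P].

Lemma zip_graph P w : size P = 2 * q -> zip P (take (2 * q) (map x P ++ w)) = graph P.
Proof.
move=> sP; rewrite take_size_cat ?size_map // /graph.
by elim: P {sP} => //= i P ->.
Qed.

Lemma drop_graph P w : size P = 2 * q -> drop (2 * q) (map x P ++ w) = w.
Proof. by move=> sP; rewrite drop_size_cat ?size_map. Qed.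

Lemma checkE P : size P = 2 * q -> check q k P (map x P ++ ys) =
  let r := rails (graph P) (assertions q ys) in
  [&& wf k (graph P), (r out).1 & all (check_assertion r) (assertions q ys)].
Proof. by move=> sP; rewrite /check zip_graph // drop_graph. Qed.

Definition selected (p : nat) : bool := has (fun i => x i == p.+1) (iota 1 k).

Lemma known_inE P p : known_in (graph P) p = (p.+1 \in map x P).
Proof. by rewrite /known_in has_map -has_pred1 has_map; apply: eq_has => i; rewrite /= eq_sym. Qed.

Lemma known_outP P p : reflect (exists i, [/\ i \in P, i.+1 \in P & x i < p.+1 < x i.+1])
                               (known_out (graph P) p).
Proof.
apply: (iffP hasP) => [[b /mapP[i iP ->] /hasP[c /mapP[j jP ->] /= /andP[/eqP ji lt]]]|[i [iP iP' lt]]].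
  by exists i; rewrite -ji.
exists (i, x i); first by apply/mapP; exists i.
by apply/hasP; exists (i.+1, x i.+1); [apply/mapP; exists i.+1|rewrite /= eqxx].
Qed.

(** The sequence [x] lists the selected inputs, shifted by one, between two sentinels. *)
Definition listing := [/\ x 0 = 0, x k.+1 = N.+1,
  forall i j, i < j -> j <= k.+1 -> x i < x j &
  forall i, 0 < i <= k -> is_input (gate_at (x i).-1) /\ x i <= N].

Section Listing.
Hypothesis xP : listing.

Lemma x_pos i : 0 < i -> i <= k.+1 -> 0 < x i.
Proof. by move=> i0 ik; case: xP => [x0 _ inc _]; rewrite -x0; apply: inc. Qed.

Lemma known_in_sound P p : p < N -> all (fun i => i < k.+2) P ->
  known_in (graph P) p -> selected p.
Proof.
move=> pN /allP Pk; rewrite known_inE => /mapP[i iP E]; apply/hasP; exists i; last by rewrite E.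
case: xP => [x0 xk _ _]; rewrite mem_iota; have := Pk i iP; rewrite ltnS leq_eqVlt.
case/orP => [/eqP ik|ik]; first by rewrite ik xk in E; lia.
case: i {iP} E ik => [|i] E ik; first by rewrite x0 in E.
by rewrite add1n ik.
Qed.

Lemma known_out_sound P p : all (fun i => i < k.+2) P -> known_out (graph P) p -> ~~ selected p.
Proof.
move=> /allP Pk /known_outP[i [iP i1P /andP[lt1 lt2]]]; apply/hasPn => m; rewrite mem_iota.
case: xP => [x0 xk inc _] /andP[m1 mk]; have := Pk _ i1P; rewrite ltnS => ik.
apply/eqP => E; have [mi|im] := leqP m i.
  have : x m <= x i by move: mi; rewrite leq_eqVlt => /orP[/eqP ->//|mi]; apply/ltnW/inc => //; lia.
  by rewrite E; lia.
have : x i.+1 <= x m by move: im; rewrite leq_eqVlt => /orP[/eqP ->//|mi]; apply/ltnW/inc => //; lia.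
by rewrite E; lia.
Qed.

(** Two positions suffice to know whether a given input is selected. *)
Lemma deciding_positions p : p < N -> exists ij : nat * nat,
  [/\ ij.1 < k.+2, ij.2 < k.+2 & forall P, ij.1 \in P -> ij.2 \in P ->
      if selected p then known_in (graph P) p else known_out (graph P) p].
Proof.
move=> pN; case: xP => [x0 xk inc _]; have [/hasP[i]|ns] := boolP (selected p).
  rewrite mem_iota add1n => /andP[i0 ik] /eqP E; exists (i, i); split=> //=; try lia.
  by move=> P iP _; rewrite known_inE -E map_f.
have ex : exists i, p.+1 <= x i by exists k.+1; rewrite xk; lia.
(* The first entry that is at least [p.+1] and its predecessor enclose the place where [p] would be
   listed. *)
case: (ex_minnP ex) => -[|i] le mi; first by rewrite x0 in le.
have ik : i <= k by have := mi k.+1; rewrite xk ltnS; apply; lia.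
exists (i, i.+1); split=> //=; try lia.
move=> P iP i1P; apply/known_outP; exists i; split=> //.
have lt : x i < p.+1 by rewrite ltnNge; apply/negP => /mi; rewrite ltnn.
rewrite lt ltn_neqAle le andbT; apply/eqP => E.
have [ek|nk] := eqVneq i k; first by rewrite ek xk in E; lia.
case/hasP: ns; exists i.+1; last by rewrite E.
by rewrite mem_iota; move: nk ik; lia.
Qed.

(** Two positions for each of at most [q] inputs, padded with position 0: the origin of the length
    [2 * q]. Further positions never undo a decision, hence the induction over all [P'] containing
    [P]. *)
Lemma decided_word (ls : seq nat) : (forall l, l \in ls -> l < N) -> size ls <= q ->
  exists P, [/\ size P = 2 * q, all (fun i => i < k.+2) P &
    forall l, l \in ls -> if selected l then known_in (graph P) l else known_out (graph P) l].
Proof.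
move=> lsN sls.
have [P [sP aP dP]] : exists P, [/\ size P = 2 * size ls, all (fun i => i < k.+2) P &
    forall P', {subset P <= P'} -> forall l, l \in ls ->
    if selected l then known_in (graph P') l else known_out (graph P') l].
  elim: ls lsN {sls} => [|l ls IH] lsN; first by exists [::].
  have [|P [sP aP dP]] := IH; first by move=> l' l'l; apply: lsN; rewrite inE l'l orbT.
  have [[i j] [/= ik jk dij]] := deciding_positions (lsN l (mem_head _ _)).
  exists [:: i, j & P]; split; rewrite /= ?ik ?jk ?sP //; first by rewrite mulnS.
  move=> P' sub l'; rewrite inE => /orP[/eqP ->|]; last first.
    by apply: dP => m mP; apply: sub; rewrite !inE mP !orbT.
  by apply: dij; apply: sub; rewrite !inE eqxx ?orbT.
exists (P ++ nseq (2 * q - size P) 0); split.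
- by rewrite size_cat size_nseq; lia.
- by rewrite all_cat aP; apply/allP => i; rewrite mem_nseq => /andP[_ /eqP ->].
- by apply: dP => i iP; rewrite mem_cat iP.
Qed.

Lemma selected_weight :
  \sum_(i < N) (is_input (gate_at i) && selected i) = k.
Proof.
pose s := [seq (x i).-1 | i <- iota 1 k]; case: xP => [x0 xk inc inp].
have mi i : i \in iota 1 k -> 0 < i <= k by rewrite mem_iota add1n ltnS.
have us : uniq s.
  rewrite map_inj_in_uniq ?iota_uniq // => i j /mi ik /mi jk E.
  have xi : 0 < x i by apply: x_pos; lia.
  have xj : 0 < x j by apply: x_pos; lia.
  have [lt|gt|//] := ltngtP i j.
    by have := inc i j lt; lia.
  by have := inc j i gt; lia.
have E (i : 'I_N) : is_input (gate_at i) && selected i = (val i \in s).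
  apply/andP/mapP => [[_ /hasP[m mk /eqP xm]]|[m mk im]]; first by exists m => //; rewrite xm.
  have mk' := mi m mk; have [im' _] := inp m mk'; rewrite im; split=> //.
  by apply/hasP; exists m => //; rewrite prednK // x_pos; lia.
rewrite -[RHS](size_iota 1) -(size_map (fun i => (x i).-1)) -/s -[RHS]sum1_size.
transitivity (\sum_(i < N) \sum_(y <- s) (y == i) * 1).
  by apply: eq_bigr => i _; rewrite E (sum_pick1 (val i) (fun=> 1) us) muln1.
rewrite exchange_big; apply: eq_big_seq => y /mapP[m /mi mk ->] /=.
have yN : (x m).-1 < N by have [_ le] := inp m mk; have := @x_pos m; lia.
rewrite (bigD1 (Ordinal yN)) //= eqxx big1 ?addn0 // => i ni.
by rewrite muln1; apply/eqP; rewrite eqb0; apply: contra ni => /eqP xi; apply/eqP/val_inj.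
Qed.

Lemma graph_wf P : all (fun i => i < k.+2) P -> wf k (graph P).
Proof.
case: xP => [x0 xk inc inp] /allP Pk; apply/andP; split.
  apply/allP => b /mapP[i iP ->]; rewrite /pos_ok /=; apply/and3P; split.
  - by apply/implyP => /eqP ->; rewrite x0.
  - by apply/implyP => /eqP ->; rewrite xk.
  - apply/implyP => ik; have [ii le] := inp i ik; rewrite x_pos; try lia.
    by rewrite (set_nth_default GInput) //; have := @x_pos i; lia.
apply/allP => b /mapP[i iP ->]; apply/allP => c /mapP[j jP ->] /=.
by apply/implyP => ij; apply: inc => //; have := Pk j jP; rewrite ltnS.
Qed.

(** ** Soundness *)

Section Sound.
Hypothesis ok : forall P, size P = 2 * q -> all (fun i => i < k.+2) P ->
  check q k P (map x P ++ ys).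
Local Notation asr := (assertions q ys).

Lemma sound_input P l : all (fun i => i < k.+2) P -> l < N -> is_input (gate_at l) ->
  (if selected l then known_in (graph P) l else known_out (graph P) l) ->
  sound_rail selected (rails (graph P) asr) l.
Proof.
move=> Pk lN il; rewrite /sound_rail railsE // valueE // /rail_step.
case: (gate_at l) il => //= _; case: ifP => [sl ->|ns ->] //=.
Qed.

(** Every input below a gate of weft zero can be decided by a single word of positions. *)
Lemma weft0_sound i : i < N -> wt i = 0 -> dp i <= dp out -> exists P,
  [/\ size P = 2 * q, all (fun i => i < k.+2) P & sound_rail selected (rails (graph P) asr) i].
Proof.
move=> iN wi di; have [||P [sP Pk dP]] := @decided_word (cut i).
- by move=> l /(cut_mem iN) [].
- apply: leq_trans (size_cut iN) _; apply: leq_trans dp_out.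
  by rewrite leq_exp2l.
exists P; split=> //; apply: sound_rails => // l lc.
have [lN _ _] := cut_mem iN lc.
by apply: sound_input => //; [apply: weft0_cut lc|apply: dP].
Qed.

(** The checks hold for all words [P] with the same assertions. So each argument of the large gate
    may be decided by a word of its own, however many arguments there are. *)
Lemma claim_sound l h : l \in cut out -> large (gate_at l) -> (l, h) \in asr ->
  claim (gate_at l) h = value selected l.
Proof.
move=> lc ll la; have [lN _ _] := cut_mem outN lc.
have args j : j \in gate_args (gate_at l) -> exists2 r : nat -> bool * bool,
    sound_rail selected r j & check_assertion r (l, h).
  move=> /(weft1_arg outN wt_out lc ll) [jN w0 dj].
  have [P [sP Pk sj]] := weft0_sound jN w0 dj.
  exists (rails (graph P) asr) => //.
  by have := ok sP Pk; rewrite checkE // => /and3P[_ _ /allP]; apply.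
rewrite valueE //; move: args ll; rewrite /check_assertion /=.
case: (gate_at l) => [|j|js|js] //= args ll.
- have [hj|nh] := boolP (h \in js).
    have [r [_ s2]] := args h hj; rewrite hj => /s2 nv.
    by apply/esym/negbTE/allPn; exists h.
  apply/esym/allP => j jj; have [r [s1 _]] := args j jj.
  by rewrite (negPf nh) => /allP/(_ j jj)/s1.
- have [hj|nh] := boolP (h \in js).
    have [r [s1 _]] := args h hj; rewrite hj => /s1 v.
    by apply/esym/hasP; exists h.
  apply/esym/negbTE/hasPn => j jj; have [r [_ s2]] := args j jj.
  by rewrite (negPf nh) => /allP/(_ j jj)/s2.
Qed.

Lemma circuit_sound : value selected out.
Proof.
have [||P [sP Pk dP]] := @decided_word (cut out).
- by move=> l /(cut_mem outN) [].
- exact: leq_trans (size_cut outN) dp_out.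
have := ok sP Pk; rewrite checkE // => /and3P[_ + _].
have [+ _] : sound_rail selected (rails (graph P) asr) out; last by apply.
apply: sound_rails => // l lc; have [lN il _] := cut_mem outN lc.
have [ii|ni] := boolP (is_input (gate_at l)); first by apply: sound_input => //; apply: dP.
have ll : large (gate_at l) by rewrite (negPf ni) in il.
rewrite /sound_rail railsE // /rail_step ll /=; split=> /hasP[[l' h] la /andP[/eqP /= el c]];
  by rewrite el in la; rewrite -(claim_sound lc ll la).
Qed.

End Sound.
(** ** Completeness *)

Section Complete.
Hypothesis v_out : value selected out.
Local Notation v := (value selected).

(** [N.+1] is no gate number; it says that no argument decides the gate. The certificate is padded
    with assertions about the nonexistent gate [N.+1]. *)
Definition witness (l : nat) : nat :=
  match gate_at l with
  | GOr js => nth N.+1 js (find v js)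
  | GAnd js => nth N.+1 js (find (predC v) js)
  | _ => N.+1
  end.

Definition asserted := [seq l <- cut out | large (gate_at l)].
Definition certificate :=
  [seq (l, witness l) | l <- asserted] ++ nseq (q - size asserted) (N.+1, 0).
Definition certificate_word := unzip1 certificate ++ unzip2 certificate.

Lemma size_certificate : size certificate = q.
Proof.
rewrite size_cat size_map size_nseq subnKC // size_filter.
by apply: leq_trans (count_size _ _) _; apply: leq_trans (size_cut outN) dp_out.
Qed.

Lemma certificateK : assertions q certificate_word = certificate.
Proof.
rewrite /assertions /certificate_word take_size_cat ?size_map ?size_certificate //.
by rewrite drop_size_cat ?size_map ?size_certificate // zip_unzip.
Qed.

Lemma args_lt l j : l < N -> j \in gate_args (gate_at l) -> j != N.+1.
Proof. by move=> lN /(arg_lt lN) jl; rewrite neq_ltn (ltn_trans jl) // ltnW. Qed.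

Lemma witness_claim l : l < N -> large (gate_at l) -> claim (gate_at l) (witness l) = v l.
Proof.
move=> lN; rewrite valueE // /witness; have := @args_lt l^~ lN.
case: (gate_at l) => [|j|js|js] //= jsN _.
- have [all_v|] := boolP (all v js).
    rewrite nth_default; first by apply/negP => /jsN; rewrite eqxx.
    by rewrite leqNgt -has_find has_predC all_v.
  by rewrite -has_predC => h; rewrite mem_nth // -has_find.
- have [h|nh] := boolP (has v js); first by rewrite mem_nth // -has_find.
  rewrite nth_default; first by apply/negP => /jsN; rewrite eqxx.
  by rewrite leqNgt -has_find.
Qed.

Lemma certificate_bound : all (fun m => m < N.+2) certificate_word.
Proof.
have lN l : l \in asserted -> l < N by rewrite mem_filter => /andP[_ /(cut_mem outN) []].
rewrite all_cat !all_map; apply/andP; split; apply/allP => b;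
  rewrite mem_cat => /orP[/mapP[l la ->]|]; rewrite ?mem_nseq ?(nseqP _) /=; last 1 first.
- by case/andP=> _ /eqP ->.
- by have := lN l la; lia.
- by case/andP=> _ /eqP ->.
rewrite /witness; have := @args_lt l^~ (lN l la); have /arg_lt H := lN l la.
have nthN (p : pred nat) js : {subset js <= gate_args (gate_at l)} -> nth N.+1 js (find p js) < N.+2.
  move=> sub; have [h|nh] := boolP (has p js).
    have /sub/H lt := mem_nth N.+1 (etrans (esym (has_find p js)) h).
    by apply: (ltn_trans lt); have := lN l la; lia.
  by rewrite nth_default // leqNgt -has_find.
by move=> _; case E: (gate_at l) nthN => [|j|js|js] nthN //; apply: nthN.
Qed.

Lemma complete_input P l : all (fun i => i < k.+2) P -> l < N -> is_input (gate_at l) ->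
  complete_rail selected (rails (graph P) certificate) l.
Proof.
move=> Pk lN il; rewrite /complete_rail railsE // valueE // /rail_step.
case: (gate_at l) il => //= _; split; first by apply: contraL; apply: known_out_sound.
by apply: contra; apply: known_in_sound.
Qed.

Lemma weft0_complete P i : all (fun i => i < k.+2) P -> i < N -> wt i = 0 ->
  complete_rail selected (rails (graph P) certificate) i.
Proof.
move=> Pk iN wi; apply: complete_rails => // l lc; have [lN _ _] := cut_mem iN lc.
by apply: complete_input => //; apply: weft0_cut lc.
Qed.

Lemma circuit_complete P : size P = 2 * q -> all (fun i => i < k.+2) P ->
  check q k P (map x P ++ certificate_word).
Proof.
move=> sP Pk; rewrite /check zip_graph // drop_graph // certificateK.
rewrite graph_wf //=; apply/andP; split.
  have [/(_ v_out)//] : complete_rail selected (rails (graph P) certificate) out.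
  apply: complete_rails => // l lc; have [lN il _] := cut_mem outN lc.
  have [ii|ni] := boolP (is_input (gate_at l)); first exact: complete_input.
  have ll : large (gate_at l) by rewrite (negPf ni) in il.
  have la : (l, witness l) \in certificate.
    by rewrite mem_cat map_f // mem_filter ll.
  rewrite /complete_rail railsE // /rail_step ll /=.
  by split=> vl; apply/hasP; exists (l, witness l); rewrite //= eqxx witness_claim.
apply/allP => b; rewrite mem_cat => /orP[/mapP[l]|]; last first.
  by rewrite mem_nseq => /andP[_ /eqP ->]; rewrite /check_assertion /= nth_default.
rewrite mem_filter => /andP[ll lc] ->; rewrite /check_assertion /=.
have [lN _ _] := cut_mem outN lc; have := witness_claim lN ll; have := valueE selected lN.
have arg j : j \in gate_args (gate_at l) -> complete_rail selected (rails (graph P) certificate) j.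
  by case/(weft1_arg outN wt_out lc ll) => jN w0 _; apply: weft0_complete.
rewrite /witness; case E: (gate_at l) arg => [|j|js|js] //= arg -> cl.
- case: ifP => [wj|wj].
    have [_] := arg _ wj; apply; move: wj cl; set m := nth _ _ _ => -> /esym/allPn nv.
    have := nth_find N.+1 (a := predC v) (s := js); rewrite has_predC -/m; apply.
    by apply/allPn.
  by apply/allP => j jj; have [+ _] := arg j jj; apply; move: cl; rewrite wj => /esym/allP; apply.
- case: ifP => [wj|wj].
    have [+ _] := arg _ wj; apply; move: wj cl; set m := nth _ _ _ => -> /esym h.
    exact: nth_find.
  by apply/allP => j jj; have [_] := arg j jj; apply; move: cl; rewrite wj => /esym/negbT/hasPn; apply.
Qed.

End Complete.
End Listing.

(** The consistency checks force [x] to be a listing. *)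
Lemma checked_listing :
  (forall P, size P = 2 * q -> all (fun i => i < k.+2) P -> check q k P (map x P ++ ys)) ->
  listing.
Proof.
move=> ok.
have pair i j : i < k.+2 -> j < k.+2 -> wf k (graph [:: i; j]).
  (* Any two positions occur in a common word, so pairwise checks within words cover the whole
     list. *)
  move=> ik jk; pose P := [:: i, j & nseq (2 * q - 2) i].
  have sP : size P = 2 * q by rewrite /= size_nseq; lia.
  have Pk : all (fun i => i < k.+2) P.
    by rewrite /= ik jk; apply/allP => l; rewrite mem_nseq => /andP[_ /eqP ->].
  have := ok P sP Pk; rewrite checkE // => /and3P[/andP[/allP w1 /allP w2] _ _].
  have sub : {subset graph [:: i; j] <= graph P}.
    by move=> b; rewrite !inE => /orP[] /eqP ->; rewrite eqxx ?orbT.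
  apply/andP; split; first by apply/allP => b /sub/w1.
  by apply/allP => b /sub/w2 /allP H; apply/allP => c /sub/H.
have pos i : i < k.+2 -> pos_ok k (i, x i).
  by move=> ik; have := pair i i ik ik; rewrite /wf /= => /andP[/andP[]].
split.
- by have /and3P[/implyP/(_ (eqxx _))/eqP] := pos 0 isT.
- by have /and3P[_ /implyP/(_ (eqxx _))/eqP] := pos k.+1 (ltnSn _).
- move=> i j ij jk; have := pair i j; rewrite !ltnS => /(_ _ jk).
  rewrite /wf /= ij /= => H; have /H : i <= k.+1 by lia.
  by case/andP=> _ /andP[/and3P[_ ->]].
- move=> i ik; have /and3P[_ _ /implyP /= H] : pos_ok k (i, x i) by apply: pos; lia.
  have /andP[x0 ii] := H ik.
  have le : (x i).-1 < N.
    by rewrite ltnNge; apply/negP => ge; rewrite nth_default in ii.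
  by rewrite (set_nth_default (GNot 0)) //; split=> //; lia.
Qed.

End Positions.

Lemma value_ext a a' i : (forall p, p < N -> is_input (gate_at p) -> a p = a' p) ->
  i < N -> value a i = value a' i.
Proof.
move=> E; elim/ltn_ind: i => i IH iN; rewrite !valueE //.
have H j : j \in gate_args (gate_at i) -> value a j = value a' j.
  by move=> ja; have ji := arg_lt iN ja; apply: IH => //; apply: ltn_trans iN.
have := E i iN; case: (gate_at i) H => [|j|js|js] /= H Ei.
- exact: Ei.
- by rewrite H // inE.
- exact: eq_in_all.
- exact: eq_in_has.
Qed.

Lemma listing_exists k (a : nat -> bool) :
  \sum_(i < N) (is_input (gate_at i) && a i) = k -> exists2 x, listing k x &
  (forall p, p < N -> is_input (gate_at p) -> selected k x p = a p) /\
  (forall i, x i < N.+2).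
Proof.
move=> ka; pose Sel := [seq p <- iota 0 N | is_input (gate_at p) && a p].
have sS : size Sel = k.
  rewrite size_filter -sum1_count big_mkcond -ka -(big_mkord xpredT
    (fun i => nat_of_bool (is_input (gate_at i) && a i))) /index_iota subn0.
  by apply: eq_bigr => i _; case: (_ && _).
pose s := 0 :: rcons (map succn Sel) N.+1; exists (nth 0 s).
  have mem i : 0 < i <= k -> exists2 p, p \in Sel & nth 0 s i = p.+1.
    case: i => // i /= ik; exists (nth 0 Sel i); first by rewrite mem_nth // sS.
    by rewrite nth_rcons size_map sS ik (nth_map 0) // sS.
  split=> //; first by rewrite /= nth_rcons size_map sS ltnn eqxx.
    have srt : sorted ltn s.
      rewrite /s /= rcons_path; apply/andP; split.
        rewrite path_min_sorted; last by apply/allP => _ /mapP[p _ ->].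
        have: sorted ltn Sel by apply: sorted_filter (iota_ltn_sorted 0 N); apply: ltn_trans.
        by apply: homo_sorted.
      have := mem_last 0 (map succn Sel); rewrite inE => /orP[/eqP ->//|/mapP[p]].
      by rewrite mem_filter mem_iota => /andP[_ /andP[_ pN]] ->.
    move=> i j ij jk; apply: (sorted_ltn_nth ltn_trans) => //.
      by rewrite inE /= size_rcons size_map sS; lia.
    by rewrite inE /= size_rcons size_map sS; lia.
  move=> i /mem[p pS ->]; move: pS; rewrite mem_filter mem_iota.
  by case/andP=> /andP[ip _] /andP[_ pN]; split.
split=> [p pN ip|i].
  rewrite /selected; apply/hasP/idP => [[i]|ap].
    rewrite mem_iota add1n => /andP[i0 ik]; case: i i0 ik => // i _ ik /=.
    rewrite nth_rcons size_map sS (_ : i < k = true) // (nth_map 0) ?sS // => /eqP [E].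
    have : nth 0 Sel i \in Sel by rewrite mem_nth // sS.
    by rewrite E mem_filter => /andP[/andP[]].
  have pS : p \in Sel by rewrite mem_filter ip ap mem_iota.
  exists (index p Sel).+1; first by rewrite mem_iota add1n !ltnS -sS index_mem.
  by rewrite /= nth_rcons size_map index_mem pS (nth_map 0) ?index_mem // nth_index.
have [lt|ge] := ltnP i (size s); last by rewrite nth_default.
have := mem_nth 0 lt; rewrite inE mem_rcons inE => /or3P[/eqP ->//|/eqP ->//|/mapP[p]].
by rewrite mem_filter mem_iota => /andP[_ /andP[_ pN]] ->; rewrite ltnS ltnW.
Qed.

(** ** The tiling instance *)

Section Tiling.
Variables (q k : nat).
Hypothesis q_gt0 : 0 < q.
Hypothesis outN : out < N.
Hypothesis wt_out : path_weight (fun g => large g : nat) out <= 1.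
Hypothesis dp_out : 2 ^ path_weight (fun g => ~~ is_input g : nat) out <= q.

Definition position_words := words (2 * q) (iota 0 k.+2).
Definition value_words := words (4 * q) (iota 0 N.+2).
(** Every word of positions occurs twice, so that a row and a column may carry it. *)
Definition class (a : nat) : seq nat := nth [::] (position_words ++ position_words) a.
Definition classes := size (position_words ++ position_words).

Definition compatible (P w P' w' : seq nat) : bool :=
  all (fun b => all (fun c => (b.1 == c.1) ==> (b.2 == c.2)) (zip P' (take (2 * q) w')))
    (zip P (take (2 * q) w))
  && (drop (2 * q) w == drop (2 * q) w').

Definition tile (a b : nat) (w w' : seq nat) : bool :=
  [&& check q k (class a) w, check q k (class b) w' & compatible (class a) w (class b) w'].

Lemma position_wordP P :
  (P \in position_words) = (size P == 2 * q) && all (fun i => i < k.+2) P.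
Proof. by rewrite mem_words; congr (_ && _); apply: eq_all => i; exact: mem_iota. Qed.

Lemma value_wordP w :
  (w \in value_words) = (size w == 4 * q) && all (fun i => i < N.+2) w.
Proof. by rewrite mem_words; congr (_ && _); apply: eq_all => i; exact: mem_iota. Qed.

Lemma class_mem a : a < classes -> class a \in position_words.
Proof. by move=> ac; have := mem_nth [::] ac; rewrite mem_cat orbb. Qed.

Lemma classes_gt4 : 4 < classes.
Proof.
rewrite /classes size_cat size_words size_iota.
have : 2 ^ 2 <= k.+2 ^ (2 * q).
  by apply: leq_trans (leq_exp 2 (_ : 2 <= k.+2)) _ => //; rewrite leq_exp2l //; lia.
lia.
Qed.

Lemma nth_zip_mem (P s : seq nat) i : i < size P -> size P = size s ->
  (nth 0 P i, nth 0 s i) \in zip P s.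
Proof.
by move=> iP ss; rewrite -nth_zip // mem_nth // size_zip -ss minnn.
Qed.

(** Rows use the first copy of the words and columns the second, so any two words meet off the
    diagonal. The entry at position [i] is read off the row of the constant word [i]; compatibility
    with these rows makes every column word the restriction of one list, with one common guess. *)
Lemma tiling_sound : (exists u v : nat -> seq nat,
    forall a b, a < classes -> b < classes -> a != b ->
    [/\ u a \in value_words, v b \in value_words & tile a b (u a) (v b)]) ->
  exists a : nat -> bool, \sum_(i < N) (is_input (gate_at i) && a i) = k /\ value a out.
Proof.
move=> [u [v uvT]]; pose K := size position_words.
have KK : classes = K + K by rewrite /classes size_cat.
pose const (i : nat) := nseq (2 * q) i.
have const_mem i : i < k.+2 -> const i \in position_words.
  move=> ik; rewrite position_wordP size_nseq eqxx.
  by apply/allP => j; rewrite mem_nseq => /andP[_ /eqP ->].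
pose ix P := index P position_words.
have ixK P : P \in position_words -> ix P < K by rewrite index_mem.
have cl_ix P : P \in position_words -> class (ix P) = P.
  by move=> PP; rewrite /class nth_cat ixK // nth_index.
have cl_ix2 P : P \in position_words -> class (K + ix P) = P.
  by move=> PP; rewrite /class nth_cat ltnNge leq_addr /= addKn nth_index.
have T P P' : P \in position_words -> P' \in position_words ->
    [/\ u (ix P) \in value_words, v (K + ix P') \in value_words,
        check q k P' (v (K + ix P')) & compatible P (u (ix P)) P' (v (K + ix P'))].
  move=> PP PP'; have := ixK P PP; have := ixK P' PP' => lt' lt.
  have [||| uU vU] := uvT (ix P) (K + ix P'); rewrite ?KK; try lia.
  by rewrite /tile cl_ix // cl_ix2 // => /and3P[].
pose x i := nth 0 (u (ix (const i))) 0.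
pose ys := drop (2 * q) (u (ix (const 0))).
have word P : size P = 2 * q -> all (fun i => i < k.+2) P -> v (K + ix P) = map x P ++ ys.
  move=> sP aP; have PP : P \in position_words by rewrite position_wordP sP eqxx.
  rewrite -[LHS](cat_take_drop (2 * q)); congr (_ ++ _); last first.
    by have [_ _ _ /andP[_ /eqP]] := T _ _ (const_mem 0 isT) PP.
  have [_ + _ _] := T _ _ PP PP; rewrite value_wordP => /andP[/eqP sv _].
  have st : size (take (2 * q) (v (K + ix P))) = 2 * q by rewrite size_takel // sv; lia.
  apply: (@eq_from_nth _ 0); first by rewrite st size_map sP.
  move=> s; rewrite st => sq; rewrite (nth_map 0) ?sP //.
  have sk : nth 0 P s < k.+2 by move/allP: aP; apply; rewrite mem_nth ?sP.
  have [uU _ _ /andP[/allP H _]] := T _ _ (const_mem _ sk) PP.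
  move: uU; rewrite value_wordP => /andP[/eqP su _].
  have su' : size (take (2 * q) (u (ix (const (nth 0 P s))))) = 2 * q.
    by rewrite size_takel // su; lia.
  have m1 := @nth_zip_mem (const (nth 0 P s)) _ 0 _ (etrans (size_nseq _ _) (esym su')).
  have {m1}m1 := m1 ltac:(by rewrite size_nseq; lia).
  have m2 := @nth_zip_mem P (take (2 * q) (v (K + ix P))) s.
  rewrite sP st in m2; have {m2}m2 := m2 sq erefl.
  have /allP/(_ _ m2)/implyP /= := H _ m1.
  rewrite nth_nseq (_ : 0 < 2 * q) ?eqxx; last by lia.
  by move=> /(_ isT) /eqP <-; rewrite nth_take //; lia.
have ok P : size P = 2 * q -> all (fun i => i < k.+2) P -> check q k P (map x P ++ ys).
  move=> sP aP; rewrite -word //.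
  by have [||] := T P P; rewrite ?position_wordP ?sP ?eqxx.
have xP : listing k x by apply: (checked_listing (q := q) (ys := ys)).
exists (selected k x); split; first exact: (selected_weight (q := q)).
exact: (circuit_sound q_gt0 outN wt_out dp_out xP ok).
Qed.

Lemma tiling_complete (a : nat -> bool) :
  \sum_(i < N) (is_input (gate_at i) && a i) = k -> value a out ->
  exists u v : nat -> seq nat,
    forall a b, a < classes -> b < classes -> a != b ->
    [/\ u a \in value_words, v b \in value_words & tile a b (u a) (v b)].
Proof.
move=> wa va; have [x xP [sel_a xN]] := listing_exists wa.
have vs : value (selected k x) out by rewrite (value_ext sel_a).
set ys := certificate_word q k x.
pose u c := map x (class c) ++ ys.
have ok c : c < classes -> size (class c) = 2 * q /\ all (fun i => i < k.+2) (class c).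
  by move=> /class_mem; rewrite position_wordP => /andP[/eqP].
have uV c : c < classes -> u c \in value_words.
  move=> /ok[sc ac]; rewrite value_wordP size_cat size_map sc size_cat !size_map.
  rewrite size_certificate // all_cat all_map certificate_bound // andbT.
  by apply/andP; split; [apply/eqP; lia|apply/allP => i _ /=; apply: xN].
exists u, u => c d cc dc _; split; [exact: uV|exact: uV|].
have [sc ac] := ok c cc; have [sd ad] := ok d dc.
rewrite /tile !circuit_complete //= /compatible /u !zip_graph // !drop_graph // eqxx andbT.
apply/allP => _ /mapP[i _ ->]; apply/allP => _ /mapP[j _ ->] /=.
by apply/implyP => /eqP ->.
Qed.

End Tiling.
End Circuit.

(** * The reduction is computable in polynomial time *)

Lemma poly_pred A {eA : Enc A} (n : A -> nat) : poly n -> poly (fun x => (n x).-1).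
Proof.
move=> pn; apply: (@poly_eq _ _ _ _ (fun x => n x - 1)) => [|x]; last exact: subn1.
by apply: poly_subn => //; apply: poly_const.
Qed.

(** Works by the head symbol of the function; hypotheses settle subterms that were made opaque, also
    after a composition. *)
Ltac poly_step := cbv beta; lazymatch goal with
  | |- poly (fun x => x) => exact poly_id
  | |- poly fst => exact (poly_fst poly_id)
  | |- poly snd => exact (poly_snd poly_id)
  | |- poly (fun _ => ?b) => exact (poly_const b)
  | H : poly ?f |- poly ?f => exact H
  | |- poly (fun x => fst (@?f x)) => apply (poly_fst (f := f))
  | |- poly (fun x => snd (@?f x)) => apply (poly_snd (f := f))
  | |- poly (fun x => (@?f x, @?g x)) => apply (poly_pair (f := f) (g := g))
  | |- poly (fun x => cons (@?f x) (@?g x)) => apply (poly_cons (f := f) (g := g))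
  | |- poly (fun x => cat (@?f x) (@?g x)) => apply (poly_cat (l := f) (t := g))
  | |- poly (fun x => flatten (@?f x)) => apply (poly_flatten (l := f))
  | |- poly (fun x => map (@?g x) (@?l x)) => apply (poly_map (g := g) (l := l))
  | |- poly (fun x => filter (@?p x) (@?l x)) => apply (poly_filter (p := p) (l := l))
  | |- poly (fun x => has (@?p x) (@?l x)) => apply (poly_has (p := p) (l := l))
  | |- poly (fun x => all (@?p x) (@?l x)) => apply (poly_all (p := p) (l := l))
  | |- poly (fun x => negb (@?b x)) => apply (poly_negb (b := b))
  | |- poly (fun x => andb (@?b x) (@?c x)) => apply (poly_andb (b := b) (c := c))
  | |- poly (fun x => implb (@?b x) (@?c x)) => apply (poly_implb (b := b) (c := c))
  | |- poly (fun x => leq (@?m x) (@?n x)) => apply (poly_leq (m := m) (n := n))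
  | |- poly (fun x => @eq_op Datatypes_nat__canonical__eqtype_Equality (@?m x) (@?n x)) =>
      apply (poly_eqn (m := m) (n := n))
  | |- poly (fun x => addn (@?m x) (@?n x)) => apply (poly_addn (m := m) (n := n))
  | |- poly (fun x => muln (@?m x) (@?n x)) => apply (poly_muln (m := m) (n := n))
  | |- poly (fun x => succn (@?n x)) => apply (poly_succ (n := n))
  | |- poly (fun x => predn (@?n x)) => apply (poly_pred (n := n))
  | |- poly (fun x => size (@?l x)) => apply (poly_size (l := l))
  | |- poly (fun x => drop (@?n x) (@?l x)) => apply (poly_drop (n := n) (l := l))
  | |- poly (fun x => take (@?n x) (@?l x)) => apply (poly_take (n := n) (l := l))
  | |- poly (fun x => zip (@?l x) (@?t x)) => apply (poly_zip (s := l) (t := t))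
  | |- poly (fun x => nth ?b (@?l x) (@?n x)) => apply (poly_nth b (n := n) (l := l))
  | |- poly (fun x => nseq (@?n x) (@?b x)) => apply (poly_nseq (n := n) (b := b))
  | |- poly (fun x => iota 0 (@?n x)) => apply (poly_iota (n := n))
  | |- poly (fun x => words ?t (@?s x)) => apply (poly_words t (s := s))
  | H : poly ?p |- poly (fun q => ?p (@?f q)) => apply (poly_comp (g := p) (f := f))
  | |- poly ?f => match f with context [if _ then _ else _] => refine (poly_if _ _ _) end
  end.
Ltac polys := repeat poly_step.

(** Selectors for the encoding of gates: the kind and a payload, which is a number up to kind 1 and
    a list from kind 2 on. *)
Definition gkind (g : gate) : nat :=
  match g with GInput => 0 | GNot _ => 1 | GAnd _ => 2 | GOr _ => 3 end.
Definition gnot (g : gate) : nat := if g is GNot j then j else 0.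
Definition gjs (g : gate) : seq nat := match g with GAnd js | GOr js => js | _ => [::] end.

Lemma poly_gkind A {eA : Enc A} (g : A -> gate) : poly g -> poly (fun x => gkind (g x)).
Proof.
move=> pg; apply: (poly_comp (g := gkind) (f := g)) => //.
apply: (poly_expr (e := EHd (EVar 0))) => [[|j|js|js] s /= -> //|].
by apply: pb_le (pb_const 7) _ => -[|j|js|js].
Qed.

Lemma poly_payload B {eB : Enc B} (f : gate -> B) (hi lo : expr) :
  (forall g s, s 0 = enc g ->
     eval s (if 1 < gkind g then hi else lo) = enc (f g)) ->
  (forall g, esize (f g) <= esize g) -> poly f.
Proof.
move=> H le; exists (If (ETl (EHd (EVar 0))) (Assign 0 hi) (Assign 0 lo)), (fun g => (esize g).+2); split.
  by do 2!apply: pb_S; apply: pb_size.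
move=> g s s0; have := H g s s0; have := le g; case: ifP => hg leg E.
  exists (tsize (eval s hi)).+1.+1, (update s 0 (eval s hi)); split.
  - by apply: ExecIfTrue; [rewrite /= s0; case: g hg {s0 E leg}|constructor].
  - by rewrite /update.
  - by rewrite E.
exists (tsize (eval s lo)).+1.+1, (update s 0 (eval s lo)); split.
- by apply: ExecIfFalse; [rewrite /= s0; case: g hg {s0 E leg}|constructor].
- by rewrite /update.
- by rewrite E.
Qed.

Lemma esize_gate g : esize g =
  (gkind g).*2.+1 + (if 1 < gkind g then esize (gjs g) else esize (gnot g)) + 1.
Proof. by case: g => [|j|js|js]; rewrite addn1. Qed.

Lemma poly_gnot A {eA : Enc A} (g : A -> gate) : poly g -> poly (fun x => gnot (g x)).
Proof.
move=> pg; apply: (poly_comp (g := gnot) (f := g)) => //.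
apply: (@poly_payload _ _ _ ENil (ETl (EVar 0))) => [g0 s E|h].
  by case: g0 E => [|j|js|js] /= E; rewrite ?E.
by rewrite (esize_gate h); case: h => [|j|js|js] /=; lia.
Qed.

Lemma poly_gjs A {eA : Enc A} (g : A -> gate) : poly g -> poly (fun x => gjs (g x)).
Proof.
move=> pg; apply: (poly_comp (g := gjs) (f := g)) => //.
apply: (@poly_payload _ _ _ (ETl (EVar 0)) ENil) => [g0 s E|h].
  by case: g0 E => [|j|js|js] /= E; rewrite ?E.
by rewrite (esize_gate h); case: h => [|j|js|js] /=; lia.
Qed.

Lemma largeE g : large g = (2 < size (gjs g)).
Proof. by case: g. Qed.

Lemma claimE g h : claim g h =
  if gkind g == 3 then h \in gjs g else if gkind g == 2 then ~~ (h \in gjs g) else false.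
Proof. by case: g. Qed.

Lemma rail_stepE z asr i g v : rail_step z asr i g v =
  if 2 < size (gjs g) then
    (has (fun b => (b.1 == i) && claim g b.2) asr,
     has (fun b => (b.1 == i) && ~~ claim g b.2) asr)
  else if gkind g == 0 then (~~ known_out z i, ~~ known_in z i)
  else if gkind g == 1 then ((v (gnot g)).2, (v (gnot g)).1)
  else if gkind g == 2 then
    (all (fun j => (v j).1) (gjs g), has (fun j => (v j).2) (gjs g))
  else (has (fun j => (v j).1) (gjs g), all (fun j => (v j).2) (gjs g)).
Proof. by rewrite /rail_step largeE; case: g. Qed.

Lemma poly_known_in A {eA : Enc A} (z : A -> seq (nat * nat)) (p : A -> nat) :
  poly z -> poly p -> poly (fun x => known_in (z x) (p x)).
Proof. by move=> pz pp; rewrite /known_in; polys. Qed.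

Lemma poly_known_out A {eA : Enc A} (z : A -> seq (nat * nat)) (p : A -> nat) :
  poly z -> poly p -> poly (fun x => known_out (z x) (p x)).
Proof. by move=> pz pp; rewrite /known_out; polys. Qed.

Lemma poly_claim A {eA : Enc A} (g : A -> gate) (h : A -> nat) :
  poly g -> poly h -> poly (fun x => claim (g x) (h x)).
Proof.
move=> pg ph; have pk := poly_gkind pg; have pj := poly_gjs pg.
apply: (poly_eq _ (fun x => esym (claimE (g x) (h x)))).
have pm : poly (fun x => h x \in gjs (g x)) by apply: poly_mem_nat.
by polys.
Qed.

Lemma poly_rail_step A {eA : Enc A} (z asr : A -> seq (nat * nat)) (i : A -> nat)
    (g : A -> gate) (vs : A -> seq (bool * bool)) :
  poly z -> poly asr -> poly i -> poly g -> poly vs ->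
  poly (fun x => rail_step (z x) (asr x) (i x) (g x) (nth (false, false) (vs x))).
Proof.
move=> pz pasr pi pg pvs; have pk := poly_gkind pg; have pj := poly_gjs pg; have pn := poly_gnot pg.
have pin := poly_known_in pz pi; have pout := poly_known_out pz pi.
have pc : poly (fun b : A * (nat * nat) => claim (g b.1) b.2.2).
  by apply: poly_claim; polys.
apply: (poly_eq _ (fun x => esym (rail_stepE (z x) (asr x) (i x) (g x) _))).
by polys.
Qed.

Definition rail_run gs z asr := run (false, false) (rail_step z asr) gs.

Lemma poly_rail_run A {eA : Enc A} (gs : A -> seq gate) (z asr : A -> seq (nat * nat)) :
  poly gs -> poly z -> poly asr -> poly (fun x => rail_run (gs x) (z x) (asr x)).
Proof.
move=> pgs pz pasr; rewrite /rail_run /run.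
pose h x (vs : seq (bool * bool)) g :=
  rcons vs (rail_step (z x) (asr x) (size vs) g (nth (false, false) vs)).
apply: (poly_foldl (h := h) (l := gs) (b := fun=> [::])) => //; first exact: poly_const.
  rewrite /h; apply: (@poly_eq _ _ _ _ (fun p : A * seq (bool * bool) * gate =>
    p.1.2 ++ [:: rail_step (z p.1.1) (asr p.1.1) (size p.1.2) p.2 (nth (false, false) p.1.2)])).
    have ps : poly (fun p : A * seq (bool * bool) * gate =>
        rail_step (z p.1.1) (asr p.1.1) (size p.1.2) p.2 (nth (false, false) p.1.2)).
      by apply: poly_rail_step; polys.
    by polys.
  by move=> p; rewrite cats1.
(* A pair of booleans has size at most 7, and its list node adds one. *)
exists (fun x => esize (gs x) * 8 + 1).
  apply: pb_add; last exact: pb_const.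
  by apply: pb_mul; [apply: poly_pb|apply: pb_const].
move=> x i; have E (s : seq (bool * bool)) : esize s <= size s * 8 + 1.
  elim: s => // -[b1 b2] s IH; rewrite esize_cons esize_pair /=.
  by case: b1 b2 => [] [] /=; move: IH; lia.
apply: leq_trans (E _) _; rewrite leq_add2r leq_mul2r /=.
have -> : foldl (h x) [::] (take i (gs x)) = run (false, false) (rail_step (z x) (asr x)) (take i (gs x)) by [].
rewrite size_run size_take_min; apply: leq_trans (geq_minr _ _) _.
exact/ltnW/esize_size.
Qed.

Lemma check_assertionE gs r b : check_assertion gs r b =
  if gkind (nth GInput gs b.1) == 3 then
    if b.2 \in gjs (nth GInput gs b.1) then (r b.2).1
    else all (fun j => (r j).2) (gjs (nth GInput gs b.1))
  else if gkind (nth GInput gs b.1) == 2 then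
    if b.2 \in gjs (nth GInput gs b.1) then (r b.2).2
    else all (fun j => (r j).1) (gjs (nth GInput gs b.1))
  else true.
Proof. by rewrite /check_assertion; case: nth. Qed.

Lemma poly_check_assertion A {eA : Enc A} (gs : A -> seq gate) (V : A -> seq (bool * bool))
    (b : A -> nat * nat) : poly gs -> poly V -> poly b ->
  poly (fun x => check_assertion (gs x) (nth (false, false) (V x)) (b x)).
Proof.
move=> pgs pV pb.
have pg : poly (fun x => nth GInput (gs x) (b x).1) by polys.
have pk := poly_gkind pg; have pj := poly_gjs pg.
have pm : poly (fun x => (b x).2 \in gjs (nth GInput (gs x) (b x).1)).
  by apply: poly_mem_nat; polys.
apply: (poly_eq _ (fun x => esym (check_assertionE (gs x) _ (b x)))).
move: pk pj pm; set kd := fun x => gkind _; set js := fun x => gjs _; set m := fun x => _ \in _.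
move=> pk pj pm.
change (poly (fun x => if kd x == 3 then if m x then (nth (false, false) (V x) (b x).2).1
    else all (fun j => (nth (false, false) (V x) j).2) (js x)
  else if kd x == 2 then if m x then (nth (false, false) (V x) (b x).2).2
    else all (fun j => (nth (false, false) (V x) j).1) (js x) else true)).
by move: kd js m pk pj pm => kd js m pk pj pm; polys.
Qed.

Lemma poly_wf A {eA : Enc A} (gs : A -> seq gate) (k : A -> nat) (z : A -> seq (nat * nat)) :
  poly gs -> poly k -> poly z -> poly (fun x => wf (gs x) (k x) (z x)).
Proof.
move=> pgs pk pz; rewrite /wf.
have pi : poly (fun b : A * (nat * nat) => is_input (nth (GNot 0) (gs b.1) b.2.2.-1)).
  apply: (@poly_eq _ _ _ _ (fun b : A * (nat * nat) => gkind (nth (GNot 0) (gs b.1) b.2.2.-1) == 0)).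
    have pn : poly (fun b : A * (nat * nat) => nth (GNot 0) (gs b.1) b.2.2.-1) by polys.
    by have pg := poly_gkind pn; polys.
  by move=> b; case: nth.
by rewrite /pos_ok; polys.
Qed.

Lemma poly_check A {eA : Enc A} q (gs : A -> seq gate) (out k : A -> nat) (P w : A -> seq nat) :
  poly gs -> poly out -> poly k -> poly P -> poly w ->
  poly (fun x => check (gs x) (out x) q (k x) (P x) (w x)).
Proof.
move=> pgs pout pk pP pw.
have pz : poly (fun x => zip (P x) (take (2 * q) (w x))) by polys.
have pasr : poly (fun x => assertions q (drop (2 * q) (w x))) by rewrite /assertions; polys.
have pr := poly_rail_run pgs pz pasr; have pwf := poly_wf pgs pk pz.
have pca : poly (fun b : A * (nat * nat) => check_assertion (gs b.1)
   (nth (false, false) (rail_run (gs b.1) (zip (P b.1) (take (2 * q) (w b.1)))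
     (assertions q (drop (2 * q) (w b.1))))) b.2).
  apply: poly_check_assertion; [by polys| |by polys].
  exact: (poly_comp (f := fun b : A * (nat * nat) => b.1) pr (poly_fst poly_id)).
rewrite /check /rails -/(rail_run _ _ _); move: pwf pca pasr pr.
set f1 := fun x => wf _ _ _; set f2 := fun x => assertions _ _; set f3 := fun x => rail_run _ _ _.
set f4 := fun b => check_assertion _ _ _ => pwf pca pasr pr.
change (poly (fun x => [&& f1 x, (nth (false, false) (f3 x) (out x)).1 & all (fun b => f4 (x, b)) (f2 x)])).
by move: f1 f2 f3 f4 pwf pca pasr pr => f1 f2 f3 f4 pwf pca pasr pr; polys.
Qed.

Lemma poly_compatible A {eA : Enc A} q (P w P' w' : A -> seq nat) :
  poly P -> poly w -> poly P' -> poly w' ->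
  poly (fun x => compatible q (P x) (w x) (P' x) (w' x)).
Proof.
move=> pP pw pP' pw'; rewrite /compatible.
have pe : poly (fun x => drop (2 * q) (w x) == drop (2 * q) (w' x)).
  by apply: poly_eqseq; polys.
by polys.
Qed.

Lemma poly_tile A {eA : Enc A} q (gs : A -> seq gate) (out k a b : A -> nat)
    (w w' : A -> seq nat) : poly gs -> poly out -> poly k -> poly a -> poly b ->
  poly w -> poly w' -> poly (fun x => tile (gs x) (out x) q (k x) (a x) (b x) (w x) (w' x)).
Proof.
move=> pgs pout pk pa pb pw pw'; rewrite /tile.
have pca : poly (fun x => class q (k x) (a x)) by rewrite /class /position_words; polys.
have pcb : poly (fun x => class q (k x) (b x)) by rewrite /class /position_words; polys.
have p1 := poly_check q pgs pout pk pca pw; have p2 := poly_check q pgs pout pk pcb pw'.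
by have p3 := poly_compatible q pca pw pcb pw'; polys.
Qed.

(** The reduction reads only the tags and the color of a row, so these represent it. *)
#[global] Instance enc_rdesc : Enc rdesc := fun r => enc (tags r, color r).

Lemma poly_row A {eA : Enc A} (r : A -> rdesc) :
  poly (fun x => tags (r x)) -> poly (fun x => color (r x)) -> poly r.
Proof.
move=> pt pc; have := poly_pair pt pc.
by move=> H; apply: (poly_recode (h := id) H).
Qed.

Lemma poly_tags A {eA : Enc A} (r : A -> rdesc) : poly r -> poly (fun x => tags (r x)).
Proof.
move=> pr; apply: (poly_comp (g := tags) (f := r)) => //.
exact: (@poly_recode _ _ _ _ _ _ _ _ fst tags (fun r => (tags r, color r)) (poly_fst poly_id)).
Qed.

Lemma poly_color A {eA : Enc A} (r : A -> rdesc) : poly r -> poly (fun x => color (r x)).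
Proof.
move=> pr; apply: (poly_comp (g := color) (f := r)) => //.
exact: (@poly_recode _ _ _ _ _ _ _ _ snd color (fun r => (tags r, color r)) (poly_snd poly_id)).
Qed.

Ltac grid_step := cbv beta; lazymatch goal with
  | |- poly (fun x => Cell (@?a x) (@?b x) (@?u x) (@?v x) (@?c x)) =>
      apply poly_row; rewrite /tags /color /TL /lab /vtx
  | |- poly (fun x => Hub (@?a x) (@?b x) (@?c x) (@?d x)) =>
      apply poly_row; rewrite /tags /color /TL /lab /TB
  | |- poly (fun x => Side _ (@?a x)) => apply poly_row; rewrite /tags /color /lab
  | _ => poly_step
  end.

Section PolyGrid.
Context (A : Type) {eA : Enc A}.
Variables (C : A -> nat) (U : A -> seq (seq nat)).
Variable Sf : A * (nat * nat * (seq nat * seq nat)) -> bool.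
Hypotheses (pC : poly C) (pU : poly U) (pS : poly Sf).

Lemma poly_grid_rows :
  poly (fun x => grid_rows (C x) (U x) (fun a b w w' => Sf (x, ((a, b), (w, w'))))).
Proof. by rewrite /grid_rows /idx2 /sel /others /except /idx; repeat grid_step. Qed.

Lemma poly_grid_cols : poly (fun x => grid_cols (C x) (U x)).
Proof.
rewrite /grid_cols /block_tags /vertex_tags /copies /slack /idx2 /others /idx /TB /TL /lab /vtx.
by polys.
Qed.

Lemma poly_grid_budget : poly (fun x => grid_budget (C x)).
Proof. by rewrite /grid_budget /copies /block_cost /slack; polys. Qed.

End PolyGrid.

Definition circuit_data : Type := (seq gate * nat) * nat * nat.
Definition fdmc_data : Type :=
  (seq (seq bool) * (nat * (seq nat * (nat * (nat * unit))))) * nat.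

Definition reduction (q : nat) (x : circuit_data) : fdmc_data :=
  let gs := x.1.1.1 in let out := x.1.1.2 in let k := x.1.2 in
  let C := classes q k in
  let rows := grid_rows C (value_words gs q) (tile gs out q k) in
  let cols := grid_cols C (value_words gs q) in
  (([seq [seq t \in tags r | t <- cols] | r <- rows],
    (C, ([seq color r | r <- rows], (grid_budget C, (size rows, tt))))),
   C + grid_budget C).

(** For fixed [q] there are polynomially many value words and, as the weight is in unary,
    polynomially many position words. Naming the parts of the instance makes them opaque to
    [polys]. *)
Lemma poly_reduction q : poly (reduction q).
Proof.
have pC : poly (fun x : circuit_data => classes q x.1.2).
  by rewrite /classes /position_words; polys.
have pU : poly (fun x : circuit_data => value_words x.1.1.1 q).
  by rewrite /value_words; polys.
have pS : poly (fun y : circuit_data * (nat * nat * (seq nat * seq nat)) =>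
    tile y.1.1.1.1 y.1.1.1.2 q y.1.1.2 y.2.1.1 y.2.1.2 y.2.2.1 y.2.2.2).
  by apply: poly_tile; polys.
have pR := poly_grid_rows pC pU pS; have pcols := poly_grid_cols pC pU.
have pB := poly_grid_budget pC; rewrite /reduction.
have pM : poly (fun y : circuit_data * rdesc * seq nat => y.2 \in tags y.1.2).
  by apply: poly_mem_seq; [polys|apply: poly_tags; polys].
have pc : poly (fun y : circuit_data * rdesc => color y.2) by apply: poly_color; polys.
move: pR pcols pB pC pM pc; rewrite /=.
set f1 := fun x : circuit_data => grid_rows _ _ _.
set f2 := fun x : circuit_data => grid_cols _ _.
set f3 := fun x : circuit_data => grid_budget _.
set f4 := fun x : circuit_data => classes _ _.
set f5 := fun y => _ \in _.
set f6 := fun y => color _ => pR pcols pB pC pM pc.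
change (poly (fun x => (([seq [seq f5 (x, r, t) | t <- f2 x] | r <- f1 x],
    (f4 x, ([seq f6 (x, r) | r <- f1 x], (f3 x, (size (f1 x), tt))))), f4 x + f3 x))).
by move: f1 f2 f3 f4 f5 f6 pR pcols pB pC pM pc => f1 f2 f3 f4 f5 f6 *; polys.
Qed.

(** * Parameterized reductions *)

Lemma computable_comp (f g : nat -> nat) :
  computable f -> poly g -> computable (fun k => g (f k)).
Proof.
move=> [c H] [c' [F [_ H']]]; exists (Seq c c') => k.
have [n [s X E]] := H k; have [n' [s' [X' E' _]]] := H' (f k) s E.
by exists (n + n'), s' => //; apply: ExecSeq X X'.
Qed.

Lemma poly_exp A {eA : Enc A} (f : A -> nat) e : poly f -> poly (fun x => f x ^ e).
Proof.
move=> pf; elim: e => [|e IH]; first exact: poly_const.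
by apply: (poly_eq (poly_muln pf IH)) => x; rewrite expnS.
Qed.

(** By [exec_size] the intermediate instance has size at most [(f1 k + 1) n^(e1 + 1)] for inputs of
    size [n]; a polynomial of this is again a function of [k] times a power of [n]. *)
Lemma fpt_reducible_comp (P Q Q' : pproblem) (R : inst Q -> inst Q') (g : nat -> nat) :
  fpt_reducible P Q -> @poly _ _ (@pcode Q) (@pcode Q') R ->
  (forall y, yes y <-> yes (R y)) ->
  poly g -> {homo g : m n / m <= n} -> (forall y, param (R y) <= g (param y)) ->
  fpt_reducible P Q'.
Proof.
move=> [R1 [c1 [f1 [g1 [e1 [cf1 cg1 ok1 pa1 run1]]]]]] [c [F [[a [e bF]] H]]] ok pg mg pa.
exists (fun x => R (R1 x)), (Seq c1 c), (fun k => f1 k + a * (f1 k).+1 ^ e), (fun k => g (g1 k)),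
  (e1 + e1.+1 * e); split.
- apply: (computable_comp (g := fun m => m + a * m.+1 ^ e)) => //.
  by have pe := poly_exp e (poly_succ (@poly_id nat _)); polys.
- exact: computable_comp.
- by move=> x; rewrite ok1 ok.
- by move=> x; apply: leq_trans (pa _) _; apply: mg.
move=> x; have [n1 [s X E] le1] := run1 x.
have [n [s' [X' E' le]]] := H (R1 x) s E.
exists (n1 + n); first by exists s' => //; apply: ExecSeq X X'.
have sz : tsize (pcode (R1 x)) <= (f1 (param x)).+1 * tsize (pcode x) ^ e1.+1.
  rewrite -E; apply: leq_trans (exec_size X 0) _; rewrite geq_max /update /=.
  have s1 : 0 < tsize (pcode x) ^ e1 by rewrite expn_gt0 tsize_gt0.
  rewrite mulSn expnS; apply/andP; split.
    by apply: leq_trans (leq_addr _ _); rewrite leq_pmulr.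
  apply: leq_trans le1 (leq_trans _ (leq_addl _ _)).
  by rewrite leq_mul2l leq_pmull ?tsize_gt0 ?orbT.
rewrite mulnDl leq_add //.
  by apply: leq_trans le1 _; rewrite leq_mul2l leq_pexp2l ?tsize_gt0 ?leq_addr ?orbT.
apply: leq_trans le _; apply: leq_trans (bF _) _; rewrite -mulnA leq_mul2l.
apply/orP; right; apply: leq_trans (leq_exp e sz) _.
rewrite expnMn -expnM leq_mul2l leq_pexp2l ?tsize_gt0 ?orbT //.
exact: leq_addl.
Qed.

(** * Hardness from circuits of weft one *)

Section WeftOne.
Variable d : nat.
Local Notation q := (2 ^ d).
Local Notation source := (WCS_weft_depth 1 d).
Local Notation target := (@restrict FDMC2 (fun I : fdmc bool =>
  is_true (distinct_rows (mat I) <= row_bound I))).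
Local Notation gs x := (gates (sval x).1).
Local Notation out x := (output (sval x).1).

Lemma source_weft (x : inst source) :
  path_weight (gs x) (fun g => large g : nat) (out x) <= 1.
Proof. by case: x => x /= /andP[]. Qed.

Lemma source_depth (x : inst source) :
  2 ^ path_weight (gs x) (fun g => ~~ is_input g : nat) (out x) <= q.
Proof. by case: x => x /= /andP[_ dx]; rewrite leq_exp2l. Qed.

Lemma q_gt0 : 0 < q. Proof. by rewrite expn_gt0. Qed.

Lemma uniq_value_words gs : uniq (value_words gs q).
Proof. exact/uniq_words/iota_uniq. Qed.

Definition circuit_grid (x : inst source) : fdmc bool :=
  grid_inst (tile (gs x) (out x) q (param x)) (uniq_value_words (gs x))
    (classes_gt4 (param x) q_gt0 (output_ok (sval x).1) (source_weft x) (source_depth x)).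

Lemma circuit_grid_rows x :
  is_true (distinct_rows (mat (circuit_grid x)) <= row_bound (circuit_grid x)).
Proof. by apply: leq_trans (leq_imset_card _ _) _; rewrite card_ord. Qed.

Definition circuit_target (x : inst source) : inst target :=
  exist _ (circuit_grid x) (circuit_grid_rows x).

Lemma circuit_grid_yes (x : inst source) : yes x <-> fdmc_yes (circuit_grid x).
Proof.
rewrite grid_inst_yes; split.
  move=> [a wa va].
  exact: (tiling_complete (@gates_ok _) q_gt0 (output_ok _) (source_weft x) (source_depth x) wa va).
move=> /(tiling_sound (@gates_ok _) q_gt0 (output_ok _) (source_weft x) (source_depth x)).
by case=> a [wa va]; exists a.
Qed.

Definition circuit_param k := classes q k + grid_budget (classes q k).

Lemma circuit_grid_param x : param (circuit_target x) = circuit_param (param x).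
Proof.
have E : fairlet_size (coloring (circuit_grid x)) = classes q (param x) by exact: grid_fairlet.
change (fairlet_size (coloring (circuit_grid x)) + budget (circuit_grid x) = circuit_param (param x)).
by rewrite E.
Qed.

Lemma classes_mono : {homo classes q : m n / m <= n}.
Proof. by move=> m n le; rewrite /classes !size_cat !size_words !size_iota leq_add // leq_exp. Qed.

Lemma circuit_param_mono : {homo circuit_param : m n / m <= n}.
Proof.
move=> m n /classes_mono ; rewrite /circuit_param /grid_budget /copies /block_cost /slack.
move: (classes q m) (classes q n) => M N le.
have le1 : M.-1 <= N.-1 by lia.
have le2 : M.-2 <= N.-2 by lia.
by rewrite !(leq_add, leq_mul, ltnS).
Qed.

Lemma poly_circuit_param : poly circuit_param.
Proof.
have pc : poly (classes q) by rewrite /classes /position_words; polys.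
have pb := poly_grid_budget pc.
exact: poly_addn pc pb.
Qed.

(** Codes do not mention the proofs inside instances, so the program for bare data serves. The
    weight occurs twice in the input, in the code and as the parameter. *)
Lemma poly_circuit_target : @poly _ _ (@pcode source) (@pcode target) circuit_target.
Proof.
apply: (@poly_recode _ _ _ _ _ _ _ _ (reduction q) circuit_target
  (fun x => ((gs x, out x), (sval x).2, (sval x).2)) (poly_reduction q)) => // x.
rewrite /enc /pcode circuit_grid_param.
change (code (circuit_target x)) with (tfdmc2 (circuit_grid x)); rewrite grid_code.
set rows := grid_rows _ _ _; set cols := grid_cols _ _.
have -> : [seq tseq [seq tbool (t \in tags r) | t <- cols] | r <- rows] =
    map enc [seq [seq t \in tags r | t <- cols] | r <- rows].
  by rewrite -map_comp; apply: eq_map => r /=; rewrite /enc /enc_seq -map_comp.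
have -> : [seq tnat (color r) | r <- rows] = map enc [seq color r | r <- rows].
  by rewrite -map_comp.
by [].
Qed.

End WeftOne.

Theorem theorem1 :
  W_hard 1 FDMC2 /\
  W_hard 1 (@restrict FDMC2 (fun I : fdmc bool =>
              is_true (distinct_rows (mat I) <= row_bound I))).
Proof.
(* A restricted instance has the same code and parameter as the underlying one, so the same program
   reduces to the unrestricted problem. *)
suff H : W_hard 1 (@restrict FDMC2 (fun I : fdmc bool =>
    is_true (distinct_rows (mat I) <= row_bound I))).
  split=> // P /H [R [c [f [g [e [cf cg ok pa run]]]]]].
  by exists (fun x => sval (R x)), c, f, g, e.
move=> P [d red]; apply: fpt_reducible_comp red (@poly_circuit_target d) _
  (poly_circuit_param d) (@circuit_param_mono d) _ => y.
  exact: circuit_grid_yes.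
by rewrite circuit_grid_param.
Qed.
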